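(* Let $K$ be a subfield of $\mathbb{R}$. The first order theory of the ordered $K$-vector space $\mathbb{R}$ (i.e. the structure $(\mathbb{R},<,+,(x\mapsto bx)_{b\in K})$) expanded by a unary predicate for $\mathbb{Z}$ is decidable if and only if $K=\mathbb{Q}(a)$ for some quadratic $a\in\mathbb{R}$ (equivalently, $[K:\mathbb{Q}]\le 2$).
   Context: A real number is quadratic if it is a solution of a quadratic equation with rational coefficients (so rational numbers are quadratic). *)

(* Defs.v *)
From mathcomp Require Import all_boot all_order all_algebra.
From mathcomp Require Import boolp classical_sets reals.

Set Implicit Arguments.
Unset Strict Implicit.
Unset Printing Implicit Defensive.
Import Order.TTheory GRing.Theory Num.Theory.

Local Open Scope classical_set_scope.
Local Open Scope ring_scope.

(* Total recursive functions: the least class of total functions containing   *)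
(* zero, successor and projections, and closed under composition, primitive   *)
(* recursion and minimisation of regular functions. The defining equations    *)
(* are hypotheses on [h], so that the class is closed under pointwise         *)
(* equality.                                                                  *)
Inductive recursive : forall k, (k.-tuple nat -> nat) -> Prop :=
| rec_zero k (h : k.-tuple nat -> nat) :
    (forall v, h v = 0%N) -> recursive h
| rec_succ (h : 1.-tuple nat -> nat) :
    (forall v, h v = (tnth v ord0).+1) -> recursive h
| rec_proj k (i : 'I_k) (h : k.-tuple nat -> nat) :
    (forall v, h v = tnth v i) -> recursive h
| rec_comp k m (f : m.-tuple nat -> nat) (g : 'I_m -> k.-tuple nat -> nat)
    (h : k.-tuple nat -> nat) :
    recursive f -> (forall i, recursive (g i)) ->
    (forall v, h v = f [tuple g i v | i < m]) -> recursive h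
| rec_prim k (f : k.-tuple nat -> nat) (g : k.+2.-tuple nat -> nat)
    (h : k.+1.-tuple nat -> nat) :
    recursive f -> recursive g ->
    (forall v : k.-tuple nat, h [tuple of 0%N :: v] = f v) ->
    (forall n (v : k.-tuple nat),
         h [tuple of n.+1 :: v] =
         g [tuple of n :: h [tuple of n :: v] :: v]) ->
    recursive h
| rec_min k (f : k.+1.-tuple nat -> nat) (h : k.-tuple nat -> nat) :
    recursive f ->
    (forall v : k.-tuple nat, f [tuple of h v :: v] = 0%N) ->
    (forall (v : k.-tuple nat) n, (n < h v)%N -> f [tuple of n :: v] <> 0%N) ->
    recursive h.

Definition computable (A : set nat) : Prop :=
  exists2 f : 1.-tuple nat -> nat,
    recursive f & forall n, f [tuple n] = nat_of_bool `[< A n >].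

(* First-order language {<, +, (s . _)_(s : S), Int} with equality, with      *)
(* named variables; the other connectives and the universal quantifier are    *)
(* classical abbreviations.                                                   *)
Inductive term (S : Type) : Type :=
| Tvar of nat
| Tadd of term S & term S
| Tscale of S & term S.

Inductive formula (S : Type) : Type :=
| Feq of term S & term S
| Flt of term S & term S
| Fint of term S
| Fnot of formula S
| Fand of formula S & formula S
| Fex of nat & formula S.

Fixpoint term_vars S (t : term S) : seq nat :=
  match t with
  | Tvar n => [:: n]
  | Tadd t u => term_vars t ++ term_vars u
  | Tscale _ t => term_vars t
  end.

Fixpoint free_vars S (p : formula S) : seq nat :=
  match p with
  | Feq t u | Flt t u => term_vars t ++ term_vars u
  | Fint t => term_vars t
  | Fnot p => free_vars p
  | Fand p q => free_vars p ++ free_vars q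
  | Fex n p => [seq m <- free_vars p | m != n]
  end.

Definition sentence S (p : formula S) : bool := nilp (free_vars p).

Fixpoint term_val (R : realType) S (i : S -> R) (e : nat -> R) (t : term S)
    : R :=
  match t with
  | Tvar n => e n
  | Tadd t u => term_val i e t + term_val i e u
  | Tscale s t => i s * term_val i e t
  end.

Fixpoint sat (R : realType) S (i : S -> R) (e : nat -> R) (p : formula S)
    : Prop :=
  match p with
  | Feq t u => term_val i e t = term_val i e u
  | Flt t u => term_val i e t < term_val i e u
  | Fint t => term_val i e t \is a Num.int
  | Fnot p => ~ sat i e p
  | Fand p q => sat i e p /\ sat i e q
  | Fex n p => exists x, sat i [eta e with n |-> x] p
  end.

Definition theory (R : realType) (K : {pred R})
    : set (formula {b : R | b \in K}) :=
  [set p | sentence p /\ forall e, sat sval e p].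
Arguments theory {R} K.

(* Goedel numbering induced by a numbering [c] of the scalar symbols;         *)
(* [CodeSeq.code] is an effective bijection from [seq nat] to [nat].          *)
Fixpoint term_code S (c : S -> nat) (t : term S) : nat :=
  match t with
  | Tvar n => CodeSeq.code [:: 0; n]
  | Tadd t u => CodeSeq.code [:: 1; term_code c t; term_code c u]
  | Tscale s t => CodeSeq.code [:: 2; c s; term_code c t]
  end%N.

Fixpoint formula_code S (c : S -> nat) (p : formula S) : nat :=
  match p with
  | Feq t u => CodeSeq.code [:: 0; term_code c t; term_code c u]
  | Flt t u => CodeSeq.code [:: 1; term_code c t; term_code c u]
  | Fint t => CodeSeq.code [:: 2; term_code c t]
  | Fnot p => CodeSeq.code [:: 3; formula_code c p]
  | Fand p q => CodeSeq.code [:: 4; formula_code c p; formula_code c q]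
  | Fex n p => CodeSeq.code [:: 5; n; formula_code c p]
  end%N.

(* The language has one symbol per element of [K], so decidability is         *)
(* relative to a coding of these symbols by natural numbers; some injective   *)
(* coding has to work (in particular [K] is then countable). Nothing is       *)
(* gained from an ineffective coding: if the set below is computable, then    *)
(* so are the set of codes of symbols and the field operations and order of   *)
(* [K] on codes, since for example b = b1 * b2 is expressed by the sentence   *)
(* forall x, b x = b1 (b2 x).                                                 *)
Definition decidable_theory (R : realType) (K : {pred R}) : Prop :=
  exists2 c : {b : R | b \in K} -> nat,
    injective c & computable [set formula_code c p | p in theory K].

Definition quadratic (R : realType) (a : R) : Prop :=
  exists2 p : {poly rat}, size p = 3%N & root (map_poly ratr p) a.

(* The subfield Q(a) of R generated by a. *)
Definition Qadjoin (R : realType) (a : R) : set R :=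
  [set x | forall L : {pred R}, GRing.divring_closed L -> a \in L -> x \in L].

(* [K : Q] = d *)
Definition has_degree (R : realType) (K : {pred R}) (d : nat) : Prop :=
  exists b : 'I_d -> R,
    [/\ forall i, b i \in K,
        forall q : 'I_d -> rat,
          \sum_i ratr (q i) * b i = 0 -> forall i, q i = 0
      & forall x, x \in K ->
          exists q : 'I_d -> rat, x = \sum_i ratr (q i) * b i].

(* Main.v *)
Require Import Defs.
From mathcomp Require Import all_boot all_order all_algebra.
From mathcomp Require Import boolp classical_sets reals zify ring lra.

Set Implicit Arguments.
Unset Strict Implicit.
Unset Printing Implicit Defensive.
Import Order.TTheory GRing.Theory Num.Theory.

Local Open Scope classical_set_scope.
Local Open Scope ring_scope.

(* A field of degree at most two is Q or spanned by 1 and a unit b > 1 with   *)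
(* b^2 = t b - 1, found from Pell's equation. In base b, with bounded integer *)
(* digits, every real is an infinite word read outwards from the point;       *)
(* equality, addition, multiplication by b and order become recognisable,     *)
(* because the carries and their conjugates stay bounded, and integers are    *)
(* the numbers with a finite expansion that is its own conjugate. Recognition *)
(* is by finite semigroups with Ramsey factorisations (instead of Buechi      *)
(* automata): complementation is immediate and projection is the power-set    *)
(* construction. A natural number can then certify, by decidable local        *)
(* conditions, a recogniser for each formula up to a given code, and a truth  *)
(* value is found by searching for a certificate.                             *)
(*                                                                            *)
(* Otherwise K contains x and y with 1, x, y independent over Q. By           *)
(* Kronecker's theorem the fractional parts a n, b n of n x and n y fill the  *)
(* unit square. For a real c consider the indices M such that a M comes       *)
(* closest to c from below, and keep this record much longer than usual; the  *)
(* values b M at such M code a finite set, and a suitable c gives any finite  *)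
(* set of natural numbers. Quantification over finite sets defines            *)
(* divisibility, hence n (n + 1) as the least common multiple of n and n + 1, *)
(* hence pairing and all recursive functions, and diagonalisation applies.    *)

(** * Recursive functions and decidable predicates *)

Local Open Scope nat_scope.

(** Three cases are separated by [degree_trichotomy]: K is Q, K is spanned over Q by 1 and an
    irrational number, or K contains x, y with 1, x, y independent over Q. [has_degree_le2] and
    [quadratic_rspan] identify the first two with degree at most two and with K = Q(a) for a
    quadratic a. It remains to decide the theory in these two cases and to refute decidability in
    the third.

    Decidability. [pell] yields b > 1 with b^2 = t b - 1, so that the conjugate of b is b^-1, and K
    is spanned by 1 and b; for K = Q an auxiliary b outside K is used. A real is a word of digits in
    base b, integral and fractional digits being read in parallel from the point outwards. For a
    linear relation over Z[b] the carries lie in Z[b] and are bounded together with their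
    conjugates, hence take finitely many values ([reg_zero]). Equality, addition, multiplication by
    b and order follow, and integers are the numbers with a finite expansion equal to its own mirror
    image ([reg_int]). Recognition by finite semigroups rests on Ramsey's theorem
    ([additive_ramsey]) and is closed under Boolean operations and projection ([combines_sound]), so
    every formula has a recogniser, and a sentence is evaluated on one constant word. No algorithm
    is programmed: a certificate is a number tabulating recognisers for all codes up to n, its
    conditions have bounded quantifiers only, it exists ([certificate_exists]), it is sound
    ([accepted_sound]), and unbounded search finds it ([quadratic_decidable]).

    Undecidability. By [kronecker2] the points formed by the fractional parts of n x and n y are
    dense in the unit square. Best approximations from below in the first coordinate, when they
    survive long enough, select indices whose second coordinates spell out an arbitrary finite set
    of naturals ([coded_list]). Four real parameters thus replace a quantifier over finite sets
    ([df_exS]), which makes divisibility, n (n + 1), a pairing function and then every recursive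
    function definable ([recursive_fn]). A diagonal sentence finishes the argument
    ([undecidable]). *)

Fixpoint env k : Type := if k is k'.+1 then (env k' * nat)%type else unit.

Fixpoint env_of k : seq nat -> env k :=
  match k with
  | 0 => fun=> tt
  | k'.+1 => fun s => (env_of k' (behead s), head 0 s)
  end.

Fixpoint seq_of k : env k -> seq nat :=
  match k with
  | 0 => fun=> [::]
  | k'.+1 => fun e => e.2 :: seq_of e.1
  end.

Lemma env_ofK k (s : seq nat) : size s = k -> seq_of (env_of k s) = s.
Proof. by elim: k s => [|k IH] [|n s] //= [] /IH ->. Qed.

Lemma seq_ofK k (e : env k) : env_of k (seq_of e) = e.
Proof. by elim: k e => [|k IH] /= => [[]|[e n]] //=; rewrite IH. Qed.

Lemma size_seq_of k (e : env k) : size (seq_of e) = k.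
Proof. by elim: k e => [|k IH] //= e; rewrite IH. Qed.

(** In an environment the most recent variable is [e.2], and it is the head of the tuple. Weakening
    is then [e.1] and substitution is pairing, so that recursiveness can be read off the syntax of a
    function of [e]. *)
Definition rc k (f : env k -> nat) : Prop :=
  recursive (fun v : k.-tuple nat => f (env_of k v)).

Definition rp k (P : env k -> Prop) : Prop :=
  rc (fun e => nat_of_bool `[< P e >]).

Lemma rc_ext k (f g : env k -> nat) : f =1 g -> rc f -> rc g.
Proof. by move=> /funext ->. Qed.

Lemma rp_ext k (P Q : env k -> Prop) : (forall e, P e <-> Q e) -> rp P -> rp Q.
Proof. by move=> PQ; suff -> : P = Q by []; apply/funext => e; apply/propext. Qed.

Lemma rc_compn k m (F : env m -> nat) (gs : seq (env k -> nat)) :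
  size gs = m -> rc F -> (forall i, i < m -> rc (nth (fun=> 0) gs i)) ->
  rc (fun e => F (env_of m [seq g e | g <- gs])).
Proof.
move=> sz rF rg; apply: (rec_comp (g := fun (i : 'I_m) v =>
  nth (fun=> 0) gs i (env_of k v)) rF) => [i|v]; first exact: rg.
congr (F (env_of m _)).
have -> : [seq g (env_of k v) | g <- gs] =
  [seq nth (fun=> 0) gs i (env_of k v) | i <- iota 0 m].
  by rewrite -[gs in LHS](mkseq_nth (fun=> 0)) -map_comp sz.
by rewrite /= -val_enum_ord -map_comp.
Qed.

Lemma rc_const k c : rc (fun _ : env k => c).
Proof.
elim: c => [|c IH]; first exact: rec_zero.
have rS : @rc 1 (fun e => e.2.+1) by apply: rec_succ => -[[|n [|]]].
by apply: (@rc_compn k 1 _ [:: fun=> c] erefl rS) => -[].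
Qed.

Lemma rc_nth k i : rc (fun e : env k => nth 0 (seq_of e) i).
Proof.
have [ik|ki] := ltnP i k.
  apply: (rec_proj (i := Ordinal ik)) => v.
  by rewrite env_ofK ?size_tuple // (tnth_nth 0).
by apply: rc_ext (rc_const k 0) => e; rewrite nth_default // size_seq_of.
Qed.

Lemma rc_var k : rc (fun e : env k.+1 => e.2).
Proof. exact: (rc_nth k.+1 0). Qed.

Lemma rc_wk k (f : env k -> nat) : rc f -> rc (fun e : env k.+1 => f e.1).
Proof.
move=> rf; have := @rc_compn k.+1 k f
  [seq (fun e : env k.+1 => nth 0 (seq_of e) i.+1) | i <- iota 0 k].
rewrite size_map size_iota => /(_ erefl rf) H; apply: rc_ext (H _) => [e|i ik].
  congr f; rewrite -map_comp (_ : map _ _ = seq_of e.1) ?seq_ofK //.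
  apply: (@eq_from_nth _ 0) => [|i]; rewrite size_map size_iota ?size_seq_of //.
  by move=> ik; rewrite (nth_map 0) ?size_iota // nth_iota.
by rewrite (nth_map 0) ?size_iota // nth_iota //; exact: rc_nth.
Qed.

Lemma rc_sub k (F : env k.+1 -> nat) (g : env k -> nat) :
  rc F -> rc g -> rc (fun e => F (e, g e)).
Proof.
move=> rF rg; have := @rc_compn k k.+1 F
  (g :: [seq (fun e : env k => nth 0 (seq_of e) i) | i <- iota 0 k]).
rewrite /= size_map size_iota => /(_ erefl rF) H; apply: rc_ext (H _) => [e|].
  congr (F (_, _)); rewrite -map_comp (_ : map _ _ = seq_of e) ?seq_ofK //.
  apply: (@eq_from_nth _ 0) => [|i]; rewrite size_map size_iota ?size_seq_of //.
  by move=> ik; rewrite (nth_map 0) ?size_iota // nth_iota.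
case=> [|i] //= ik; rewrite ltnS in ik.
by rewrite (nth_map 0) ?size_iota // nth_iota //; exact: rc_nth.
Qed.

Lemma rc_prim k (f : env k -> nat) (g : env k.+2 -> nat) (h : env k.+1 -> nat) :
  rc f -> rc g -> (forall v, h (v, 0) = f v) ->
  (forall v n, h (v, n.+1) = g (v, h (v, n), n)) -> rc h.
Proof. by move=> rf rg h0 hS; apply: (rec_prim rf rg) => [v|n v] /=. Qed.

Lemma rc_min k (f : env k.+1 -> nat) (h : env k -> nat) :
  rc f -> (forall v, f (v, h v) = 0) ->
  (forall v n, n < h v -> f (v, n) <> 0) -> rc h.
Proof. by move=> rf h0 hS; apply: (rec_min rf) => [v|v n] /=; [|exact: hS]. Qed.

Lemma rc_iter k (n a : env k -> nat) (s : env k.+2 -> nat) :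
  rc n -> rc a -> rc s ->
  rc (fun e => iteri (n e) (fun i x => s (e, x, i)) (a e)).
Proof.
move=> rn ra rs.
apply: (@rc_sub _ (fun e => iteri e.2 (fun i x => s (e.1, x, i)) (a e.1))) => //.
exact: (rc_prim ra rs).
Qed.

Lemma rc_succ k (f : env k -> nat) : rc f -> rc (fun e => (f e).+1).
Proof.
have rS : @rc 1 (fun e => e.2.+1) by apply: rec_succ => -[[|n [|]]].
by move=> rf; apply: (@rc_compn k 1 _ [:: f] erefl rS) => -[].
Qed.

Lemma rc_add k (f g : env k -> nat) : rc f -> rc g -> rc (fun e => f e + g e).
Proof.
move=> rf rg; apply: (@rc_sub _ (fun e => f e.1 + e.2)) => //.
by apply: (rc_prim rf (rc_succ (rc_wk (rc_var k)))) => [v|v n] /=;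
  rewrite ?addn0 ?addnS.
Qed.

Lemma rc_mul k (f g : env k -> nat) : rc f -> rc g -> rc (fun e => f e * g e).
Proof.
move=> rf rg; apply: (@rc_sub _ (fun e => f e.1 * e.2)) => //.
apply: (rc_prim (rc_const k 0) (rc_add (rc_wk (rc_wk rf)) (rc_wk (rc_var k)))).
  by move=> v; rewrite muln0.
by move=> v n; rewrite mulnS.
Qed.

Lemma rc_exp k (f g : env k -> nat) : rc f -> rc g -> rc (fun e => f e ^ g e).
Proof.
move=> rf rg; apply: (@rc_sub _ (fun e => f e.1 ^ e.2)) => //.
apply: (rc_prim (rc_const k 1) (rc_mul (rc_wk (rc_wk rf)) (rc_wk (rc_var k)))).
  by move=> v; rewrite expn0.
by move=> v n; rewrite expnS.
Qed.

Lemma rc_pred k (f : env k -> nat) : rc f -> rc (fun e => (f e).-1).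
Proof.
move=> rf; apply: (@rc_sub _ (fun e => e.2.-1)) => //.
by apply: (rc_prim (rc_const k 0) (rc_var k.+1)).
Qed.

Lemma rc_subn k (f g : env k -> nat) : rc f -> rc g -> rc (fun e => f e - g e).
Proof.
move=> rf rg; apply: (@rc_sub _ (fun e => f e.1 - e.2)) => //.
apply: (rc_prim rf (rc_pred (rc_wk (rc_var k)))) => [v|v n] /=.
  by rewrite subn0.
by rewrite subnS.
Qed.

Lemma rp_eq0 k (f : env k -> nat) : rc f -> rp (fun e => f e = 0).
Proof.
move=> rf; apply: rc_ext (rc_subn (rc_const k 1) rf) => e.
by case: (f e) => [|n]; [rewrite asboolT|rewrite asboolF].
Qed.

Lemma rp_not k (P : env k -> Prop) : rp P -> rp (fun e => ~ P e).
Proof.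
move=> rP; apply: rc_ext (rc_subn (rc_const k 1) rP) => e.
by rewrite asbool_neg; case: `[< _ >].
Qed.

Lemma rp_and k (P Q : env k -> Prop) : rp P -> rp Q -> rp (fun e => P e /\ Q e).
Proof.
by move=> rP rQ; apply: rc_ext (rc_mul rP rQ) => e;
  rewrite asbool_and; do 2!case: `[< _ >].
Qed.

Lemma rp_or k (P Q : env k -> Prop) : rp P -> rp Q -> rp (fun e => P e \/ Q e).
Proof.
move=> rP rQ; apply: rp_ext (rp_not (rp_and (rp_not rP) (rp_not rQ))) => e.
by rewrite not_andP !not_notE.
Qed.

Lemma rp_imp k (P Q : env k -> Prop) : rp P -> rp Q -> rp (fun e => P e -> Q e).
Proof.
by move=> rP rQ; apply: rp_ext (rp_or (rp_not rP) rQ) => e; rewrite implyE.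
Qed.

Lemma rp_iff k (P Q : env k -> Prop) : rp P -> rp Q -> rp (fun e => P e <-> Q e).
Proof. by move=> rP rQ; apply: rp_and; apply: rp_imp. Qed.

Lemma rp_le k (f g : env k -> nat) : rc f -> rc g -> rp (fun e => f e <= g e).
Proof.
move=> rf rg; apply: rp_ext (rp_eq0 (rc_subn rf rg)) => e.
by split => /eqP.
Qed.

Lemma rp_lt k (f g : env k -> nat) : rc f -> rc g -> rp (fun e => f e < g e).
Proof. by move=> rf rg; apply: rp_le => //; apply: rc_succ. Qed.

Lemma rp_eq k (f g : env k -> nat) : rc f -> rc g -> rp (fun e => f e = g e).
Proof.
move=> rf rg; apply: rp_ext (rp_and (rp_le rf rg) (rp_le rg rf)) => e.
by split => [[fg gf]|->//]; apply/eqP; rewrite eqn_leq fg gf.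
Qed.

Lemma rp_true k (b : Prop) : rp (fun _ : env k => b).
Proof. exact: rc_const. Qed.

Lemma rp_sub k (P : env k.+1 -> Prop) (g : env k -> nat) :
  rp P -> rc g -> rp (fun e => P (e, g e)).
Proof. exact: rc_sub. Qed.

Lemma rp_bex k (n : env k -> nat) (P : env k -> nat -> Prop) :
  rc n -> @rp k.+1 (fun e => P e.1 e.2) ->
  rp (fun e => exists2 x, x < n e & P e x).
Proof.
move=> rn rP; apply: (@rp_sub _ (fun e => exists2 x, x < e.2 & P e.1 x)) => //.
have rQ : @rp k.+2 (fun e => e.1.2 <> 0 \/ P e.1.1 e.2).
  apply: rp_or; first exact: rp_not (rp_eq0 (rc_wk (rc_var k))).
  have := @rc_compn k.+2 k.+1 _ ((fun e => e.2) ::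
     [seq (fun e : env k.+2 => nth 0 (seq_of e) i.+2) | i <- iota 0 k]) _ rP.
  rewrite /= size_map size_iota => /(_ erefl) H; apply: rc_ext (H _) => [e|].
    rewrite -map_comp (_ : map _ _ = seq_of e.1.1) ?seq_ofK //.
    apply: (@eq_from_nth _ 0) => [|i]; rewrite size_map size_iota ?size_seq_of //.
    by move=> ik; rewrite (nth_map 0) ?size_iota // nth_iota.
  case=> [|i] //= ik; first exact: rc_var.
  by rewrite (nth_map 0) ?size_iota // nth_iota //; exact: (rc_wk (rc_wk (rc_nth k i))).
apply: (rc_prim (rc_const k 0) rQ) => [v|v m] /=; first by rewrite asboolF // => -[].
congr nat_of_bool; apply: asbool_equiv_eq; split => [[x]|].
  rewrite ltnS leq_eqVlt => /predU1P[->|xm] Pv; [by right|left].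
  by rewrite asboolT //; exists x.
case=> [|Pm]; last by exists m.
by case: asboolP => // -[x xm Px] _; exists x => //; exact: ltnW.
Qed.

Lemma rp_ball k (n : env k -> nat) (P : env k -> nat -> Prop) :
  rc n -> @rp k.+1 (fun e => P e.1 e.2) ->
  rp (fun e => forall x, x < n e -> P e x).
Proof.
move=> rn rP; apply: rp_ext (rp_not (rp_bex (P := fun e x => ~ P e x) rn (rp_not rP))) => e /=.
split => [H x xn|H [x xn]]; last by apply; exact: H.
by have [//|nP] := pselect (P e x); case: H; exists x.
Qed.

Lemma rc_mu k (P : env k -> nat -> Prop) (h : env k -> nat) :
  @rp k.+1 (fun e => P e.1 e.2) -> (forall e, P e (h e)) ->
  (forall e n, n < h e -> ~ P e n) -> rc h.
Proof.
move=> rP hP hm; apply: (rc_min (rp_not rP)) => [v|v n nh] /=.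
  by rewrite asboolF //; apply.
by rewrite asboolT //; apply: hm.
Qed.

(** Minimisation finds the value from a decidable graph; quotients and the projections [hd] and [tl]
    are obtained in this way from descriptions by bounded quantifiers. *)
Lemma rc_graph k (h : env k -> nat) :
  @rp k.+1 (fun e => h e.1 = e.2) -> rc h.
Proof.
move=> rP; apply: (rc_mu (P := fun e y => h e = y) rP) => // e n nh hE; by rewrite hE ltnn in nh.
Qed.

Lemma rc_div k (f g : env k -> nat) : rc f -> rc g -> rc (fun e => f e %/ g e).
Proof.
move=> rf rg; apply: (@rc_graph k).
pose Q (e : env k.+1) := (g e.1 = 0 /\ e.2 = 0) \/
  (0 < g e.1 /\ (e.2 * g e.1 <= f e.1 /\ f e.1 < e.2.+1 * g e.1)).
have rQ : rp Q.
  have [rf' rg'] := (rc_wk rf, rc_wk rg); have r2 := rc_var k.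
  apply: rp_or; apply: rp_and; [exact: rp_eq0|exact: rp_eq0| |].
    exact: rp_lt (rc_const _ 0) _.
  by apply: rp_and; [apply: rp_le => //|apply: rp_lt => //]; apply: rc_mul => //;
     apply: rc_succ.
apply: rp_ext rQ => -[e q]; rewrite /Q /=; case: (posnP (g e)) => [->|g0].
  by rewrite divn0; split => [[[_ ->]|[]]|<-]; [|by []|left].
split => [[[g00]|[_ /andP h]]|<-]; first by rewrite g00 in g0.
- apply/eqP; rewrite eqn_leq -ltnS ltn_divLR // -[_ <= _ %/ _]negbK.
  by rewrite -ltnNge ltn_divLR // -leqNgt andbC.
- by right; split => //; split; [exact: leq_trunc_div|rewrite -ltn_divLR].
Qed.

Lemma rc_mod k (f g : env k -> nat) : rc f -> rc g -> rc (fun e => f e %% g e).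
Proof.
move=> rf rg; apply: rc_ext (rc_subn rf (rc_mul (rc_div rf rg) rg)) => e.
by rewrite {1}(divn_eq (f e) (g e)) addKn.
Qed.

(** One step of [CodeSeq.code]. Every nonzero number is 2^n (2m + 1) in a unique way, so every
    number is the code of a list and 0 is the code of the empty one. *)
Definition cns n m := 2 ^ n * m.*2.+1.

Lemma code_cons n s : CodeSeq.code (n :: s) = cns n (CodeSeq.code s).
Proof. by []. Qed.

Lemma cnsE n m : cns n m = CodeSeq.code (n :: CodeSeq.decode m).
Proof. by rewrite code_cons CodeSeq.decodeK. Qed.

Lemma cns_inj n m n' m' : cns n m = cns n' m' -> n = n' /\ m = m'.
Proof.
rewrite !cnsE => /(can_inj CodeSeq.codeK) [-> /(can_inj CodeSeq.decodeK)].
by [].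
Qed.

Lemma cns_gt n m : n < cns n m /\ m < cns n m.
Proof.
rewrite /cns; split; first exact: leq_trans (ltn_expl n (isT : 1 < 2)) (leq_pmulr _ _).
by apply: (@leq_trans m.*2.+1); rewrite ?leq_pmull ?expn_gt0 // ltnS -addnn leq_addr.
Qed.

Lemma cns_neq0 n m : cns n m <> 0.
Proof. by case: (cns n m) (cns_gt n m) => // -[]. Qed.

Lemma cns_cases w : w = 0 \/ exists n m, w = cns n m.
Proof.
rewrite -[w]CodeSeq.decodeK; case: (CodeSeq.decode w) => [|n s]; first by left.
by right; exists n, (CodeSeq.code s).
Qed.

Lemma rc_cns k (f g : env k -> nat) :
  rc f -> rc g -> rc (fun e => cns (f e) (g e)).
Proof.
move=> rf rg; rewrite /cns.
apply: rc_ext (rc_mul (rc_exp (rc_const k 2) rf) (rc_succ (rc_add rg rg))) => e.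
by rewrite addnn.
Qed.

Definition hd w := head 0 (CodeSeq.decode w).
Definition tl w := CodeSeq.code (behead (CodeSeq.decode w)).

Lemma hd_cns n m : hd (cns n m) = n.
Proof. by rewrite /hd cnsE CodeSeq.codeK. Qed.

Lemma tl_cns n m : tl (cns n m) = m.
Proof. by rewrite /tl cnsE CodeSeq.codeK CodeSeq.decodeK. Qed.

Lemma rc_hd k (f : env k -> nat) : rc f -> rc (fun e => hd (f e)).
Proof.
move=> rf; apply: rc_graph; have rf' := rc_wk rf; have r2 := rc_var k.
apply: (@rp_ext _ (fun e : env k.+1 => (f e.1 = 0 /\ e.2 = 0) \/
   exists2 m, m < f e.1 & f e.1 = cns e.2 m)).
  case=> e y /=; case: (cns_cases (f e)) => [->|[n [m fE]]].
    by split => [[[]//|[]//]|<-]; left.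
  rewrite fE hd_cns; split => [[[/cns_neq0//]|[m' _ /cns_inj[]//]]|<-].
  by right; exists m => //; case: (cns_gt n m).
apply: rp_or; first by apply: rp_and; apply: rp_eq0.
apply: (rp_bex (P := fun (e : env k.+1) m => f e.1 = cns e.2 m)) => //; apply: rp_eq.
  exact: rc_wk rf'.
exact: rc_cns (rc_wk r2) (rc_var _).
Qed.

Lemma rc_tl k (f : env k -> nat) : rc f -> rc (fun e => tl (f e)).
Proof.
move=> rf; apply: rc_graph; have rf' := rc_wk rf; have r2 := rc_var k.
apply: (@rp_ext _ (fun e : env k.+1 => (f e.1 = 0 /\ e.2 = 0) \/
   exists2 m, m < f e.1 & f e.1 = cns m e.2)).
  case=> e y /=; case: (cns_cases (f e)) => [->|[n [m fE]]].
    by split => [[[]//|[]//]|<-]; left.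
  rewrite fE tl_cns; split => [[[/cns_neq0//]|[m' _ /cns_inj[]//]]|<-].
  by right; exists n => //; case: (cns_gt n m).
apply: rp_or; first by apply: rp_and; apply: rp_eq0.
apply: (rp_bex (P := fun (e : env k.+1) m => f e.1 = cns m e.2)) => //; apply: rp_eq.
  exact: rc_wk rf'.
exact: rc_cns (rc_var _) (rc_wk r2).
Qed.

Definition entry w k := hd (iter k tl w).

Lemma entry_code s k : entry (CodeSeq.code s) k = nth 0 s k.
Proof.
rewrite /entry; elim: k s => [|k IH] [|n s]; rewrite ?iterSr //.
- by rewrite code_cons hd_cns.
- by rewrite (IH [::]) nth_nil.
- by rewrite code_cons tl_cns IH.
Qed.

Lemma rc_entry k (f g : env k -> nat) :
  rc f -> rc g -> rc (fun e => entry (f e) (g e)).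
Proof.
move=> rf rg; apply: rc_hd.
apply: rc_ext (rc_iter rg rf (rc_tl (rc_wk (rc_var _)))) => e /=.
by elim: (g e) => //= n ->.
Qed.

(** Any function restricted to an initial segment is tabulated by a number; all semigroups and
    certificates below are coded in this way. *)
Lemma entry_mkseq (F : nat -> nat) n :
  exists w, forall k, k < n -> entry w k = F k.
Proof.
by exists (CodeSeq.code (mkseq F n)) => k kn; rewrite entry_code nth_mkseq.
Qed.

(** * Finite semigroups recognising sets of infinite words *)

Section Segments.
Variables (S : eqType) (D : S -> Prop) (mul : S -> S -> S).

(* Product of [f i, ..., f j.-1]; meaningful only for [i < j]. *)
Definition seg (f : nat -> S) i j :=
  iteri (j - i).-1 (fun k x => mul x (f (i + k.+1))) (f i).

Lemma seg1 f i : seg f i i.+1 = f i.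
Proof. by rewrite /seg subSnn. Qed.

Lemma segS f i j : i < j -> seg f i j.+1 = mul (seg f i j) (f j).
Proof.
move=> ij; rewrite /seg subSn ?(ltnW ij) //= -{1}(prednK (n := j - i)) ?subn_gt0 //=.
by rewrite prednK ?subn_gt0 // subnKC // ltnW.
Qed.

Lemma eq_seg f g i j : i < j ->
  (forall k, i <= k < j -> f k = g k) -> seg f i j = seg g i j.
Proof.
elim: j => // j IH; rewrite ltnS leq_eqVlt => /predU1P[->|ij] fg.
  by rewrite !seg1 fg ?leqnn /=.
rewrite !segS // IH // ?fg ?ltnSn ?(ltnW ij) // => k /andP[ik kj].
by rewrite fg // ik ltnW.
Qed.

(** The laws are relative to a finite domain [D] because a multiplication table coded by a number is
    arbitrary outside its range. *)
Definition wf_mul :=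
  [/\ forall x y, D x -> D y -> D (mul x y),
      forall x y z, D x -> D y -> D z -> mul x (mul y z) = mul (mul x y) z
    & exists r : seq S, forall x, D x -> x \in r].

(** The linked pairs of the theory of infinite words: a word that factors into blocks of values s,
    e, e, ... behaves like the infinite product of s and infinitely many copies of e. *)
Definition linked s e := mul s e = s /\ mul e e = e.

Definition factors (f : nat -> S) s e := exists c : nat -> nat,
  [/\ c 0 = 0, forall i, c i < c i.+1, seg f 0 (c 1) = s
    & forall i, seg f (c i.+1) (c i.+2) = e].

Hypothesis wf : wf_mul.
Variable f : nat -> S.
Hypothesis Df : forall i, D (f i).

Lemma seg_dom i j : i < j -> D (seg f i j).
Proof.
have [cl _ _] := wf; elim: j => // j IH; rewrite ltnS leq_eqVlt.
by case/predU1P => [->|ij]; rewrite ?seg1 // segS //; apply: cl => //; apply: IH.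
Qed.

Lemma seg_cat i j k : i < j -> j < k -> seg f i k = mul (seg f i j) (seg f j k).
Proof.
have [cl ass _] := wf; move=> ij; elim: k => // k IH; rewrite ltnS leq_eqVlt.
case/predU1P => [<-|jk]; first by rewrite seg1 segS.
rewrite !segS // ?(ltn_trans ij) // IH // ass //; exact: seg_dom.
Qed.

End Segments.

Lemma infinite_pigeonhole (S : eqType) (F : nat -> S) (r : seq S) (P : nat -> Prop) :
  (forall m, exists n, m <= n /\ P n) -> (forall n, P n -> F n \in r) ->
  exists2 v, v \in r & forall m, exists n, [/\ m <= n, P n & F n = v].
Proof.
elim: r P => [|v r IH] P infP Pr.
  by have [n [_ /Pr]] := infP 0; rewrite in_nil.
have [H|] := pselect (forall m, exists n, [/\ m <= n, P n & F n = v]).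
  by exists v => //; rewrite mem_head.
move=> /existsNP [m0 Hm0].
have [] := IH (fun n => P n /\ m0 <= n).
- move=> m; have [n [mn Pn]] := infP (maxn m m0).
  by exists n; rewrite (leq_trans (leq_maxl m m0)) // (leq_trans (leq_maxr m m0)).
- move=> n [Pn m0n]; have := Pr n Pn; rewrite inE => /predU1P[Fv|//].
  by case: Hm0; exists n.
move=> u ur Hu; exists u; first by rewrite inE ur orbT.
by move=> m; have [n [mn [Pn _] Fn]] := Hu m; exists n.
Qed.

Lemma increasing_lt (c : nat -> nat) : (forall i, c i < c i.+1) ->
  forall i j, i < j -> c i < c j.
Proof. by move=> cS i j; apply: (homo_ltn ltn_trans). Qed.

Lemma increasing_ge (c : nat -> nat) : (forall i, c i < c i.+1) ->
  forall i, i <= c i.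
Proof. by move=> cS; elim=> // i IH; apply: leq_ltn_trans (cS i). Qed.

(* Ramsey's theorem for additive colourings: positions [i] and [j] are merged *)
(* if the segments from [i] and from [j] to a common end have equal products; *)
(* merging is an equivalence relation of finite index.                        *)
Lemma additive_ramsey (S : eqType) (D : S -> Prop) mul (f : nat -> S) :
  wf_mul D mul -> (forall i, D (f i)) ->
  exists s e, [/\ D s, D e, linked mul s e & factors mul f s e].
Proof.
move=> wf Df; have [cl ass [r Dr]] := wf.
pose sg := seg mul f.
have sgc i j k : i < j -> j < k -> sg i k = mul (sg i j) (sg j k).
  exact: (seg_cat wf).
have sgD i j : i < j -> D (sg i j) by exact: (seg_dom wf).
pose merged i j := exists k, [/\ i < k, j < k & sg i k = sg j k].
have [i0 Hi0] : exists i, forall m, exists j, m <= j /\ merged i j.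
  apply/not_existsP => H.
  have /choice [b Hb] i : exists m, forall j, m <= j -> ~ merged i j.
    have /existsNP [m Hm] := H i; exists m => j mj ij; apply: Hm.
    by exists j.
  (* Otherwise there are [(size r).+1] pairwise unmerged positions [g a], and their products up to
     the common end [k] would be distinct elements of [r]. *)
  pose B i := i.+1 + \max_(i' < i.+1) b i'.
  pose g n := iter n B 0.
  have gS n : g n < g n.+1 by rewrite /g /= /B addSn ltnS leq_addr.
  have gb a a' : a < a' -> b (g a) <= g a'.
    move=> aa'; have: b (g a) <= g a.+1.
      rewrite /g /= -/(g a) /B; apply: leq_trans (leq_addl _ _).
      exact: (leq_bigmax (Ordinal (ltnSn (g a)))).
    move/leq_trans; apply; move: aa'; rewrite leq_eqVlt.
    by case/predU1P => [->//|/(increasing_lt gS)/ltnW].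
  pose k := (g (size r)).+1.
  have gk a : a <= size r -> g a < k.
    by rewrite leq_eqVlt ltnS => /predU1P[->//|/(increasing_lt gS)/ltnW].
  have : size (map (fun a => sg (g a) k) (iota 0 (size r).+1)) <= size r.
    apply: uniq_leq_size => [|x /mapP [a]].
      rewrite map_inj_in_uniq ?iota_uniq // => a a'.
      rewrite !mem_iota !add0n !ltnS /= => ar ar' E.
      have [aa'|a'a|//] := ltngtP a a'; exfalso.
        by apply: (Hb _ _ (gb _ _ aa')); exists k; rewrite !gk.
      by apply: (Hb _ _ (gb _ _ a'a)); exists k; rewrite !gk.
    rewrite mem_iota add0n ltnS => ar ->; apply/Dr/sgD; exact: gk.
  by rewrite size_map size_iota ltnn.
(* Among the infinitely many positions merged with [i0], infinitely many have the same product [e]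
   from [i0]. *)
have [||e er He] := @infinite_pigeonhole _ (sg i0) r
    (fun j => i0 < j /\ merged i0 j).
- move=> m; have [j [mj ij]] := Hi0 (maxn m i0.+1); exists j.
  by rewrite (leq_trans (leq_maxl m i0.+1)) // (leq_trans (leq_maxr m i0.+1)).
- by move=> n [i0n _]; apply/Dr/sgD.
pose Q j := [/\ i0 < j, merged i0 j & sg i0 j = e].
have HQ m : exists j, m <= j /\ Q j.
  by have [j [mj [? ?] ?]] := He m; exists j.
(* Beyond the point where [j] and [i0] are merged, the product from [j] equals the product from
   [i0], which is again [e] at suitable positions. *)
have /choice [nxt Hn] j : exists j', Q j -> [/\ j < j', Q j' & sg j j' = e].
  have [[i0j [k [ik jk E]] _]|] := pselect (Q j); last by exists 0.
  have [j' [mj' [? ? E']]] := HQ (maxn k j).+1; exists j' => _.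
  have kj' : k < j' by apply: leq_trans mj'; rewrite ltnS leq_maxl.
  split=> //; first by apply: leq_trans mj'; rewrite ltnS leq_maxr.
  by rewrite -E' (sgc i0 k) // E -sgc.
have [j1 [_ Qj1]] := HQ 0.
have Qi n : Q (iter n nxt j1) by elim: n => //= n /Hn [].
have De : D e by have [? _ <-] := Qj1; apply: sgD.
have ee : mul e e = e.
  have [ij1 _ E1] := Qj1; have [j12 [ij2 _ E2] E3] := Hn _ Qj1.
  by rewrite -{1}E1 -{1}E3 -sgc.
have [ij1 _ E1] := Qj1.
have j10 : 0 < j1 by apply: leq_ltn_trans ij1.
have se : mul (sg 0 j1) e = sg 0 j1.
  have [i00|i0p] := posnP i0; first by rewrite -i00 E1 ee.
  by rewrite (sgc 0 i0) // E1 -ass ?ee //; apply: sgD.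
exists (sg 0 j1), e; split => //; first exact: sgD.
exists (fun n => if n is n'.+1 then iter n' nxt j1 else 0); split => //.
  by case=> [|i] //=; have [] := Hn _ (Qi i).
by move=> i /=; have [] := Hn _ (Qi i).
Qed.

Lemma block_index (c : nat -> nat) : c 0 = 0 -> (forall i, c i < c i.+1) ->
  exists b : nat -> nat, forall i n, c i <= n < c i.+1 -> b n = i.
Proof.
move=> c0 cS.
have ex n : exists i, n < c i.+1.
  by exists n; apply: leq_ltn_trans (cS n); apply: increasing_ge.
exists (fun n => ex_minn (ex n)) => i n /andP[cn nc]; case: ex_minnP => m mc mi.
apply/eqP; rewrite eqn_leq mi // leqNgt; apply/negP => mlt.
have: c m.+1 <= c i.
  by move: mlt; rewrite leq_eqVlt => /predU1P[->//|/(increasing_lt cS)/ltnW].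
by move=> /leq_trans/(_ cn)/(leq_trans mc); rewrite ltnn.
Qed.

(* Projection: letters of the [S]-side carry an extra component in [X], and    *)
(* an element of [T] stands for the set of values of the possible completions. *)
Lemma power_sound (S T : eqType) (DS : S -> Prop) (DT : T -> Prop) mulS mulT
    (Pr : T -> S -> Prop) (Sig X : Type) (LA : Sig -> Prop) (AX : X -> Prop)
    (ltS : Sig -> X -> S) (ltT : Sig -> T) (acc : S -> S -> Prop)
    (L : (nat -> Sig) -> (nat -> X) -> Prop) :
  wf_mul DS mulS -> wf_mul DT mulT ->
  (forall a x, LA a -> AX x -> DS (ltS a x)) ->
  (forall a, LA a -> DT (ltT a)) ->
  (forall a s, LA a -> DS s -> Pr (ltT a) s <-> exists2 x, AX x & s = ltS a x) ->
  (forall t u s, DT t -> DT u -> DS s -> Pr (mulT t u) s <->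
     exists p q, [/\ DS p, DS q, Pr t p, Pr u q & s = mulS p q]) ->
  (forall W E, (forall n, LA (W n)) -> (forall n, AX (E n)) -> forall s e,
     DS s -> DS e ->
     linked mulS s e -> factors mulS (fun n => ltS (W n) (E n)) s e ->
     (L W E <-> acc s e)) ->
  forall W t g, (forall n, LA (W n)) -> linked mulT t g ->
  factors mulT (fun n => ltT (W n)) t g ->
  (exists E, (forall n, AX (E n)) /\ L W E) <->
  exists s e, [/\ DS s, DS e, Pr t s /\ Pr g e, linked mulS s e & acc s e].
Proof.
move=> wfS wfT DltS DltT PrL PrM rS W t g LW [tg gg] [c [c0 cS Et Eg]].
have [clS _ _] := wfS; have [clT _ _] := wfT.
pose sgT := seg mulT (fun n => ltT (W n)).
pose sgS E := seg mulS (fun n => ltS (W n) (E n)).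
have sgTD i j : i < j -> DT (sgT i j).
  by apply: (seg_dom wfT) => n; apply: DltT.
have sgSD E i j : (forall n, AX (E n)) -> i < j -> DS (sgS E i j).
  by move=> AE; apply: (seg_dom wfS) => n; apply: DltS.
(* The value of an actual completion belongs to the set that the element of [T] stands for; [EPr] is
   the converse. *)
have PrE E i j : (forall n, AX (E n)) -> i < j -> Pr (sgT i j) (sgS E i j).
  move=> AE; elim: j => // j IH; rewrite ltnS leq_eqVlt => /predU1P[->|ij].
    rewrite /sgT /sgS !seg1; apply/PrL => //; first exact: DltS.
    by exists (E j).
  rewrite /sgT /sgS !segS //; apply/PrM; rewrite -/(sgT i j) -/(sgS E i j).
  - exact: sgTD.
  - exact: DltT.
  - by apply: clS; [exact: sgSD|exact: DltS].
  exists (sgS E i j), (ltS (W j) (E j)); split => //.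
  - exact: sgSD.
  - exact: DltS.
  - exact: IH.
  - by apply/PrL => //; [exact: DltS|exists (E j)].
have EPr i j s : i < j -> DS s -> Pr (sgT i j) s ->
    exists E, (forall n, AX (E n)) /\ sgS E i j = s.
  elim: j s => // j IH s; rewrite ltnS leq_eqVlt => /predU1P[->|ij] Ds.
    rewrite /sgT seg1 => /PrL [] // x Ax ->.
    by exists (fun=> x); rewrite /sgS seg1.
  rewrite /sgT segS // => /PrM [] //; [exact: sgTD|exact: DltT|].
  move=> p [q [Dp Dq /(IH _ ij Dp) [E [AE <-]] Pq ->]].
  have /PrL [//|//|x Ax ->] := Pq.
  exists (fun n => if n == j then x else E n); split=> [n|]; first by case: eqP.
  rewrite /sgS segS // eqxx; congr mulS; apply: eq_seg => // k /andP[_ kj].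
  by rewrite ltn_eqF.
split=> [[E [AE LWE]]|[s [e [Ds De [Ps Pe] lse ac]]]]; last first.
  (* Each block is completed separately with value [s] or [e], and the completions are glued along
     the block index. *)
  have /choice [G HG] i : exists E, (forall n, AX (E n)) /\
      sgS E (c i) (c i.+1) = if i is 0 then s else e.
    apply: EPr => //; first by case: i.
    by case: i => [|i]; rewrite ?c0 /sgT ?Et ?Eg.
  have [b Hb] := block_index c0 cS.
  pose E n := G (b n) n; exists E; split; first by move=> n; have [AG _] := HG (b n); exact: AG.
  have blk i : sgS E (c i) (c i.+1) = if i is 0 then s else e.
    have [_ <-] := HG i; apply: eq_seg => // k ck.
    by rewrite /E (Hb _ _ ck).
  apply/(rS W E LW _ s e) => //; first by move=> n; have [AG _] := HG (b n); exact: AG.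
  exists c; split => //; first by have := blk 0; rewrite c0.
  by move=> i; exact: (blk i.+1).
(* For a given completion, Ramsey's theorem is applied to the values of the blocks of [c]. Grouping
   blocks together does not change their values [t] and [g] in [T], since these form a linked
   pair. *)
pose v i := sgS E (c i) (c i.+1).
have Dv i : DS (v i) by apply: sgSD.
have segv a b' : a < b' -> seg mulS v a b' = sgS E (c a) (c b').
  elim: b' => // b' IH; rewrite ltnS leq_eqVlt => /predU1P[->|ab].
    by rewrite seg1.
  rewrite segS // IH // -(seg_cat wfS) => [//|n||//]; first exact: DltS.
  exact: increasing_lt.
have [s [e [Ds De lse [c' [c'0 c'S Es Ee]]]]] := additive_ramsey wfS Dv.
have Dt : DT t by rewrite -Et; apply: sgTD; rewrite -{1}c0.
have Dg : DT g by rewrite -(Eg 0); apply: sgTD.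
have sgTc i j k : i < j -> j < k -> sgT i k = mulT (sgT i j) (sgT j k).
  by apply: (seg_cat wfT) => n; apply: DltT.
have Pt i : sgT (c 0) (c i.+1) = t.
  elim: i => [|i IH]; first by rewrite c0.
  rewrite (sgTc _ (c i.+1)) //; last exact: increasing_lt.
  by rewrite IH /sgT Eg.
have Pg i j : i < j -> sgT (c i.+1) (c j.+1) = g.
  elim: j => // j IH; rewrite ltnS leq_eqVlt => /predU1P[->|ij]; first exact: Eg.
  rewrite (sgTc _ (c j.+1)) //; last exact: increasing_lt.
  by rewrite IH // /sgT Eg.
have c1p : 0 < c' 1 by have := c'S 0; rewrite c'0.
have Es' : sgS E (c 0) (c (c' 1)) = s by rewrite -segv.
exists s, e; split => //.
  split.
    rewrite -Es' -(Pt (c' 1).-1) prednK //.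
    by apply: PrE => //; apply: increasing_lt.
  have := Ee 0; have := c'S 1; move: c1p.
  case: (c' 1) (c' 2) => // a [//|b'] _ ab <-; rewrite segv // -(Pg a b') //.
  by apply: PrE => //; apply: increasing_lt.
apply/(rS W E LW AE s e Ds De lse) => //.
exists (c \o c'); split => /=.
- by rewrite c'0.
- by move=> i; apply: increasing_lt.
- by rewrite -[RHS]Es' c0.
- by move=> i; rewrite -(Ee i) segv.
Qed.

(** * Finite semigroups coded by natural numbers *)

(** A recogniser is a list of five tables: the number of elements, their products, the images of the
    letters, the accepted linked pairs and, for elements that stand for sets, the membership
    relation [apow]. *)
Definition asz v := entry v 0.
Definition amul v x y := entry (entry v 1) (x * asz v + y).
Definition alet v l := entry (entry v 2) l.
Definition aacc v x y := entry (entry v 3) (x * asz v + y) <> 0.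
Definition apow v t s := entry (entry v 4) (s * asz v + t) <> 0.

Definition walg A v :=
  [/\ forall x, x < asz v -> forall y, y < asz v -> amul v x y < asz v,
      forall x, x < asz v -> forall y, y < asz v -> forall z, z < asz v ->
        amul v x (amul v y z) = amul v (amul v x y) z
    & forall l, l < A -> alet v l < asz v].

(** The equivalence holds for every linked factorisation of the word. Hence one factorisation
    decides membership, and negating [aacc] gives the complement. *)
Definition recognises A v (L : (nat -> nat) -> Prop) :=
  walg A v /\
  forall W, (forall n, W n < A) -> forall s e, s < asz v -> e < asz v ->
    linked (amul v) s e -> factors (amul v) (fun n => alet v (W n)) s e ->
    (L W <-> aacc v s e).

Lemma walg_wf A v : walg A v -> wf_mul (fun x => x < asz v) (amul v).
Proof.
case=> cl ass _; split => [x y xv yv|x y z xv yv zv|]; [exact: cl|exact: ass|].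
by exists (iota 0 (asz v)) => x; rewrite mem_iota.
Qed.

Definition triple v1 v2 s1 s2 s3 := s1 + asz v1 * (s2 + asz v2 * s3).

Definition sgn (b : bool) (P : Prop) : Prop := if b then ~ P else P.

(** A single construction covers all closure properties: three inverse images under maps of letters,
    their intersection, projection along an auxiliary letter below [X], and an optional complement.
    It is phrased with bounded quantifiers over tables, so that a certificate can be checked against
    it. *)
Definition combines A X (f1 f2 f3 : nat -> nat -> nat) (ng : bool) v v1 v2 v3 :=
  [/\ walg A v,
      forall l, l < A -> forall s1, s1 < asz v1 -> forall s2, s2 < asz v2 ->
        forall s3, s3 < asz v3 ->
        apow v (alet v l) (triple v1 v2 s1 s2 s3) <->
        exists2 e, e < X & (alet v1 (f1 l e) = s1 /\ alet v2 (f2 l e) = s2) /\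
                            alet v3 (f3 l e) = s3,
      forall t, t < asz v -> forall u, u < asz v ->
        forall s1, s1 < asz v1 -> forall s2, s2 < asz v2 ->
        forall s3, s3 < asz v3 ->
        apow v (amul v t u) (triple v1 v2 s1 s2 s3) <->
        exists2 p1, p1 < asz v1 & exists2 p2, p2 < asz v2 &
        exists2 p3, p3 < asz v3 & exists2 q1, q1 < asz v1 &
        exists2 q2, q2 < asz v2 & exists2 q3, q3 < asz v3 &
          (apow v t (triple v1 v2 p1 p2 p3) /\ apow v u (triple v1 v2 q1 q2 q3)) /\
          (amul v1 p1 q1 = s1 /\ (amul v2 p2 q2 = s2 /\ amul v3 p3 q3 = s3))
    & forall t, t < asz v -> forall g, g < asz v ->
        aacc v t g <-> sgn ng (
        exists2 s1, s1 < asz v1 & exists2 s2, s2 < asz v2 &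
        exists2 s3, s3 < asz v3 & exists2 e1, e1 < asz v1 &
        exists2 e2, e2 < asz v2 & exists2 e3, e3 < asz v3 &
          (apow v t (triple v1 v2 s1 s2 s3) /\ apow v g (triple v1 v2 e1 e2 e3)) /\
          ((linked (amul v1) s1 e1 /\ (linked (amul v2) s2 e2 /\
            linked (amul v3) s3 e3)) /\
           (aacc v1 s1 e1 /\ (aacc v2 s2 e2 /\ aacc v3 s3 e3))))].

(** This is [power_sound] for the product of the three semigroups, where an element of [v] stands
    for the set of triples given by [apow]. *)
Lemma combines_sound A X f1 f2 f3 ng v v1 v2 v3 A1 A2 A3 L1 L2 L3 :
  recognises A1 v1 L1 -> recognises A2 v2 L2 -> recognises A3 v3 L3 ->
  (forall l e, l < A -> e < X -> f1 l e < A1) ->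
  (forall l e, l < A -> e < X -> f2 l e < A2) ->
  (forall l e, l < A -> e < X -> f3 l e < A3) ->
  combines A X f1 f2 f3 ng v v1 v2 v3 ->
  recognises A v (fun W => sgn ng (exists E, (forall n, E n < X) /\
    [/\ L1 (fun n => f1 (W n) (E n)), L2 (fun n => f2 (W n) (E n))
      & L3 (fun n => f3 (W n) (E n))])).
Proof.
move=> [w1 r1] [w2 r2] [w3 r3] F1 F2 F3 [wv Hlet Hmul Hacc].
have [cl1 ass1 l1] := w1; have [cl2 ass2 l2] := w2; have [cl3 ass3 l3] := w3.
split; first exact: wv.
move=> W WA s e sv ev lse fse; rewrite Hacc //.
pose S := (nat * nat * nat)%type.
pose DS (s : S) := s.1.1 < asz v1 /\ s.1.2 < asz v2 /\ s.2 < asz v3.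
pose mulS (p q : S) : S :=
  (amul v1 p.1.1 q.1.1, amul v2 p.1.2 q.1.2, amul v3 p.2 q.2).
pose ltS l e : S := (alet v1 (f1 l e), alet v2 (f2 l e), alet v3 (f3 l e)).
pose Pr t (s : S) := apow v t (triple v1 v2 s.1.1 s.1.2 s.2).
pose acc (s e : S) := [/\ aacc v1 s.1.1 e.1.1, aacc v2 s.1.2 e.1.2
  & aacc v3 s.2 e.2].
have wS : wf_mul DS mulS.
  split => [[[x1 x2] x3] [[y1 y2] y3]|[[x1 x2] x3] [[y1 y2] y3] [[z1 z2] z3]|].
  - move=> [/= X1 [X2 X3]] [/= Y1 [Y2 Y3]].
    by split; [exact: cl1|split; [exact: cl2|exact: cl3]].
  - move=> [/= X1 [X2 X3]] [/= Y1 [Y2 Y3]] [/= Z1 [Z2 Z3]].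
    by rewrite /mulS /= ass1 // ass2 // ass3.
  exists [seq (x, z) | x <- [seq (x, y) | x <- iota 0 (asz v1),
      y <- iota 0 (asz v2)], z <- iota 0 (asz v3)].
  move=> [[x1 x2] x3] [/= X1 [X2 X3]]; apply: allpairs_f; last by rewrite mem_iota.
  by apply: allpairs_f; rewrite mem_iota.
have lkS (p q : S) : linked mulS p q <-> [/\ linked (amul v1) p.1.1 q.1.1,
    linked (amul v2) p.1.2 q.1.2 & linked (amul v3) p.2 q.2].
  case: p q => [[x1 x2] x3] [[y1 y2] y3]; rewrite /linked /mulS /=.
  by split => [[[-> -> ->] [-> -> ->]]|[[-> ->] [-> ->] [-> ->]]].
have segS W' E i j : seg mulS (fun n => ltS (W' n) (E n)) i j =
    (seg (amul v1) (fun n => alet v1 (f1 (W' n) (E n))) i j,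
     seg (amul v2) (fun n => alet v2 (f2 (W' n) (E n))) i j,
     seg (amul v3) (fun n => alet v3 (f3 (W' n) (E n))) i j).
  by rewrite /seg; elim: (_.-1) => //= k ->.
have /= := @power_sound _ _ DS (fun t => t < asz v) mulS (amul v) Pr nat nat
  (fun l => l < A) (fun x => x < X) ltS (alet v) acc
  (fun W E => [/\ L1 (fun n => f1 (W n) (E n)), L2 (fun n => f2 (W n) (E n))
      & L3 (fun n => f3 (W n) (E n))]) wS (walg_wf wv).
have suf (P Q : Prop) : (P <-> Q) -> (sgn ng P <-> sgn ng Q).
  by case: ng {Hacc} => PQ //=; split=> H /PQ.
move=> PS; apply: suf; apply: iff_trans (PS _ _ _ _ _ W s e WA lse fse) _.
- move=> a x aA xX; rewrite /DS /=.
  by split; [|split]; [apply/l1/F1|apply/l2/F2|apply/l3/F3].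
- by have [] := wv.
- move=> a [[s1 s2] s3] aA [/= S1 [S2 S3]]; rewrite /Pr /= Hlet //; split.
    by case=> x xX [[<- <-] <-]; exists x.
  by case=> x xX [-> -> ->]; exists x.
- move=> t u [[s1 s2] s3] tv uv [/= S1 [S2 S3]]; rewrite /Pr /= Hmul //; split.
    case=> p1 P1 [p2 P2 [p3 P3 [q1 Q1 [q2 Q2 [q3 Q3 [[H1 H2] [<- [<- <-]]]]]]]].
    by exists (p1, p2, p3), (q1, q2, q3).
  case=> [[[p1 p2] p3] [[[q1 q2] q3] [[/= P1 [P2 P3]] [/= Q1 [Q2 Q3]] H1 H2]]].
  case=> -> -> ->; exists p1 => //; exists p2 => //; exists p3 => //.
  by exists q1 => //; exists q2 => //; exists q3.
- move=> W' E W'A EX [[s1 s2] s3] [[e1 e2] e3] [/= S1 [S2 S3]] [/= E1 [E2 E3]].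
  move=> /lkS [/= k1 k2 k3] [c [c0 cS]]; rewrite segS => -[h1 h2 h3] he.
  have R1 : L1 (fun n => f1 (W' n) (E n)) <-> aacc v1 s1 e1.
    apply: r1 => // [n|]; first exact: F1.
    by exists c; split => // i; have := he i; rewrite segS => -[].
  have R2 : L2 (fun n => f2 (W' n) (E n)) <-> aacc v2 s2 e2.
    apply: r2 => // [n|]; first exact: F2.
    by exists c; split => // i; have := he i; rewrite segS => -[].
  have R3 : L3 (fun n => f3 (W' n) (E n)) <-> aacc v3 s3 e3.
    apply: r3 => // [n|]; first exact: F3.
    by exists c; split => // i; have := he i; rewrite segS => -[].
  by rewrite /acc /=; split=> -[/R1 ? /R2 ? /R3 ?].
split=> [[[[s1 s2] s3] [[[e1 e2] e3]
    [[/= S1 [S2 S3]] [/= E1 [E2 E3]] [H1 H2] /lkS [/= k1 k2 k3] [h1 h2 h3]]]]|].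
  exists s1 => //; exists s2 => //; exists s3 => //.
  by exists e1 => //; exists e2 => //; exists e3.
case=> s1 S1 [s2 S2 [s3 S3 [e1 E1 [e2 E2 [e3 E3 [[H1 H2] [[k1 [k2 k3]] [a1 [a2 a3]]]]]]]]].
exists (s1, s2, s3), (e1, e2, e3); split => //.
by apply/lkS.
Qed.

Lemma triple_inj v1 v2 s1 s2 s3 t1 t2 t3 :
  s1 < asz v1 -> s2 < asz v2 -> t1 < asz v1 -> t2 < asz v2 ->
  triple v1 v2 s1 s2 s3 = triple v1 v2 t1 t2 t3 -> [/\ s1 = t1, s2 = t2 & s3 = t3].
Proof.
have dm n a b c d : a < n -> c < n -> a + n * b = c + n * d -> a = c /\ b = d.
  move=> an cn; rewrite addnC [c + _]addnC ![n * _]mulnC => E; split.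
    by rewrite -(modn_small an) -(modn_small cn) -(modnMDl b) E modnMDl.
  have n0 : 0 < n by apply: leq_ltn_trans an.
  have := congr1 (divn^~ n) E.
  by rewrite !divnMDl // !divn_small // !addn0.
by move=> S1 S2 T1 T2 /(dm _ _ _ _ _ S1 T1) [-> /(dm _ _ _ _ _ S2 T2) [-> ->]].
Qed.

Lemma alg_exists N A B (M : nat -> nat -> nat) (Lt : nat -> nat)
    (Ac P : nat -> nat -> Prop) :
  exists v, [/\ asz v = N,
    forall x y, x < N -> y < N -> amul v x y = M x y,
    forall l, l < A -> alet v l = Lt l,
    forall x y, x < N -> y < N -> (aacc v x y <-> Ac x y)
  & forall t s, t < N -> s < B -> (apow v t s <-> P t s)].
Proof.
have tab (C : nat) (F : nat -> nat -> nat) : exists w, forall x y, x < C -> y < N ->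
    entry w (x * N + y) = F x y.
  have [w Hw] := entry_mkseq (fun i => F (i %/ N) (i %% N)) (C * N).
  exists w => x y xC yN; rewrite Hw.
    have N0 : 0 < N by apply: leq_ltn_trans yN.
    by rewrite divnMDl // divn_small // addn0 modnMDl modn_small.
  by apply: (@leq_trans (x.+1 * N)); rewrite ?mulSnr ?ltn_add2l // -mulSnr leq_mul.
have [w1 H1] := tab N M.
have [w2 H2] := entry_mkseq Lt A.
have [w3 H3] := tab N (fun x y => nat_of_bool `[< Ac x y >]).
have [w4 H4] := tab B (fun s t => nat_of_bool `[< P t s >]).
exists (CodeSeq.code [:: N; w1; w2; w3; w4]).
rewrite /amul /alet /aacc /apow /asz !entry_code /=.
split=> // [x y xN yN|t s tN sB]; rewrite ?H3 ?H4 //.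
  by split; case: asboolP.
by split; case: asboolP.
Qed.

(** The power set of the product semigroup, with its elements numbered, satisfies the conditions. *)
Lemma combines_exists A X f1 f2 f3 ng v1 v2 v3 A1 A2 A3 :
  walg A1 v1 -> walg A2 v2 -> walg A3 v3 ->
  (forall l e, l < A -> e < X -> f1 l e < A1) ->
  (forall l e, l < A -> e < X -> f2 l e < A2) ->
  (forall l e, l < A -> e < X -> f3 l e < A3) ->
  exists v, combines A X f1 f2 f3 ng v v1 v2 v3.
Proof.
move=> [cl1 ass1 l1] [cl2 ass2 l2] [cl3 ass3 l3] F1 F2 F3.
pose I : finType := ('I_(asz v1) * 'I_(asz v2) * 'I_(asz v3))%type.
pose T : finType := {set I}.
pose mulI (p q r : I) := [&& val r.1.1 == amul v1 p.1.1 q.1.1,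
  val r.1.2 == amul v2 p.1.2 q.1.2 & val r.2 == amul v3 p.2 q.2].
pose mulT (x y : T) : T :=
  finset (fun r : I => [exists p in x, [exists q in y, mulI p q r]]).
have mulTP (x y : T) (r : I) : reflect (exists p q, [/\ p \in x, q \in y & mulI p q r])
    (r \in mulT x y).
  rewrite inE; apply: (iffP existsP) => [[p /andP[px /existsP [q /andP[qy m]]]]|].
    by exists p, q.
  by case=> p [q [px qy m]]; exists p; rewrite px; apply/existsP; exists q; rewrite qy.
have mulIex (p q : I) : exists r, mulI p q r.
  exists ((Ordinal (cl1 p.1.1 (ltn_ord _) q.1.1 (ltn_ord _)),
    Ordinal (cl2 p.1.2 (ltn_ord _) q.1.2 (ltn_ord _))),
    Ordinal (cl3 p.2 (ltn_ord _) q.2 (ltn_ord _))).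
  by rewrite /mulI /= !eqxx.
have mulTA (x y z : T) : mulT x (mulT y z) = mulT (mulT x y) z.
  apply/setP => r; apply/mulTP/mulTP.
    case=> p [q [px /mulTP [a [b [ay bz /and3P [/eqP e1 /eqP e2 /eqP e3]]]]]].
    case/and3P => /eqP g1 /eqP g2 /eqP g3; have [c cE] := mulIex p a.
    exists c, b; split => //; first by apply/mulTP; exists p, a.
    case/and3P: cE => /eqP h1 /eqP h2 /eqP h3.
    by rewrite /mulI g1 g2 g3 e1 e2 e3 h1 h2 h3 ass1 // ass2 // ass3 // !eqxx.
  case=> p [q [/mulTP [a [b [ax ay /and3P [/eqP e1 /eqP e2 /eqP e3]]]] qz]].
  case/and3P => /eqP g1 /eqP g2 /eqP g3; have [c cE] := mulIex b q.
  exists a, c; split => //; first by apply/mulTP; exists b, q.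
  case/and3P: cE => /eqP h1 /eqP h2 /eqP h3.
  by rewrite /mulI g1 g2 g3 e1 e2 e3 h1 h2 h3 ass1 // ass2 // ass3 // !eqxx.
pose ltT l : T := finset (fun r : I => `[< exists2 e, e < X & [/\ alet v1 (f1 l e) = r.1.1,
  alet v2 (f2 l e) = r.1.2 & alet v3 (f3 l e) = r.2] >]).
pose tri (r : I) := triple v1 v2 r.1.1 r.1.2 r.2.
pose x0 : T := finset (fun=> false).
pose st (i : nat) : T := nth x0 (enum T) i.
pose rk (x : T) : nat := enum_rank x.
have rkK x : st (rk x) = x by rewrite /st /rk nth_enum_rank.
have rk_lt x : rk x < #|T| by exact: ltn_ord.
have stK i : i < #|T| -> rk (st i) = i.
  move=> iT; rewrite /rk /st -[i in RHS]/(val (Ordinal iT)) -(enum_valK (Ordinal iT)).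
  by congr (val (enum_rank _)); rewrite (enum_val_nth x0).
pose acc (x y : T) := exists s e : I, [/\ s \in x, e \in y,
  [/\ linked (amul v1) s.1.1 e.1.1, linked (amul v2) s.1.2 e.1.2
    & linked (amul v3) s.2 e.2] &
  [/\ aacc v1 s.1.1 e.1.1, aacc v2 s.1.2 e.1.2 & aacc v3 s.2 e.2]].
have [v [Nv Mv Lv Av Pv]] := @alg_exists #|T| A (asz v1 * (asz v2 * asz v3))
  (fun x y => rk (mulT (st x) (st y))) (fun l => rk (ltT l))
  (fun x y => sgn ng (acc (st x) (st y)))
  (fun t s => exists2 r, r \in st t & tri r = s).
have tri_lt s1 s2 s3 : s1 < asz v1 -> s2 < asz v2 -> s3 < asz v3 ->
    triple v1 v2 s1 s2 s3 < asz v1 * (asz v2 * asz v3).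
  have lt2 a b n m : a < n -> b < m -> a + n * b < n * m.
    move=> an bm; apply: (@leq_trans (n + n * b)); first by rewrite ltn_add2r.
    by rewrite -mulnS leq_mul.
  by move=> S1 S2 S3; apply/lt2/lt2.
have PvI t (r : I) : t < #|T| -> apow v t (tri r) <-> r \in st t.
  move=> tT; rewrite Pv // ?tri_lt //; split; last by exists r.
  case=> -[[r1 r2] r3] r't /triple_inj [] //= e1 e2 e3.
  case: r e1 e2 e3 => [[s1 s2] s3] /= e1 e2 e3.
  by rewrite -(val_inj e1) -(val_inj e2) -(val_inj e3).
exists v; split.
- split; rewrite Nv.
  + by move=> x xT y yT; rewrite Mv.
  + by move=> x xT y yT z zT; rewrite !Mv // !rkK mulTA.
  + by move=> l lA; rewrite Lv.
- move=> l lA s1 S1 s2 S2 s3 S3.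
  rewrite -[triple _ _ _ _ _]/(tri (Ordinal S1, Ordinal S2, Ordinal S3)) PvI Lv //.
  rewrite rkK inE; split => [/asboolP [e eX /= [? ? ?]]|[e eX [[? ?] ?]]].
    by exists e.
  by apply/asboolP; exists e.
- move=> t; rewrite Nv => tT u uT s1 S1 s2 S2 s3 S3.
  rewrite -[triple _ _ s1 _ _]/(tri (Ordinal S1, Ordinal S2, Ordinal S3)).
  rewrite PvI Mv // rkK; split.
    case/mulTP => p [q [pt qu /and3P [/eqP e1 /eqP e2 /eqP e3]]].
    exists p.1.1 => //; exists p.1.2 => //; exists p.2 => //.
    exists q.1.1 => //; exists q.1.2 => //; exists q.2 => //.
    split; last by [].
    by split; [have /PvI := pt|have /PvI := qu]; exact.
  case=> p1 P1 [p2 P2 [p3 P3 [q1 Q1 [q2 Q2 [q3 Q3]]]]].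
  case=> -[/(PvI t (Ordinal P1, Ordinal P2, Ordinal P3) tT) pt].
  move=> /(PvI u (Ordinal Q1, Ordinal Q2, Ordinal Q3) uT) qu [e1 [e2 e3]].
  apply/mulTP; exists (Ordinal P1, Ordinal P2, Ordinal P3),
    (Ordinal Q1, Ordinal Q2, Ordinal Q3); split => //.
  by rewrite /mulI /= e1 e2 e3 !eqxx.
- move=> t; rewrite Nv => tT g gT; rewrite Av //.
  suff [H1 H2] : acc (st t) (st g) <-> exists2 s1, s1 < asz v1 & exists2 s2, s2 < asz v2 &
        exists2 s3, s3 < asz v3 & exists2 e1, e1 < asz v1 &
        exists2 e2, e2 < asz v2 & exists2 e3, e3 < asz v3 &
          (apow v t (triple v1 v2 s1 s2 s3) /\ apow v g (triple v1 v2 e1 e2 e3)) /\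
          ((linked (amul v1) s1 e1 /\ (linked (amul v2) s2 e2 /\
            linked (amul v3) s3 e3)) /\
           (aacc v1 s1 e1 /\ (aacc v2 s2 e2 /\ aacc v3 s3 e3))).
    by rewrite /sgn; case: (ng); split; auto.
  split.
    case=> p [q [pt qu [k1 k2 k3] [a1 a2 a3]]].
    exists p.1.1 => //; exists p.1.2 => //; exists p.2 => //.
    exists q.1.1 => //; exists q.1.2 => //; exists q.2 => //.
    split; last by [].
    by split; [have /PvI := pt|have /PvI := qu]; exact.
  case=> p1 P1 [p2 P2 [p3 P3 [q1 Q1 [q2 Q2 [q3 Q3]]]]].
  case=> -[/(PvI t (Ordinal P1, Ordinal P2, Ordinal P3) tT) pt].
  move=> /(PvI g (Ordinal Q1, Ordinal Q2, Ordinal Q3) gT) qu.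
  case=> [[k1 [k2 k3]] [a1 [a2 a3]]].
  by exists (Ordinal P1, Ordinal P2, Ordinal P3),
    (Ordinal Q1, Ordinal Q2, Ordinal Q3).
Qed.

(** * Closure properties of recognisable sets *)

Definition reg A (L : (nat -> nat) -> Prop) := exists v, recognises A v L.

Lemma recognises_ext A v L L' : (forall W, (forall n, W n < A) -> (L W <-> L' W)) ->
  recognises A v L -> recognises A v L'.
Proof.
move=> LL' [wv rv]; split => // W WA s e sv ev lse fse.
by rewrite -LL' //; apply: rv.
Qed.

Lemma reg_ext A L L' : (forall W, (forall n, W n < A) -> (L W <-> L' W)) ->
  reg A L -> reg A L'.
Proof. by move=> LL' [v rv]; exists v; apply: recognises_ext rv. Qed.

Lemma reg_combine A X f1 f2 f3 ng A1 A2 A3 L1 L2 L3 :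
  reg A1 L1 -> reg A2 L2 -> reg A3 L3 ->
  (forall l e, l < A -> e < X -> f1 l e < A1) ->
  (forall l e, l < A -> e < X -> f2 l e < A2) ->
  (forall l e, l < A -> e < X -> f3 l e < A3) ->
  reg A (fun W => sgn ng (exists E, (forall n, E n < X) /\
    [/\ L1 (fun n => f1 (W n) (E n)), L2 (fun n => f2 (W n) (E n))
      & L3 (fun n => f3 (W n) (E n))])).
Proof.
move=> [v1 r1] [v2 r2] [v3 r3] F1 F2 F3.
have [[w1 _] [[w2 _] [w3 _]]] := (r1, (r2, r3)).
have [v Hv] := combines_exists ng w1 w2 w3 F1 F2 F3.
by exists v; apply: (combines_sound r1 r2 r3 F1 F2 F3 Hv).
Qed.

Lemma reg_fin (S : finType) (mul : S -> S -> S) (lt : nat -> S)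
    (acc : S -> S -> Prop) A L :
  associative mul ->
  (forall W, (forall n, W n < A) -> forall s e,
    factors mul (fun n => lt (W n)) s e -> (L W <-> acc s e)) ->
  reg A L.
Proof.
move=> mulA rL.
have [s0|S0] := posnP #|S|.
  by have := max_card (pred1 (lt 0)); rewrite card1 s0.
pose st (i : nat) : S := nth (lt 0) (enum S) i.
pose rk (x : S) : nat := enum_rank x.
have rkK x : st (rk x) = x by rewrite /st /rk nth_enum_rank.
have rk_lt x : rk x < #|S| by exact: ltn_ord.
have stK i : i < #|S| -> rk (st i) = i.
  move=> iT; rewrite /rk /st -[i in RHS]/(val (Ordinal iT)) -(enum_valK (Ordinal iT)).
  by congr (val (enum_rank _)); rewrite (enum_val_nth (lt 0)).
have [v [Nv Mv Lv Av _]] := @alg_exists #|S| A 0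
  (fun x y => rk (mul (st x) (st y))) (fun l => rk (lt l))
  (fun x y => acc (st x) (st y)) (fun _ _ => True).
have wv : walg A v.
  split; rewrite Nv.
  + by move=> x xT y yT; rewrite Mv.
  + by move=> x xT y yT z zT; rewrite !Mv // !rkK mulA.
  + by move=> l lA; rewrite Lv.
exists v; split => // W WA s e; rewrite Nv => sS eS lse [c [c0 cS Es Ee]].
rewrite Av //; apply: rL => //.
have sg i j : i < j -> seg mul (fun n => lt (W n)) i j =
    st (seg (amul v) (fun n => alet v (W n)) i j).
  have Dv n : alet v (W n) < asz v by rewrite Nv Lv.
  elim: j => // j IH; rewrite ltnS leq_eqVlt => /predU1P[->|ij].
    by rewrite !seg1 Lv // rkK.
  have := seg_dom (walg_wf wv) Dv ij; rewrite Nv => sD.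
  by rewrite !segS // IH // Mv // ?Lv // !rkK.
exists c; split=> // [|i]; first by rewrite sg ?Es // -{1}c0.
by rewrite sg // Ee.
Qed.

Lemma block_exists (c : nat -> nat) : c 0 = 0 -> (forall i, c i < c i.+1) ->
  forall n, exists i, c i <= n < c i.+1.
Proof.
move=> c0 cS n; have ex : exists i, n < c i.+1.
  by exists n; apply: leq_ltn_trans (cS n); apply: increasing_ge.
case: (ex_minnP ex) => -[|m] mc mi; first by exists 0; rewrite c0.
exists m.+1; rewrite mc andbT leqNgt; apply/negP => /mi.
by rewrite ltnn.
Qed.

(** The semigroup records, for a segment, its first and last letters, whether all steps inside are
    allowed, and whether all its letters satisfy [ev]. All automata needed below are of this kind,
    up to projection. *)
Lemma reg_local A (init : nat -> Prop) (step : nat -> nat -> Prop)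
    (ev : nat -> Prop) :
  reg A (fun W => [/\ init (W 0), forall n, step (W n) (W n.+1)
    & exists m, forall n, m <= n -> ev (W n)]).
Proof.
pose S : finType := ('I_A.+1 * 'I_A.+1 * bool * bool)%type.
pose mul (x y : S) : S := (x.1.1.1, y.1.1.2,
  [&& x.1.2, y.1.2 & `[< step (val x.1.1.2) (val y.1.1.1) >]], x.2 && y.2).
pose lt l : S := (inord l, inord l, true, `[< ev l >]).
apply: (@reg_fin S mul lt (fun s e =>
  [/\ init (val s.1.1.1), s.1.2, e.1.2 & [/\ step (val s.1.1.2) (val e.1.1.1),
      step (val e.1.1.2) (val e.1.1.1) & e.2]])).
  move=> [[[a b] c] d] [[[a' b'] c'] d'] [[[a2 b2] c2] d2].
  by rewrite /mul /= !andbA; congr (_, _, _); rewrite -!andbA; do !bool_congr.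
move=> W WA s e [c [c0 cS Es Ee]].
have inW n : val (inord (W n) : 'I_A.+1) = W n by exact: inordK (leqW (WA n)).
have sg i j : i <= j -> let x := seg mul (fun n => lt (W n)) i j.+1 in
    [/\ val x.1.1.1 = W i, val x.1.1.2 = W j,
        x.1.2 <-> forall k, i <= k < j -> step (W k) (W k.+1)
      & x.2 <-> forall k, i <= k <= j -> ev (W k)].
  elim: j => [|j IH].
    rewrite leqn0 => /eqP ->; rewrite seg1 /lt /= inW; split => //.
    split=> [/asboolP e0 k|H]; first by rewrite leqn0 /= => /eqP ->.
    by apply/asboolP; apply: H.
  rewrite leq_eqVlt ltnS => /predU1P[->|ij].
    rewrite seg1 /lt /= inW; split => //.
      by split => // _ k /andP[ik] /(leq_ltn_trans ik); rewrite ltnn.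
    split=> [/asboolP e0 k|H]; last by apply/asboolP/H; rewrite leqnn.
    by rewrite -eqn_leq => /eqP <-.
  have /= [E1 E2 E3 E4] := IH ij; rewrite segS //= /mul /= inW E1; split => //.
    rewrite E2; split.
      case/andP => /E3 H /asboolP H' k /andP[ik].
      rewrite ltnS leq_eqVlt => /predU1P[->//|kj]; by apply: H; rewrite ik.
    move=> H; apply/andP; split => //; last by apply/asboolP/H; rewrite leqnn andbT.
    by apply/E3 => k /andP[ik kj]; apply: H; rewrite ik ltnW.
  split.
    case/andP => /E4 H /asboolP H' k /andP[ik].
    rewrite leq_eqVlt => /predU1P[->//|kj]; by apply: H; rewrite ik.
  move=> H; apply/andP; split; last by apply/asboolP/H; rewrite leqnn andbT leqW.
  by apply/E4 => k /andP[ik kj]; apply: H; rewrite ik ltnW.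
pose d i := (c i.+1).-1.
have dS i : (d i).+1 = c i.+1 by rewrite prednK // (leq_ltn_trans _ (cS i)).
have cd i : c i <= d i by rewrite -ltnS dS.
have blk i : let x := if i is 0 then s else e in
    [/\ val x.1.1.1 = W (c i), val x.1.1.2 = W (d i),
        x.1.2 <-> forall k, c i <= k < d i -> step (W k) (W k.+1)
      & x.2 <-> forall k, c i <= k <= d i -> ev (W k)].
  have /= := sg _ _ (cd i); rewrite dS; case: i => [|i]; first by rewrite c0 Es.
  by rewrite Ee.
have /= [a0 b0 k0 _] := blk 0; have /= [a1 b1 k1 v1] := blk 1.
have /= [a2 b2 _ _] := blk 2.
rewrite a0 b0 a1 b1 c0; split.
  case=> i0 st [m evm]; split => //; [by apply/k0 => k _|by apply/k1 => k _|].
  split; [by rewrite -dS|by rewrite -a1 a2 -dS|].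
  have [_ _ _ /= vm] := blk m.+1; apply/vm => k /andP[ck _]; apply: evm.
  by apply: leq_trans ck; apply: leq_trans (increasing_ge cS _); apply: leqnSn.
case=> i0 st0 st1 [s01 s11 e1]; split => //.
  move=> n; have [i /andP[ci nc]] := block_exists c0 cS n.
  have [a b k _] := blk i; have [a' _ _ _] := blk i.+1.
  move: nc; rewrite -dS ltnS leq_eqVlt => /predU1P[nd|nd].
    rewrite nd dS -b -a' /=; case: (i) => [|i'] //=; first by rewrite b0 a1.
    by rewrite b1 a1.
  have : (if i is 0 then s else e).1.2 by case: (i).
  by move/k => H; apply: H; rewrite ci.
exists (c 1) => n cn; have [i /andP[ci nc]] := block_exists c0 cS n.
case: i ci nc => [|i] ci nc; first by move: (leq_trans nc cn); rewrite ltnn.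
have [_ _ _ /= vi] := blk i.+1.
by move/vi: e1 => H; apply: H; rewrite ci -ltnS dS.
Qed.

Lemma reg_true A : reg A (fun=> True).
Proof.
apply: reg_ext (reg_local A (fun=> True) (fun _ _ => True) (fun=> True)).
by move=> W _; split => // _; split => //; exists 0.
Qed.

Lemma reg_ex A X B L (f : nat -> nat -> nat) :
  reg B L -> (forall l e, l < A -> e < X -> f l e < B) ->
  reg A (fun W => exists2 E, (forall n, E n < X) & L (fun n => f (W n) (E n))).
Proof.
move=> rL fB; apply: reg_ext (reg_combine false rL (reg_true B) (reg_true B) fB fB fB).
by move=> W _; split=> [[E [EX [? _ _]]]|[E EX ?]]; exists E.
Qed.

Lemma reg_pre A B L (f : nat -> nat) :
  reg B L -> (forall l, l < A -> f l < B) -> reg A (fun W => L (fun n => f (W n))).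
Proof.
move=> rL fB; apply: reg_ext (reg_ex (X := 1) (f := fun l _ => f l) rL _) => [W _|].
  by split=> [[]|] //; exists (fun=> 0).
by move=> l e /fB.
Qed.

Lemma reg_not A L : reg A L -> reg A (fun W => ~ L W).
Proof.
move=> rL; have idA l e : l < A -> e < 1 -> l < A by [].
apply: reg_ext (reg_combine true rL (reg_true A) (reg_true A) idA idA idA) => W _ /=.
by split=> nL H; apply: nL; [exists (fun=> 0)|case: H => E [_ []]].
Qed.

Lemma reg_and A L L' : reg A L -> reg A L' -> reg A (fun W => L W /\ L' W).
Proof.
move=> rL rL'; have idA l e : l < A -> e < 1 -> l < A by [].
apply: reg_ext (reg_combine false rL rL' (reg_true A) idA idA idA) => W _ /=.
by split=> [[E [_ []]]|[]] //; exists (fun=> 0).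
Qed.

Lemma reg_or A L L' : reg A L -> reg A L' -> reg A (fun W => L W \/ L' W).
Proof.
move=> rL rL'; apply: reg_ext (reg_not (reg_and (reg_not rL) (reg_not rL'))).
by move=> W _; rewrite not_andP !not_notE.
Qed.

(** * Numeration in a quadratic unit base *)

Local Open Scope ring_scope.

Section Numeration.
Variables (R : realType) (t : nat) (b : R).
Hypotheses (t_gt2 : (2 < t)%N) (b_gt1 : 1 < b) (b_sq : b ^+ 2 = t%:R * b - 1).

(* [p] stands for the element [p.1 + p.2 b] of Z[b]; [cj] is its conjugate,   *)
(* as the conjugate of [b] is [b^-1].                                         *)
Definition ev (p : int * int) : R := p.1%:~R + p.2%:~R * b.
Definition cj (p : int * int) : R := p.1%:~R + p.2%:~R / b.
Definition mulb (p : int * int) : int * int := (- p.2, p.1 + t%:Z * p.2).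

Lemma b_gt0 : 0 < b. Proof. exact: lt_trans b_gt1. Qed.
Lemma b_neq0 : b != 0. Proof. by rewrite gt_eqF // b_gt0. Qed.

Lemma invb : b^-1 = t%:R - b.
Proof.
apply: (mulfI b_neq0); rewrite divff ?b_neq0 // mulrBr -expr2 b_sq.
by rewrite mulrC opprB addrC subrK.
Qed.

Lemma evD p q : ev (p + q) = ev p + ev q.
Proof. by rewrite /ev /= !intrD; ring. Qed.
Lemma evN p : ev (- p) = - ev p.
Proof. by rewrite /ev /= !intrN; ring. Qed.
Lemma ev0 : ev 0 = 0. Proof. by rewrite /ev /= mul0r addr0. Qed.
Lemma cjD p q : cj (p + q) = cj p + cj q.
Proof. by rewrite /cj /= !intrD; ring. Qed.
Lemma cjN p : cj (- p) = - cj p.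
Proof. by rewrite /cj /= !intrN; ring. Qed.
Lemma cj0 : cj 0 = 0. Proof. by rewrite /cj /= mul0r addr0. Qed.

Lemma ev_mulb p : ev (mulb p) = b * ev p.
Proof.
rewrite /ev /mulb /= intrD intrM intrN.
have -> : b * (p.1%:~R + p.2%:~R * b) = p.1%:~R * b + p.2%:~R * b ^+ 2 by ring.
by rewrite b_sq; ring.
Qed.

Lemma cj_mulb p : cj (mulb p) = b^-1 * cj p.
Proof.
rewrite /cj /mulb /= intrD intrM intrN.
have -> : b^-1 * (p.1%:~R + p.2%:~R / b) = p.1%:~R / b + p.2%:~R * b^-1 ^+ 2 by ring.
have -> : b^-1 ^+ 2 = t%:R / b - 1.
  by rewrite {1}expr2 {1}invb mulrBl divff ?b_neq0.
by ring.
Qed.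

Lemma mulbD p q : mulb (p + q) = mulb p + mulb q.
Proof. by congr (_, _); rewrite /=; ring. Qed.
Lemma mulb0 : mulb 0 = 0.
Proof. by congr (_, _); rewrite /=; ring. Qed.
Lemma mulbN p : mulb (- p) = - mulb p.
Proof. by congr (_, _); rewrite /=; ring. Qed.

Lemma ev_eq_cj p : ev p = cj p -> p.2 = 0.
Proof.
move=> e0; apply/eqP; rewrite -(intr_eq0 R).
have : p.2%:~R * (b - b^-1) = 0 :> R.
  by rewrite -[RHS](subrr (ev p)) {2}e0 /ev /cj; ring.
move/eqP; rewrite mulf_eq0 => /orP[//|].
by rewrite subr_eq0 gt_eqF // (lt_trans _ b_gt1) // invf_lt1 ?b_gt0.
Qed.

Lemma expb_unbounded (e C : R) : 0 < e -> exists j, C < b ^+ j * e.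
Proof.
move=> e0; have d0 : 0 < b - 1 by rewrite subr_gt0.
have bern j : 1 + j%:R * (b - 1) <= b ^+ j.
  elim: j => [|j IH]; first by rewrite mul0r addr0 expr0.
  rewrite exprS; apply: le_trans (ler_wpM2l (ltW b_gt0) IH).
  rewrite -subr_ge0 -natr1.
  have -> : b * (1 + j%:R * (b - 1)) - (1 + (j%:R + 1) * (b - 1)) =
    j%:R * (b - 1) ^+ 2 by ring.
  by rewrite mulr_ge0 ?sqr_ge0.
have [j Hj] : exists j : nat, C / e / (b - 1) < j%:R.
  exists (Num.bound `|C / e / (b - 1)|).
  exact: le_lt_trans (ler_norm _) (archi_boundP (normr_ge0 _)).
exists j; move: Hj; rewrite !ltr_pdivrMr // => H.
apply: lt_le_trans H _; apply: ler_wpM2r; first exact: ltW.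
by apply: le_trans (bern j); rewrite lerDr.
Qed.

(** [y] is the finite sum of the [I k] times b^k in Z[b], presented by Horner's scheme; [Y k] is the
    carry at position k. *)
Definition hi (I : nat -> int * int) y := exists Y : nat -> int * int,
  [/\ Y 0%N = y, forall k, Y k = I k + mulb (Y k.+1)
    & exists m, forall k, (m <= k)%N -> Y k = 0].

(** [z] is the sum of the [F k] divided by b^k, presented by its rescaled remainders [Z k]. Since
    errors are multiplied by b > 1, boundedness selects the right solution. Position 0 has weight 1
    in both halves. *)
Definition lo (F : nat -> R) z := exists Z : nat -> R,
  [/\ Z 0%N = z, forall k, Z k.+1 = b * (Z k - F k)
    & exists C, forall k, `|Z k| <= C].

Lemma hi_uniq I y y' : hi I y -> hi I y' -> y = y'.
Proof.
move=> [Y [<- YS [m Ym]]] [Y' [<- Y'S [m' Y'm]]].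
suff H j k : (k + j = maxn m m')%N -> Y k = Y' k.
  by apply: (H (maxn m m')); rewrite add0n.
elim: j k => [|j IH] k kj.
  by rewrite addn0 in kj; rewrite kj Ym ?Y'm ?leq_maxl ?leq_maxr.
by rewrite YS Y'S (IH k.+1) // addSnnS.
Qed.

Lemma hiD I I' y y' : hi I y -> hi I' y' -> hi (fun k => I k + I' k) (y + y').
Proof.
move=> [Y [<- YS [m Ym]]] [Y' [<- Y'S [m' Y'm]]].
exists (fun k => Y k + Y' k); split=> // [k|].
  by rewrite YS Y'S mulbD addrACA.
exists (maxn m m') => k km; rewrite Ym ?Y'm ?addr0 //.
  exact: leq_trans (leq_maxr _ _) km.
exact: leq_trans (leq_maxl _ _) km.
Qed.

Lemma hiN I y : hi I y -> hi (fun k => - I k) (- y).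
Proof.
move=> [Y [<- YS [m Ym]]]; exists (fun k => - Y k); split=> // [k|].
  by rewrite YS mulbN opprD.
by exists m => k /Ym ->; rewrite oppr0.
Qed.

Lemma hi_shift I y a : hi I y ->
  hi (fun k => if k is k'.+1 then I k' else a) (a + mulb y).
Proof.
move=> [Y [<- YS [m Ym]]].
exists (fun k => if k is k'.+1 then Y k' else a + mulb (Y 0%N)); split=> //.
  by case=> [|k] //.
by exists m.+1 => -[|k] //; apply: Ym.
Qed.

Lemma hi0 I : (forall k, I k = 0) -> hi I 0.
Proof.
by move=> I0; exists (fun=> 0); split=> // [k|]; [rewrite I0 mulb0 addr0|exists 0%N].
Qed.

Lemma eq_hi I I' y : I =1 I' -> hi I y -> hi I' y.
Proof. by move=> /funext ->. Qed.

Lemma hi_support I y : hi I y -> exists m, forall k, (m <= k)%N -> I k = 0.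
Proof.
move=> [Y [_ YS [m Ym]]]; exists m => k mk.
by have := YS k; rewrite !Ym ?mulb0 ?addr0 //; apply: leq_trans (leqnSn k).
Qed.

Lemma hi_exists I : (exists m, forall k, (m <= k)%N -> I k = 0) -> exists y, hi I y.
Proof.
move=> [m]; elim: m I => [|m IH] I Im; first by exists 0; apply: hi0 => k; apply: Im.
have [k mk|y /(hi_shift (I 0%N)) Hy] := IH (fun k => I k.+1); first exact: Im.
by exists (I 0%N + mulb y); apply: eq_hi Hy => -[].
Qed.

(** The bound is the fixed point of c -> b (c - B): an excess over it would be multiplied by at
    least b at each step, against boundedness. *)
Lemma lo_bound (F Z : nat -> R) (B C : R) :
  (forall k, Z k.+1 = b * (Z k - F k)) -> (forall k, `|Z k| <= C) ->
  (forall k, `|F k| <= B) -> forall k, `|Z k| <= B * b / (b - 1).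
Proof.
move=> ZS ZC FB k; have d0 : 0 < b - 1 by rewrite subr_gt0.
rewrite leNgt; apply/negP => kC; set C0 := B * b / (b - 1) in kC.
have C0E : b * (C0 - B) = C0.
  by rewrite /C0; field; rewrite gt_eqF.
have [j] := expb_unbounded (C - C0) (e := `|Z k| - C0) ltac:(by rewrite subr_gt0).
rewrite ltrBlDl ltNge => /negP; apply; apply: le_trans (ZC (k + j)%N).
elim: j => [|j IH]; first by rewrite addn0 expr0 mul1r addrC subrK.
rewrite addnS ZS normrM gtr0_norm ?b_gt0 // exprS -[X in X + _]C0E -mulrA -mulrDr.
rewrite ler_pM2l ?b_gt0 //; apply: le_trans (lerB_dist _ _).
have := FB (k + j)%N; lra.
Qed.

Lemma loD F F' z z' : lo F z -> lo F' z' -> lo (fun k => F k + F' k) (z + z').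
Proof.
move=> [Z [<- ZS [C ZC]]] [Z' [<- Z'S [C' Z'C]]].
exists (fun k => Z k + Z' k); split=> // [k|]; first by rewrite ZS Z'S; ring.
by exists (C + C') => k; apply: le_trans (ler_normD _ _) (lerD (ZC k) (Z'C k)).
Qed.

Lemma loM a F z : lo F z -> lo (fun k => a * F k) (a * z).
Proof.
move=> [Z [<- ZS [C ZC]]]; exists (fun k => a * Z k); split=> // [k|].
  by rewrite ZS; ring.
by exists (`|a| * C) => k; rewrite normrM ler_wpM2l.
Qed.

Lemma loN F z : lo F z -> lo (fun k => - F k) (- z).
Proof.
move=> /(loM (-1)); rewrite mulN1r; congr lo.
by apply/funext => k; rewrite mulN1r.
Qed.

Lemma eq_lo F F' z : F =1 F' -> lo F z -> lo F' z.
Proof. by move=> /funext ->. Qed.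

Lemma lo_uniq F z z' : lo F z -> lo F z' -> z = z'.
Proof.
move=> l1 /loN /(loD l1) [Z [Z0 ZS [C ZC]]].
have := lo_bound ZS ZC (B := 0) (fun k => _) 0.
rewrite !mul0r Z0 normr_le0 subr_eq0 => H; apply/eqP/H => k.
by rewrite subrr normr0.
Qed.

Lemma lo_ge0 F z : (forall k, 0 <= F k) -> lo F z -> 0 <= z.
Proof.
move=> F0 [Z [<- ZS [C ZC]]]; rewrite leNgt; apply/negP => z0.
have [j] := expb_unbounded C (e := - Z 0%N) ltac:(by rewrite oppr_gt0).
rewrite ltNge => /negP; apply; apply: le_trans (ZC j).
rewrite -normrN; apply: le_trans (ler_norm _).
elim: j => [|j IH]; first by rewrite expr0 mul1r.
rewrite exprS ZS -mulrA -mulrN ler_pM2l ?b_gt0 //; have := F0 j; lra.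
Qed.

Lemma lo_exists (F : nat -> R) (B : R) : (forall k, `|F k| <= B) -> exists z, lo F z.
Proof.
move=> FB; have d0 : 0 < b - 1 by rewrite subr_gt0.
pose C := B * b / (b - 1); pose s n := \sum_(k < n) F k / b ^+ k.
have bk k : 0 < b ^+ k by rewrite exprn_gt0 ?b_gt0.
have CE : C - C / b = B by rewrite /C; field; rewrite b_neq0 gt_eqF.
have sS n : s n.+1 = s n + F n / b ^+ n by rewrite /s big_ord_recr.
have step n : `|F n / b ^+ n| <= C / b ^+ n - C / b ^+ n.+1.
  rewrite normrM normfV (gtr0_norm (bk n)) exprS invfM mulrA -mulrBl.
  by rewrite CE ler_pM2r ?invr_gt0.
have mon m n : (m <= n)%N -> `|s n - s m| <= C / b ^+ m - C / b ^+ n.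
  elim: n => [|n IH]; first by rewrite leqn0 => /eqP ->; rewrite !subrr normr0.
  rewrite leq_eqVlt => /predU1P[->|/IH H]; first by rewrite !subrr normr0.
  rewrite sS addrAC; apply: le_trans (ler_normD _ _) _.
  have := step n; lra.
(* [C / b ^+ n] bounds the tail after the partial sum [s n], so the limit is the supremum of these
   lower estimates, and all [s m + C / b ^+ m] are upper bounds. *)
pose E : set R := fun x => exists n, x = s n - C / b ^+ n.
have C0 : 0 <= C.
  rewrite /C; apply: divr_ge0; last exact: ltW.
  by rewrite mulr_ge0 ?(ltW b_gt0) // (le_trans _ (FB 0%N)).
have Cb k : 0 <= C / b ^+ k by rewrite divr_ge0 // ltW.
have Eub m : ubound E (s m + C / b ^+ m).
  move=> _ [n ->]; have [mn|/ltnW nm] := leqP m n.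
    have := mon _ _ mn; rewrite ler_norml => /andP[_].
    have := Cb m; have := Cb n; lra.
  have := mon _ _ nm; rewrite ler_norml => /andP[+ _].
  have := Cb m; have := Cb n; lra.
have supE : has_sup E by split; [exists (s 0%N - C / b ^+ 0), 0%N|exists (s 0%N + C / b ^+ 0)].
pose z := sup E.
have zs n : `|z - s n| <= C / b ^+ n.
  have h1 : s n - C / b ^+ n <= z by apply: ub_le_sup; [case: supE|exists n].
  have h2 : z <= s n + C / b ^+ n by apply: ge_sup => //; case: supE.
  by rewrite ler_norml; lra.
exists z, (fun k => b ^+ k * (z - s k)); split.
- by rewrite expr0 mul1r /s big_ord0 subr0.
- by move=> k; rewrite sS exprS; field; rewrite gt_eqF.
exists C => k; rewrite normrM gtr0_norm // -ler_pdivlMl //.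
by rewrite mulrC.
Qed.

(** The greedy expansion, with digits the integer parts of the remainders. The remainders stay below
    b, and b < t because t - b = b^-1. *)
Lemma lo_greedy (x : R) : 0 <= x < b -> exists f : nat -> int,
  (forall k, 0 <= f k < t%:Z) /\ lo (fun k => (f k)%:~R) x.
Proof.
move=> xb; pose Z k := iter k (fun z => b * (z - (Num.floor z)%:~R)) x.
have Zb k : 0 <= Z k < b.
  elim: k => // k _; rewrite /= -/(Z k); have := floor_itv (Z k) => /andP[h1 h2].
  rewrite mulr_ge0 ?(ltW b_gt0) ?subr_ge0 //= -[ltRHS]mulr1 ltr_pM2l ?b_gt0 //.
  by move: h2; rewrite intrD; lra.
exists (fun k => Num.floor (Z k)); split => [k|]; last first.
  exists Z; split=> //; exists b => k; have /andP[z0 zb] := Zb k.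
  by rewrite ger0_norm // ltW.
have /andP[z0 zb] := Zb k; rewrite floor_ge0 z0 /= -(ltr_int R).
apply: le_lt_trans (floor_le _) _; apply: lt_trans zb _.
by rewrite -subr_gt0 -invb invr_gt0 b_gt0.
Qed.

Lemma int_interval (N : nat) (i : int) : (`|i| <= N)%N ->
  i \in [seq j%:Z - N%:Z | j <- iota 0 (N + N).+1].
Proof.
clear t_gt2 b_gt1 b_sq.
move=> iN; apply/mapP; exists (absz (i + N%:Z)%R); last by lia.
by rewrite mem_iota; lia.
Qed.

(** The difference of the two embeddings is [p.2] times b - b^-1, so bounds on both embeddings bound
    [p.2] and then [p.1]. *)
Lemma bounded_conjugates (C : R) : exists2 qs : seq (int * int), (0, 0) \in qs &
  forall p, `|ev p| <= C -> `|cj p| <= C -> p \in qs.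
Proof.
have d0 : 0 < b - b^-1.
  by rewrite subr_gt0 (lt_trans _ b_gt1) // invf_lt1 ?b_gt0.
pose M1 : R := 2 * C / (b - b^-1); pose M2 : R := C + M1 * b.
pose N := maxn (Num.bound `|M1|) (Num.bound `|M2|).
have le_bound (i : int) (M : R) : `|i%:~R| <= M :> R -> (`|i| <= Num.bound `|M|)%N.
  move=> iM; rewrite -(ler_nat R) natr_absz intr_norm; apply: (le_trans iM).
  exact: ltW (le_lt_trans (ler_norm _) (archi_boundP (normr_ge0 _))).
pose ints : seq int := [seq j%:Z - N%:Z | j <- iota 0 (N + N).+1].
exists [seq (m, n) | m <- ints, n <- ints].
  by apply: allpairs_f; apply: int_interval.
move=> p ep cp.
have p2 : `|p.2%:~R| <= M1 :> R.
  rewrite ler_pdivlMr // -(gtr0_norm d0) -normrM (_ : p.2%:~R * _ = ev p - cj p).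
    by rewrite mulr_natl mulr2n (le_trans (ler_normB _ _)) // lerD.
  by rewrite /ev /cj; ring.
have p1 : `|p.1%:~R| <= M2 :> R.
  rewrite (_ : p.1%:~R = ev p - p.2%:~R * b); last by rewrite /ev addrK.
  apply: le_trans (ler_normB _ _) (lerD ep _).
  by rewrite normrM (gtr0_norm b_gt0) ler_pM2r ?b_gt0.
rewrite (surjective_pairing p); apply: allpairs_f; apply: int_interval.
  by rewrite leq_max (le_bound _ _ p1) orbT.
by rewrite leq_max (le_bound _ _ p2).
Qed.

Lemma finite_bound (T : Type) (F : T -> R) (g : nat -> T) (A : nat) :
  exists2 B : R, 0 <= B & forall l, (l < A)%N -> `|F (g l)| <= B.
Proof.
elim: A => [|A [B B0 HB]]; first by exists 0.
exists (B + `|F (g A)|); first by rewrite addr_ge0.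
move=> l; rewrite ltnS leq_eqVlt => /predU1P[->|/HB H]; first by rewrite lerDr.
by rewrite (le_trans H) // lerDl.
Qed.

(* Reading a word outwards from position [0], the carries of the two halves   *)
(* and their conjugates stay bounded, so they take finitely many values.      *)
Lemma reg_zero A (zI zF : nat -> int * int) :
  reg A (fun W => exists y z, [/\ hi (fun n => zI (W n)) y,
    lo (fun n => ev (zF (W n))) z & ev y + z = 0]).
Proof.
have [B1 B10 HB1] := finite_bound ev zI A.
have [B2 B20 HB2] := finite_bound cj zI A.
have [B3 B30 HB3] := finite_bound ev zF A.
have [B4 B40 HB4] := finite_bound cj zF A.
(* [C] is stable under both recursions: [CE1] serves those of the form (c + B) / b and [CE2], an
   equality, those of the form B + c / b. *)
pose B : R := B1 + B2 + B3 + B4; pose C : R := B * b / (b - 1).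
have d0 : 0 < b - 1 by rewrite subr_gt0.
have [b0 b1] := (b_gt0, b_gt1).
have B0 : 0 <= B by rewrite /B; lra.
have CE1 : b^-1 * (C + B) <= C.
  rewrite -subr_ge0 (_ : _ - _ = B * (b - 1) / b); last first.
    by rewrite /C; field; rewrite !gt_eqF.
  by rewrite divr_ge0 ?mulr_ge0 // ltW.
have CE2 : B + b^-1 * C <= C.
  by rewrite le_eqVlt (_ : _ + _ = C) ?eqxx // /C; field; rewrite !gt_eqF.
have nb x : `|b^-1 * x| = b^-1 * `|x| by rewrite normrM gtr0_norm ?invr_gt0.
have [qs qs0 Hqs] := bounded_conjugates C.
pose Q := size qs; pose X := (Q * Q)%N; pose st i := nth 0 qs i.
have Q0 : (0 < Q)%N by rewrite lt0n; apply: contraTneq qs0 => /size0nil ->.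
(* A letter of the extended alphabet is [l * X + e], where the auxiliary part [e] guesses a carry of
   each half by its index in [qs]. *)
pose yst c := st ((c %% X) %/ Q)%N; pose zst c := st ((c %% X) %% Q)%N.
pose lt c := (c %/ X)%N.
have ltE l e : (e < X)%N -> lt (l * X + e)%N = l.
  by move=> eX; rewrite /lt divnMDl ?muln_gt0 ?Q0 // divn_small // addn0.
have rl := reg_local (A * X) (fun c => yst c + zst c = 0)
  (fun c c' => yst c = zI (lt c) + mulb (yst c') /\
               zst c' = mulb (zst c - zF (lt c))) (fun c => yst c = 0).
have fX l e : (l < A)%N -> (e < X)%N -> (l * X + e < A * X)%N.
  move=> lA eX; apply: (@leq_trans (l.+1 * X)%N); last by rewrite leq_mul.
  by rewrite mulSnr ltn_add2l.
apply: reg_ext (reg_ex (f := fun l e => (l * X + e)%N) rl fX) => W WA; split.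
  case=> E EX [/= init step [m fin]].
  pose Y n := yst (W n * X + E n)%N; pose Z n := zst (W n * X + E n)%N.
  exists (Y 0%N), (ev (Z 0%N)); split; last by rewrite -evD init ev0.
    exists Y; split=> // [k|]; last by exists m.
    by have [+ _] := step k; rewrite ltE.
  exists (fun k => ev (Z k)); split=> // [k|].
    by rewrite /Z; have [_ ->] := step k; rewrite ltE // ev_mulb evD evN.
  have [C' _ HC'] := finite_bound ev st Q.
  by exists C' => k; apply: HC'; rewrite ltn_mod.
case=> _ [_ [[Y [<- YS [m Ym]]] [Zr [<- ZrS [C' ZrC]]] YZ0]].
(* The remainders are real numbers a priori. As the total is zero, the first one is the value of
   [- Y 0], so all of them lift to Z[b] and have conjugates. *)
pose Z := fix Z k := if k is k'.+1 then mulb (Z k' - zF (W k')) else - Y 0%N.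
have ZZr k : ev (Z k) = Zr k.
  elim: k => [|k IH]; first by rewrite /= evN; lra.
  by rewrite ZrS /= ev_mulb evD evN IH.
(* There are four bounds: [ev Z] by [lo_bound]; [cj Y] downwards from the end of the integral part;
   then [cj Z] and [ev Y] upwards from [Z 0 = - Y 0]. In the last three each step divides the
   previous bound by b after adding a digit, or adds a digit after dividing. *)
have Zb k : `|ev (Z k)| <= C.
  rewrite ZZr; apply: (lo_bound ZrS ZrC) => j.
  by have := HB3 _ (WA j); rewrite /B; lra.
have cYb k : `|cj (Y k)| <= C.
  suff H j k' : (m <= k' + j)%N -> `|cj (Y k')| <= C.
    by apply: (H m); rewrite leq_addl.
  elim: j k' => [|j IH] k'.
    by rewrite addn0 => /Ym ->; rewrite cj0 normr0 divr_ge0 ?mulr_ge0 // ltW.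
  rewrite -addSnnS => /IH H; rewrite YS cjD cj_mulb.
  apply: le_trans CE2; apply: le_trans (ler_normD _ _) _.
  apply: lerD; first by have := HB2 _ (WA k'); rewrite /B; lra.
  by rewrite nb ler_pM2l ?invr_gt0.
have cZb k : `|cj (Z k)| <= C.
  elim: k => [|k IH]; first by rewrite /= cjN normrN.
  rewrite /= cj_mulb cjD cjN nb; apply: le_trans CE1.
  rewrite ler_pM2l ?invr_gt0 //; apply: le_trans (ler_normB _ _) (lerD IH _).
  by have := HB4 _ (WA k); rewrite /B; lra.
have Yb k : `|ev (Y k)| <= C.
  elim: k => [|k IH]; first by have := Zb 0%N; rewrite /= evN normrN.
  have -> : ev (Y k.+1) = b^-1 * (ev (Y k) - ev (zI (W k))).
    by rewrite (YS k) evD ev_mulb addrC addKr mulKf ?b_neq0.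
  rewrite nb; apply: le_trans CE1.
  rewrite ler_pM2l ?invr_gt0 //; apply: le_trans (ler_normB _ _) (lerD IH _).
  by have := HB1 _ (WA k); rewrite /B; lra.
have Yq k : Y k \in qs by apply: Hqs.
have Zq k : Z k \in qs by apply: Hqs.
pose E k := (index (Y k) qs * Q + index (Z k) qs)%N.
have EX k : (E k < X)%N.
  apply: (@leq_trans ((index (Y k) qs).+1 * Q)%N).
    by rewrite mulSnr ltn_add2l index_mem.
  by rewrite leq_mul // index_mem.
have YE k : yst (W k * X + E k)%N = Y k.
  rewrite /yst modnMDl modn_small // divnMDl // divn_small ?index_mem // addn0.
  exact: nth_index.
have ZE k : zst (W k * X + E k)%N = Z k.
  rewrite /zst modnMDl (modn_small (EX k)) modnMDl modn_small ?index_mem //.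
  exact: nth_index.
exists E => //; split => /=.
- by rewrite YE ZE /= subrr.
- by move=> k; rewrite !YE !ZE ltE.
- by exists m => k /Ym; rewrite YE.
Qed.

(** ** Words of digits *)

(* A letter of a word codes one digit of the integral part and one of the     *)
(* fractional part, both between [-2t] and [2t].                              *)
Definition base := (4 * t).+1.
Definition ndig := (base * base)%N.
Definition dI (d : nat) : int := (d %% base)%N%:Z - (2 * t)%N%:Z.
Definition dF (d : nat) : int := (d %/ base)%N%:Z - (2 * t)%N%:Z.
Definition dmk (i f : int) : nat :=
  (absz (i + (2 * t)%N%:Z)%R + base * absz (f + (2 * t)%N%:Z)%R)%N.

Lemma dmkK i f : (absz i <= 2 * t)%N -> (absz f <= 2 * t)%N ->
  [/\ (dmk i f < ndig)%N, dI (dmk i f) = i & dF (dmk i f) = f].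
Proof.
clear t_gt2 b_gt1 b_sq.
move=> it ft; rewrite /dI /dF /dmk.
have i1 : (absz (i + (2 * t)%N%:Z)%R < base)%N by rewrite /base; lia.
have f1 : (absz (f + (2 * t)%N%:Z)%R < base)%N by rewrite /base; lia.
split.
- apply: (@leq_trans (base + base * absz (f + (2 * t)%N%:Z)%R)%N).
    by rewrite ltn_add2r.
  by rewrite -mulnS leq_mul.
- by rewrite [(base * _)%N]mulnC [(_ + _ * base)%N]addnC modnMDl modn_small //; lia.
- by rewrite [(base * _)%N]mulnC [(_ + _ * base)%N]addnC divnMDl // divn_small //; lia.
Qed.

Lemma dF_bound d : (d < ndig)%N -> (absz (dF d) <= 2 * t)%N.
Proof.
clear t_gt2 b_gt1 b_sq.
move=> dD; have : (d %/ base < base)%N by rewrite ltn_divLR.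
by rewrite /dF; move: (d %/ base)%N => q; rewrite /base; lia.
Qed.

Lemma dI_bound d : (absz (dI d) <= 2 * t)%N.
Proof.
clear t_gt2 b_gt1 b_sq.
have : (d %% base < base)%N by rewrite ltn_mod.
by rewrite /dI; move: (d %% base)%N => q; rewrite /base; lia.
Qed.

Definition emb (i : int) : int * int := (i, 0).

Lemma ev_emb i : ev (emb i) = i%:~R.
Proof. by rewrite /ev /= mul0r addr0. Qed.

Definition digits (w : nat -> nat) := forall k, (w k < ndig)%N.
Definition valid (w : nat -> nat) := exists m, forall k, (m <= k)%N -> dI (w k) = 0.

Definition rep w x := exists y z, [/\ hi (fun k => emb (dI (w k))) y,
  lo (fun k => (dF (w k))%:~R) z & x = ev y + z].

Definition value (w : nat -> nat) : R := xget 0 [set x | rep w x].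

Lemma rep_uniq w x x' : rep w x -> rep w x' -> x = x'.
Proof.
move=> [y [z [hy lz ->]]] [y' [z' [hy' lz' ->]]].
by rewrite (hi_uniq hy hy') (lo_uniq lz lz').
Qed.

Lemma rep_val w x : rep w x -> value w = x.
Proof.
move=> wx; rewrite /value; case: xgetP => [x' _ wx'|/(_ x)//].
exact: rep_uniq wx' wx.
Qed.

Lemma rep_valid w x : rep w x -> valid w.
Proof.
move=> [y [z [/hi_support [m Hm] _ _]]]; exists m => k /Hm.
by move=> /(congr1 fst).
Qed.

Lemma val_rep w : digits w -> valid w -> rep w (value w).
Proof.
move=> dw [m vw].
have [|y hy] := @hi_exists (fun k => emb (dI (w k))).
  by exists m => k /vw ->.
have [k|z lz] := @lo_exists (fun k => (dF (w k))%:~R) (2 * t)%N%:R.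
  by rewrite -intr_norm -natr_absz ler_nat dF_bound.
by rewrite (@rep_val w (ev y + z)); exists y, z.
Qed.

Lemma val_invalid w : ~ valid w -> value w = 0.
Proof.
by move=> nv; rewrite /value; case: xgetP => // x _ /rep_valid.
Qed.

Lemma rep_mk (I F : nat -> int) y z :
  (forall k, absz (I k) <= 2 * t)%N -> (forall k, absz (F k) <= 2 * t)%N ->
  hi (fun k => emb (I k)) y -> lo (fun k => (F k)%:~R) z ->
  digits (fun k => dmk (I k) (F k)) /\ rep (fun k => dmk (I k) (F k)) (ev y + z).
Proof.
move=> It Ft hy lz; split=> [k|]; first by have [] := dmkK (It k) (Ft k).
exists y, z; split=> //.
  by apply: eq_hi hy => k; have [_ -> _] := dmkK (It k) (Ft k).
by apply: eq_lo lz => k; have [_ _ ->] := dmkK (It k) (Ft k).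
Qed.

(** Conjugation maps b^k to b^-k, so it turns a finite integral expansion into a fractional one with
    the same digits. *)
Lemma lo_cj c y : hi (fun k => emb (c k)) y -> lo (fun k => (c k)%:~R) (cj y).
Proof.
move=> [Y [<- YS [m Ym]]]; exists (fun k => cj (Y k)); split=> // [k|].
  rewrite (YS k) cjD cj_mulb (_ : cj (emb _) = (c k)%:~R).
    by rewrite addrAC subrr add0r mulVKf ?b_neq0.
  by rewrite /cj /= mul0r addr0.
have [C _ HC] := finite_bound cj Y m.
exists (`|C|) => k; have [mk|/HC H] := leqP m k; first by rewrite Ym // cj0 normr0.
exact: le_trans H (ler_norm _).
Qed.

Lemma lo_head a : lo (fun k => if k is 0%N then a else 0) a.
Proof.
exists (fun k => if k is 0%N then a else 0); split=> //.
  by case=> [|k]; rewrite subrr mulr0.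
by exists `|a| => -[|k]; rewrite ?normr0.
Qed.

Definition powb k := iter k mulb (1, 0).

Lemma ev_powb k : ev (powb k) = b ^+ k.
Proof.
by elim: k => [|k IH]; [rewrite /ev /= mul0r addr0|rewrite exprS -IH ev_mulb].
Qed.

Lemma cj_powb k : cj (powb k) = b^-1 ^+ k.
Proof.
by elim: k => [|k IH]; [rewrite /cj /= mul0r addr0|rewrite exprS -IH cj_mulb].
Qed.

Lemma hi_single k (q : int) :
  hi (fun j => emb (if j == k then q else 0)) (q * (powb k).1, q * (powb k).2).
Proof.
elim: k => [|k IH].
  have := hi_shift (emb q) (@hi0 (fun=> 0) (fun=> erefl)).
  rewrite mulb0 addr0 /= mulr1 mulr0; apply: eq_hi => -[] //.
have := hi_shift 0 IH; rewrite add0r /=.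
have -> : mulb (q * (powb k).1, q * (powb k).2) =
  (q * - (powb k).2, q * ((powb k).1 + t%:Z * (powb k).2)).
  by congr (_, _); rewrite /=; ring.
by apply: eq_hi => -[].
Qed.

(* The numbers [b ^+ k + b ^- k] are integers, which makes the expansion of a *)
(* natural number in base [b] symmetric.                                      *)
Definition lucas k : int := 2%:Z * (powb k).1 + t%:Z * (powb k).2.

Lemma lucasE k : (lucas k)%:~R = b ^+ k + b^-1 ^+ k.
Proof.
rewrite -ev_powb -cj_powb /ev /cj /lucas intrD !intrM.
have -> : (t%:Z)%:~R = b + b^-1 :> R by rewrite invb; rewrite -pmulrn; ring.
by rewrite -pmulrn; ring.
Qed.

(** Greedy expansion of n as c_0 plus the sum of c_k [lucas k] over k > 0. Digits stay below t
    because [lucas k.+2] is less than t times [lucas k.+1]. As [ev y] and [cj y] both count position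
    0, the digit c_0 appears once more on the right. *)
Lemma int_expansion (n : nat) : exists (c : nat -> int) y,
  [/\ forall k, 0 <= c k < t%:Z, hi (fun k => emb (c k)) y
    & ev y + cj y = n%:R + (c 0%N)%:~R].
Proof.
have [b0 b1 bn0] := And3 b_gt0 b_gt1 b_neq0.
have lucas_gt0 k : 0 < lucas k.
  by rewrite -(ltr_int R) lucasE addr_gt0 // exprn_gt0 // invr_gt0.
have lucas_rec k : lucas k.+2 < t%:Z * lucas k.+1.
  rewrite -(ltr_int R) intrM !lucasE.
  have -> : (t%:Z)%:~R = b + b^-1 :> R by rewrite invb; rewrite -pmulrn; ring.
  rewrite -subr_gt0 !exprS (_ : _ - _ = b ^+ k + b^-1 ^+ k).
    by rewrite addr_gt0 // exprn_gt0 // invr_gt0.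
  by field.
have main k : forall n : nat, n%:Z < lucas k.+1 -> exists (c : nat -> int) y,
    [/\ forall j, 0 <= c j < t%:Z, forall j, (k < j)%N -> c j = 0,
      hi (fun k => emb (c k)) y & ev y + cj y = n%:R + (c 0%N)%:~R].
  elim: k => [|k IH] {}n nk.
    exists (fun j => if j == 0%N then n%:Z else 0), (n%:Z * 1, n%:Z * 0).
    have l1 : lucas 1 = t%:Z by rewrite /lucas /=; ring.
    split; [|by case|exact: (hi_single 0)|].
      by case=> [|j] /=; [rewrite -l1 nk|lia].
    by rewrite /= mulr1 mulr0 /ev /cj /= !mul0r !addr0 pmulrn.
  have Lk := lucas_gt0 k.+1; set L := lucas k.+1 in Lk nk IH *.
  pose q := (n%:Z %/ L)%Z; pose r := (n%:Z %% L)%Z.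
  have rE : n%:Z = q * L + r by exact: divz_eq.
  have r0 : 0 <= r by rewrite modz_ge0 // gt_eqF.
  have rL : r < L by rewrite ltz_pmod.
  have q0 : 0 <= q by rewrite divz_ge0.
  have qt : q < t%:Z.
    rewrite ltz_divLR //; exact: lt_trans nk (lucas_rec k).
  have [|c [y [c1 c2 hy yE]]] := IH (absz r); first by rewrite gez0_abs.
  exists (fun j => c j + (if j == k.+1 then q else 0)),
    (y + (q * (powb k.+1).1, q * (powb k.+1).2)); split.
  - move=> j; case: eqP => [->|_]; last by rewrite addr0.
    by rewrite c2 // add0r q0.
  - move=> j kj; rewrite c2 ?(ltn_trans _ kj) // add0r ifN //.
    by rewrite gtn_eqF.
  - apply: eq_hi (hiD hy (hi_single k.+1 q)) => j.
    by congr (_, _); rewrite /= ?addr0.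
  have nE : n%:R = q%:~R * (b ^+ k.+1 + b^-1 ^+ k.+1) + r%:~R :> R.
    by rewrite pmulrn rE intrD intrM lucasE.
  have rr : (absz r)%:R = r%:~R :> R by rewrite pmulrn gez0_abs.
  rewrite evD cjD addrACA yE nE rr -ev_powb -cj_powb.
  by rewrite /ev /cj /= !(intrM, intrD); ring.
have [k Hk] := @expb_unbounded 1 n%:R ltr01.
have [|c [y [? _ ? ?]]] := main k n; last by exists c, y.
rewrite -(ltr_int R) lucasE -pmulrn.
have H1 : b ^+ k <= b ^+ k.+1 by rewrite ler_weXn2l // ltW.
have H2 : 0 < b^-1 ^+ k.+1 by rewrite exprn_gt0 // invr_gt0.
by rewrite mulr1 in Hk; lra.
Qed.

Lemma signed_expansion (n : int) : exists (c : nat -> int) y,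
  [/\ forall k, (absz (c k) <= 2 * t)%N, hi (fun k => emb (c k)) y
    & ev y + cj y = n%:~R + (c 0%N)%:~R].
Proof.
have [c [y [ct hy yE]]] := int_expansion (absz n).
have [n0|n0] := leP 0 n.
  exists c, y; split=> // [k|]; first by have := ct k; lia.
  by rewrite yE pmulrn gez0_abs.
exists (fun k => - c k), (- y); split=> [k||]; first by have := ct k; lia.
  by apply: eq_hi (hiN hy) => k; congr (_, _); rewrite /= oppr0.
rewrite evN cjN -opprD yE pmulrn ltz0_abs // !intrN.
by rewrite opprD opprK.
Qed.

(** The integer part is expanded symmetrically and the fractional part greedily. Both contribute
    digits below t to the fractional half, which accounts for the bound 2t. *)
Lemma nonneg_expansion (x : R) : 0 <= x -> exists (I F : nat -> int) y z,
  [/\ forall k, 0 <= I k <= (2 * t)%N%:Z, forall k, 0 <= F k <= (2 * t)%N%:Z,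
      hi (fun k => emb (I k)) y, lo (fun k => (F k)%:~R) z & x = ev y + z].
Proof.
move=> x0; have [c [y [ct hy yE]]] := int_expansion (absz (Num.floor x)).
have fE : (absz (Num.floor x))%:R = (Num.floor x)%:~R :> R.
  by rewrite pmulrn gez0_abs // floor_ge0.
have xf : 0 <= x - (Num.floor x)%:~R < b.
  have /andP[h1 h2] := floor_itv x.
  rewrite subr_ge0 h1 /=; apply: lt_trans b_gt1.
  by move: h2; rewrite intrD; lra.
have [f [ft lf]] := lo_greedy xf.
pose F k := (if k is 0%N then 0 else c k) + f k.
exists c, F, y, ((cj y - (c 0%N)%:~R) + (x - (Num.floor x)%:~R)).
split=> [k|k||| //].
- by have := ct k; lia.
- by rewrite /F; have := ct k; have := ft k; case: (k) => [|k']; lia.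
- exact: hy.
- apply: eq_lo (loD (loD (lo_cj hy) (loN (lo_head (c 0%N)%:~R))) lf) => k.
  by rewrite /F intrD; case: (k) => [|k']; rewrite ?subrr ?oppr0 ?addr0.
by move: yE; rewrite fE; lra.
Qed.

Lemma val_surj (x : R) : exists w, [/\ digits w, valid w & value w = x].
Proof.
have nn (I F : nat -> int) :
    (forall k, 0 <= I k <= (2 * t)%N%:Z) -> (forall k, 0 <= F k <= (2 * t)%N%:Z) ->
    forall k, [/\ (absz (I k) <= 2 * t)%N, (absz (F k) <= 2 * t)%N,
      (absz (- I k)%R <= 2 * t)%N & (absz (- F k)%R <= 2 * t)%N].
  by move=> I0 F0 k; have := I0 k; have := F0 k; split; lia.
have [x0|x0] := leP 0 x.
  have [I [F [y [z [I0 F0 hy lz ->]]]]] := nonneg_expansion x0.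
  have [|| ? rw] := rep_mk _ _ hy lz; try by move=> k; have [] := nn _ _ I0 F0 k.
  by eexists; split; [eassumption|apply: rep_valid rw|apply: rep_val].
have x0' : 0 <= - x by rewrite oppr_ge0 ltW.
have [I [F [y [z [I0 F0 /hiN hy /loN lz xE]]]]] := nonneg_expansion x0'.
have hy' : hi (fun k => emb (- I k)) (- y).
  by apply: eq_hi hy => k; congr (_, _); rewrite /= oppr0.
have lz' : lo (fun k => (- F k)%:~R) (- z) by apply: eq_lo lz => k; rewrite intrN.
have [|| ? rw] := rep_mk _ _ hy' lz'; try by move=> k; have [] := nn _ _ I0 F0 k.
eexists; split; [eassumption|apply: rep_valid rw|].
by rewrite (rep_val rw) evN; lra.
Qed.

Definition mulz (q p : int * int) : int * int :=
  (q.1 * p.1 + q.2 * (mulb p).1, q.1 * p.2 + q.2 * (mulb p).2).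

Lemma ev_mulz q p : ev (mulz q p) = ev q * ev p.
Proof.
rewrite {3}/ev mulrDl -mulrA -ev_mulb /mulz /ev /= !intrD !intrM !intrN !intrD.
by rewrite !intrM; ring.
Qed.

Lemma mulzD q p p' : mulz q (p + p') = mulz q p + mulz q p'.
Proof. by congr (_, _); rewrite /=; ring. Qed.

Lemma mulz0 q : mulz q 0 = 0.
Proof. by congr (_, _); rewrite /=; ring. Qed.

Lemma mulz_mulb q p : mulz q (mulb p) = mulb (mulz q p).
Proof. by congr (_, _); rewrite /=; ring. Qed.

Lemma hi_mulz q I y : hi I y -> hi (fun k => mulz q (I k)) (mulz q y).
Proof.
move=> [Y [<- YS [m Ym]]]; exists (fun k => mulz q (Y k)); split=> // [k|].
  by rewrite {1}YS mulzD mulz_mulb.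
by exists m => k /Ym ->; rewrite mulz0.
Qed.

(* Letters carry several digits, numbered from [0]. *)
Definition dg l k := ((l %/ ndig ^ k) %% ndig)%N.
Definition setd l k e := (l %% ndig ^ k + e * ndig ^ k + (l %/ ndig ^ k.+1) * ndig ^ k.+1)%N.

Lemma ndig_gt0 : (0 < ndig)%N. Proof. by rewrite muln_gt0. Qed.

Lemma dg_lt l k : (dg l k < ndig)%N.
Proof. by rewrite ltn_mod ndig_gt0. Qed.

Lemma ndigX_gt0 k : (0 < ndig ^ k)%N. Proof. by rewrite expn_gt0 ndig_gt0. Qed.

Lemma setdE l k e : (e < ndig)%N ->
  (setd l k e %% ndig ^ k = l %% ndig ^ k)%N /\ (setd l k e %/ ndig ^ k = e + l %/ ndig ^ k.+1 * ndig)%N.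
Proof.
move=> eD; have -> : setd l k e = ((e + l %/ ndig ^ k.+1 * ndig) * ndig ^ k + l %% ndig ^ k)%N.
  by rewrite /setd mulnDl -mulnA -expnS -addnA addnC.
rewrite modnMDl modn_mod divnMDl ?ndigX_gt0 // (@divn_small (l %% ndig ^ k)) ?addn0 //.
by rewrite ltn_mod ndigX_gt0.
Qed.

Lemma dg_setd l k e j : (e < ndig)%N -> dg (setd l k e) j = if j == k then e else dg l j.
Proof.
move=> eD; have [m1 d1] := setdE l k eD; rewrite /dg.
have [jk|kj|->] := ltngtP j k.
- rewrite !modn_divl -expnS; congr (_ %/ _)%N.
  have dv : (ndig ^ j.+1 %| ndig ^ k)%N by rewrite dvdn_exp2l.
  by rewrite -(modn_dvdm _ dv) m1 modn_dvdm.
- have E n : (n %/ ndig ^ j = n %/ ndig ^ k %/ ndig %/ ndig ^ (j - k.+1))%N.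
    by rewrite -{1}(subnKC kj) expnD divnMA expnSr divnMA.
  rewrite !E d1 [(e + _)%N]addnC divnMDl ?ndig_gt0 // (divn_small eD) addn0.
  by rewrite expnSr divnMA.
- by rewrite d1 addnC modnMDl modn_small.
Qed.

Lemma setd_lt l k e m : (l < ndig ^ m)%N -> (k < m)%N -> (e < ndig)%N -> (setd l k e < ndig ^ m)%N.
Proof.
clear t_gt2 b_gt1 b_sq.
move=> lm km eD; rewrite /setd -addnA.
have H1 : (l %% ndig ^ k < ndig ^ k)%N by rewrite ltn_mod ndigX_gt0.
have H2 : (e * ndig ^ k + ndig ^ k <= ndig ^ k.+1)%N by rewrite -mulSnr expnS leq_mul.
have H3 : (l %/ ndig ^ k.+1 * ndig ^ k.+1 + ndig ^ k.+1 <= ndig ^ m)%N.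
  rewrite -mulSnr -[X in (_ <= ndig ^ X)%N](subnK km) expnD leq_mul //.
  by rewrite ltn_divLR ?ndigX_gt0 // -expnD subnK.
lia.
Qed.

Definition track (W : nat -> nat) k := fun n => dg (W n) k.

Lemma track_digits W k : digits (track W k).
Proof. by move=> n; apply: dg_lt. Qed.

Definition lin (q0 q1 q2 : int * int) (f : nat -> int) (l : nat) : int * int :=
  mulz q0 (emb (f (dg l 0))) + mulz q1 (emb (f (dg l 1))) +
  mulz q2 (emb (f (dg l 2))).

(** The relation q0 x0 + q1 x1 + q2 x2 = 0 between three tracks, formed letter by letter so that it
    is an instance of [reg_zero]. *)
Definition zero_lin q0 q1 q2 (W : nat -> nat) := exists y z,
  [/\ hi (fun n => lin q0 q1 q2 dI (W n)) y,
    lo (fun n => ev (lin q0 q1 q2 dF (W n))) z & ev y + z = 0].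

Lemma zero_linP q0 q1 q2 W : (forall k, (k < 3)%N -> valid (track W k)) ->
  zero_lin q0 q1 q2 W <-> ev q0 * value (track W 0) + ev q1 * value (track W 1) +
    ev q2 * value (track W 2) = 0.
Proof.
move=> vW.
have [y0 [z0 [hy0 lz0 ->]]] := val_rep (track_digits W 0) (vW 0%N isT).
have [y1 [z1 [hy1 lz1 ->]]] := val_rep (track_digits W 1) (vW 1%N isT).
have [y2 [z2 [hy2 lz2 ->]]] := val_rep (track_digits W 2) (vW 2%N isT).
have hy := hiD (hiD (hi_mulz q0 hy0) (hi_mulz q1 hy1)) (hi_mulz q2 hy2).
have lz := loD (loD (loM (ev q0) lz0) (loM (ev q1) lz1)) (loM (ev q2) lz2).
have lz' : lo (fun n => ev (lin q0 q1 q2 dF (W n)))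
    (ev q0 * z0 + ev q1 * z1 + ev q2 * z2).
  by apply: eq_lo lz => k; rewrite /lin !evD !ev_mulz !ev_emb.
have xE : ev q0 * (ev y0 + z0) + ev q1 * (ev y1 + z1) + ev q2 * (ev y2 + z2) =
    ev (mulz q0 y0 + mulz q1 y1 + mulz q2 y2) +
    (ev q0 * z0 + ev q1 * z1 + ev q2 * z2).
  by rewrite !evD !ev_mulz; ring.
rewrite xE; split=> [[y [z [hy' lz2' <-]]]|E0].
  by rewrite (hi_uniq hy hy') (lo_uniq lz' lz2').
by exists (mulz q0 y0 + mulz q1 y1 + mulz q2 y2),
  (ev q0 * z0 + ev q1 * z1 + ev q2 * z2).
Qed.

(** A quantified track is not known to have a value. Where the other integral digits and their
    combination vanish, q0 times the remaining digit is zero, so this digit vanishes as well. *)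
Lemma zero_lin_valid q0 q1 q2 W : q0 <> 0 ->
  (forall k, (0 < k < 3)%N -> valid (track W k)) ->
  zero_lin q0 q1 q2 W -> valid (track W 0).
Proof.
move=> q00 vW [y [z [/hi_support [m Hm] _ _]]].
have [m1 H1] := vW 1%N isT; have [m2 H2] := vW 2%N isT.
exists (maxn m (maxn m1 m2)) => k; rewrite !geq_max => /and3P[mk mk1 mk2].
have := Hm k mk; rewrite /lin (H1 k mk1) (H2 k mk2).
rewrite !mulz0 !addr0 => -[]; rewrite /track; set d := dI _ => e1 e2.
have: q0.1 * d == 0 by apply/eqP; rewrite -[RHS]e1 /=; ring.
have: q0.2 * d == 0 by apply/eqP; rewrite -[RHS]e2 /=; ring.
rewrite !mulf_eq0; case: eqP => [q02 _|_ /eqP //]; case: eqP => [q01 _|_ /eqP //].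
by case: q00; rewrite [q0]surjective_pairing q01 q02.
Qed.

Lemma reg_zero_lin q0 q1 q2 A : reg A (zero_lin q0 q1 q2).
Proof. exact: reg_zero. Qed.

Definition zerod := dmk 0 0.

Lemma zerodE : [/\ (zerod < ndig)%N, dI zerod = 0 & dF zerod = 0].
Proof.
clear t_gt2 b_gt1 b_sq. exact: dmkK. Qed.

Lemma zero_rep w : (forall n, w n = zerod) -> rep w 0.
Proof.
move=> w0; have [_ zI zF] := zerodE; exists 0, 0; split; last by rewrite ev0 addr0.
  by apply: hi0 => k; rewrite w0 zI.
exists (fun=> 0); split=> // [k|]; first by rewrite w0 zF subr0 mulr0.
by exists 0 => k; rewrite normr0.
Qed.

Definition set3 a0 a1 a2 := setd (setd (setd 0 0 a0) 1 a1) 2 a2.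

Lemma set3E a0 a1 a2 : (a0 < ndig)%N -> (a1 < ndig)%N -> (a2 < ndig)%N ->
  [/\ (set3 a0 a1 a2 < ndig ^ 3)%N, dg (set3 a0 a1 a2) 0 = a0,
     dg (set3 a0 a1 a2) 1 = a1 & dg (set3 a0 a1 a2) 2 = a2].
Proof.
clear t_gt2 b_gt1 b_sq.
move=> h0 h1 h2; rewrite /set3 !dg_setd //=; split=> //.
by do 3![apply: setd_lt => //]; rewrite ndigX_gt0.
Qed.

(* Words without a value are given the value [0]: such a track is replaced by *)
(* the word of zeros.                                                         *)
Lemma reg_total (P : R -> R -> R -> Prop) L : reg (ndig ^ 3) L ->
  (forall W, (forall n, W n < ndig ^ 3)%N ->
     (forall k, (k < 3)%N -> valid (track W k)) ->
     L W <-> P (value (track W 0)) (value (track W 1)) (value (track W 2))) ->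
  reg (ndig ^ 3) (fun W => P (value (track W 0)) (value (track W 1)) (value (track W 2))).
Proof.
set X := (ndig ^ 3)%N => rL HL; have X0 : (0 < X)%N by exact: ndigX_gt0.
have [zD zI zF] := zerodE.
pose lt c := (c %/ X)%N; pose ax c := (c %% X)%N.
pose fin k (C : nat -> nat) := exists m, forall n, (m <= n)%N -> dI (dg (lt (C n)) k) = 0.
pose same k (C : nat -> nat) := forall n : nat, dg (lt (C n)) k = dg (ax (C n)) k.
pose zero k (C : nat -> nat) := forall n : nat, dg (ax (C n)) k = zerod.
(* Track k of the auxiliary word copies a track that has a value, and is the word of zeros
   otherwise. *)
pose norm k C := (fin k C /\ same k C) \/ (~ fin k C /\ zero k C).
have rfin k : reg (X * X) (fin k).
  apply: reg_ext (reg_local (X * X) (fun=> True) (fun _ _ => True)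
    (fun c => dI (dg (lt c) k) = 0)) => C _.
  by split=> [[]|].
have rsame k : reg (X * X) (same k).
  apply: reg_ext (reg_local (X * X) (fun=> True)
    (fun c _ => dg (lt c) k = dg (ax c) k) (fun=> True)) => C _.
  by split=> [[]|H] //; split=> //; exists 0%N.
have rzero k : reg (X * X) (zero k).
  apply: reg_ext (reg_local (X * X) (fun=> True)
    (fun c _ => dg (ax c) k = zerod) (fun=> True)) => C _.
  by split=> [[]|H] //; split=> //; exists 0%N.
have rnorm k : reg (X * X) (norm k).
  by apply: reg_or; apply: reg_and => //; apply: reg_not.
have rL' : reg (X * X) (fun C => L (fun n => ax (C n))).
  by apply: (reg_pre (f := ax) rL) => l _; rewrite ltn_mod.
have ltE l e : (e < X)%N -> lt (l * X + e)%N = l.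
  by move=> eX; rewrite /lt divnMDl // divn_small // addn0.
have axE l e : (e < X)%N -> ax (l * X + e)%N = e.
  by move=> eX; rewrite /ax modnMDl modn_small.
have fX l e : (l < X)%N -> (e < X)%N -> (l * X + e < X * X)%N.
  move=> lA eX; apply: (@leq_trans (l.+1 * X)%N); last by rewrite leq_mul.
  by rewrite mulSnr ltn_add2l.
have rC := reg_and (reg_and (reg_and (rnorm 0%N) (rnorm 1%N)) (rnorm 2%N)) rL'.
apply: reg_ext (reg_ex (f := fun l e => (l * X + e)%N) rC fX) => W WX.
have finE E k : (forall n, E n < X)%N ->
    fin k (fun n => (W n * X + E n)%N) <-> valid (track W k).
  by move=> EX; split=> -[m Hm]; exists m => n /Hm; rewrite ltE.
split=> [[E EX [[[n0 n1] n2]]]|PW].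
  have EE : (fun n => ax (W n * X + E n)%N) = E by apply/funext => n; rewrite axE.
  have nk k : norm k (fun n => (W n * X + E n)%N) ->
      valid (track E k) /\ value (track E k) = value (track W k).
    case=> -[].
      move=> /(finE _ _ EX) vW same_k; suff -> : track E k = track W k by [].
      by apply/funext => n; have := same_k n; rewrite ltE // axE.
    move=> nf zk; have r0 : rep (track E k) 0.
      by apply: zero_rep => n; have := zk n; rewrite axE.
    split; first exact: rep_valid r0.
    by rewrite (rep_val r0) val_invalid // => /(finE _ _ EX).
  have [[v0 e0] [[v1 e1] [v2 e2]]] := (nk _ n0, (nk _ n1, nk _ n2)).
  rewrite EE HL //; last by case=> [|[|[|]]].
  by rewrite e0 e1 e2.
pose d k n := if `[< valid (track W k) >] then dg (W n) k else zerod.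
have dD k n : (d k n < ndig)%N by rewrite /d; case: ifP => // _; apply: dg_lt.
pose E n := set3 (d 0%N n) (d 1%N n) (d 2%N n).
have HE n := set3E (dD 0%N n) (dD 1%N n) (dD 2%N n).
have EX n : (E n < X)%N by have [] := HE n.
have trE k : (k < 3)%N -> track E k = d k.
  by move=> k3; apply/funext => n; have [_ ? ? ?] := HE n; case: k k3 => [|[|[|]]].
have EE : (fun n => ax (W n * X + E n)%N) = E by apply/funext => n; rewrite axE.
have vE k : (k < 3)%N -> valid (track E k) /\ value (track E k) = value (track W k).
  move=> k3; rewrite trE // /d; case: asboolP => vW; first by [].
  have r0 : rep (fun=> zerod) 0 by apply: zero_rep.
  split; first exact: rep_valid r0.
  by rewrite (rep_val r0) val_invalid.
have nE k : (k < 3)%N -> norm k (fun n => (W n * X + E n)%N).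
  move=> k3; rewrite /norm; have [vW|vW] := pselect (valid (track W k)).
    left; split; first exact/finE.
    move=> n; rewrite ltE // axE //; have /(congr1 (fun f => f n)) := trE k k3.
    by rewrite /track => ->; rewrite /d asboolT.
  right; split; first by move/finE => /(_ EX).
  move=> n; rewrite axE //; have /(congr1 (fun f => f n)) := trE k k3.
  by rewrite /track => ->; rewrite /d asboolF.
exists E => //; split; first by split; [split|]; apply: nE.
rewrite EE; apply/HL => //; first by move=> k /vE [].
by have [[_ ->] [[_ ->] [_ ->]]] := (vE 0%N isT, (vE 1%N isT, vE 2%N isT)).
Qed.

(** * Recognisable relations between real numbers *)

Definition tval W k := value (track W k).

Lemma ev_int (m : int) : ev (m, 0) = m%:~R.
Proof. exact: ev_emb. Qed.

Lemma reg_eq : reg (ndig ^ 3) (fun W => tval W 1 = tval W 0).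
Proof.
apply: (@reg_total (fun x0 x1 _ => x1 = x0)) (reg_zero_lin (-1, 0) (1, 0) (0, 0) _) _.
move=> W _ vW; rewrite zero_linP // !ev_int; split; lra.
Qed.

Lemma reg_add : reg (ndig ^ 3) (fun W => tval W 1 + tval W 2 = tval W 0).
Proof.
apply: (@reg_total (fun x0 x1 x2 => x1 + x2 = x0))
  (reg_zero_lin (-1, 0) (1, 0) (1, 0) _) _.
move=> W _ vW; rewrite zero_linP // !ev_int; split; lra.
Qed.

Lemma reg_mulb : reg (ndig ^ 3) (fun W => b * tval W 1 = tval W 0).
Proof.
apply: (@reg_total (fun x0 x1 _ => b * x1 = x0))
  (reg_zero_lin (-1, 0) (0, 1) (0, 0) _) _.
move=> W _ vW; rewrite zero_linP // !ev_int.
have -> : ev (0, 1) = b by rewrite /ev /= add0r mul1r.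
split; lra.
Qed.

Lemma track_setd W E k j : (forall n, E n < ndig)%N ->
  track (fun n => setd (W n) k (E n)) j = if j == k then E else track W j.
Proof.
move=> ED; apply/funext => n; rewrite /track dg_setd //.
by case: eqP.
Qed.

(** The order is obtained by projection: a real is nonnegative iff it has an expansion with
    nonnegative digits, by [nonneg_expansion] and [lo_ge0]. *)
Lemma reg_le : reg (ndig ^ 3) (fun W => tval W 1 <= tval W 2).
Proof.
have rnn := reg_local (ndig ^ 3) (fun=> True)
  (fun l _ => 0 <= dI (dg l 0) /\ 0 <= dF (dg l 0)) (fun=> True).
have rz := reg_and rnn (reg_zero_lin (1, 0) (1, 0) (-1, 0) (ndig ^ 3)).
have f3 l e : (l < ndig ^ 3)%N -> (e < ndig)%N -> (setd l 0 e < ndig ^ 3)%N.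
  by move=> l3 eD; apply: setd_lt.
have := reg_ex rz f3; move=> rL.
apply: (@reg_total (fun _ x1 x2 => x1 <= x2) _ rL) => W WX vW; split.
  case=> E ED [[_ nn _] zl].
  have vE k : (k < 3)%N -> valid (track (fun n => setd (W n) 0 (E n)) k).
    case: k => [_|k k3]; last by rewrite track_setd //; apply: vW.
    apply: zero_lin_valid zl => // -[|k] //= k3; rewrite track_setd //=.
    exact: vW.
  have := zl; rewrite zero_linP // !track_setd //= !ev_int.
  have vE0 : valid E by have := vE 0%N isT; rewrite track_setd.
  suff : 0 <= value E by lra.
  have [y [z [[Y [<- YS [m Ym]]] lz ->]]] := val_rep ED vE0.
  have nnI n : 0 <= dI (E n) by have [] := nn n; rewrite dg_setd.
  have nnF n : 0 <= dF (E n) by have [_] := nn n; rewrite dg_setd.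
  apply: addr_ge0; last by apply: lo_ge0 lz => n; rewrite ler0z.
  suff H j k : (m <= k + j)%N -> 0 <= ev (Y k) by apply: (H m); rewrite leq_addl.
  elim: j k => [|j IH] k; first by rewrite addn0 => /Ym ->; rewrite ev0.
  rewrite -addSnnS => /IH H; rewrite YS evD ev_mulb ev_emb.
  by rewrite addr_ge0 ?ler0z // mulr_ge0 // ltW ?b_gt0.
move=> x12; have x0 : 0 <= value (track W 2) - value (track W 1) by rewrite subr_ge0.
have [I [F [y [z [I0 F0 hy lz xE]]]]] := nonneg_expansion x0.
have [k|k|ED rE] := rep_mk _ _ hy lz.
- by have := I0 k; lia.
- by have := F0 k; lia.
set E := fun k => dmk (I k) (F k) in ED rE.
exists E => //; split.
  split=> //; last by exists 0%N.
  move=> n; rewrite dg_setd //=.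
  have [|| _ -> ->] := @dmkK (I n) (F n).
  - by have := I0 n; lia.
  - by have := F0 n; lia.
  by have /andP[-> _] := I0 n; have /andP[-> _] := F0 n.
rewrite zero_linP => [|k k3].
  by rewrite !track_setd //= !ev_int (rep_val rE); lra.
rewrite track_setd //; case: eqP => _; [exact: rep_valid rE|exact: vW].
Qed.

Lemma reg_lt : reg (ndig ^ 3) (fun W => tval W 1 < tval W 2).
Proof.
pose sw l := set3 0 (dg l 2) (dg l 1).
have swE l := set3E ndig_gt0 (dg_lt l 2) (dg_lt l 1).
have := reg_not (reg_pre (f := sw) (A := (ndig ^ 3)%N) reg_le _).
move=> H; apply: reg_ext (H _) => [W _|l _]; last by have [] := swE l.
have -> : tval (fun n => sw (W n)) 1 = tval W 2.
  by congr value; apply/funext => n; rewrite /track; have [] := swE (W n).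
have -> : tval (fun n => sw (W n)) 2 = tval W 1.
  by congr value; apply/funext => n; rewrite /track; have [] := swE (W n).
by rewrite ltNge; split => /negP.
Qed.

(* [x] is an integer iff it has a finite expansion which is fixed by          *)
(* conjugation, that is, by the exchange of the two halves.                   *)
Lemma reg_int : reg (ndig ^ 3) (fun W => tval W 1 \is a Num.int).
Proof.
pose sw d := dmk (dF d) (dI d).
have swE d : (d < ndig)%N -> [/\ (sw d < ndig)%N, dI (sw d) = dF d & dF (sw d) = dI d].
  by move=> dD; apply: dmkK; [exact: dF_bound|exact: dI_bound].
have f1 l e : (l < ndig ^ 3)%N -> (e < ndig)%N -> (setd l 0 e < ndig ^ 3)%N.
  by move=> l3 eD; apply: setd_lt.
have f2 l e : (l < ndig ^ 3)%N -> (e < ndig)%N -> (setd l 0 (sw e) < ndig ^ 3)%N.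
  by move=> l3 eD; apply: setd_lt => //; have [] := swE _ eD.
have rz := reg_zero_lin (1, 0) (-1, 0) (0, 0) (ndig ^ 3).
have rL := reg_combine false rz rz (reg_true (ndig ^ 3)) f1 f2 f1.
apply: (@reg_total (fun _ x _ => x \is a Num.int) _ rL) => W WX vW /=.
have vS E : digits E -> valid E ->
    forall k, (k < 3)%N -> valid (track (fun n => setd (W n) 0 (E n)) k).
  by move=> ED vE k k3; rewrite track_setd //; case: eqP => _ //; apply: vW.
split.
  case=> E [ED [z1 z2 _]]; pose E' n := sw (E n).
  have E'ndig n : (E' n < ndig)%N by have [] := swE _ (ED n).
  have vE : valid E.
    have := @zero_lin_valid (1, 0) (-1, 0) (0, 0) _ _ _ z1; rewrite track_setd //=.
    by apply=> // -[|k] //= k3; rewrite track_setd //=; apply: vW.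
  have vE' : valid E'.
    have := @zero_lin_valid (1, 0) (-1, 0) (0, 0) _ _ _ z2; rewrite track_setd //=.
    by apply=> // -[|k] //= k3; rewrite track_setd //=; apply: vW.
  have x1 : value E = value (track W 1).
    move: z1; rewrite zero_linP; last exact: vS.
    by rewrite !track_setd //= !ev_int; lra.
  have x2 : value E' = value (track W 1).
    move: z2; rewrite zero_linP; last exact: vS.
    by rewrite !track_setd //= !ev_int; lra.
  have [y [z [hy lz xE]]] := val_rep ED vE.
  have [y' [z' [hy' lz' xE']]] := val_rep E'ndig vE'.
  have zE : z = cj y'.
    apply: lo_uniq lz _; apply: eq_lo (lo_cj hy') => k.
    by have [_ -> _] := swE _ (ED k).
  have zE' : z' = cj y.
    apply: lo_uniq lz' _; apply: eq_lo (lo_cj hy) => k.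
    by have [_ _ ->] := swE _ (ED k).
  (* The two equations make y - y' equal to its conjugate, hence a rational integer. The value is
     then an integer because b + b^-1 = t. *)
  have e1 : value (track W 1) = ev y + cj y' by rewrite -x1 xE zE.
  have e2 : value (track W 1) = ev y' + cj y by rewrite -x2 xE' zE'.
  have y2 : y.2 = y'.2.
    apply/eqP; rewrite -subr_eq0; apply/eqP.
    apply: (@ev_eq_cj (y - y')); rewrite evD evN cjD cjN; lra.
  rewrite e1 /ev /cj y2.
  have -> : y.1%:~R + y'.2%:~R * b + (y'.1%:~R + y'.2%:~R / b) =
    (y.1 + y'.1 + t%:Z * y'.2)%:~R :> R.
    rewrite !intrD intrM -pmulrn.
    have -> : t%:R = b + b^-1 by rewrite invb; ring.
    by ring.
  exact: rpred_int.
move=> /intrP [n xn]; have [c [y [ct hy yE]]] := signed_expansion n.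
(* The digit at position 0 is kept in one half only, since it would otherwise be counted twice; the
   exchanged word keeps it in the other half and has the same value. *)
pose F k := if k is 0%N then 0 else c k.
have Ft k : (absz (F k) <= 2 * t)%N by rewrite /F; case: (k).
have lF : lo (fun k => (F k)%:~R) (cj y - (c 0%N)%:~R).
  apply: eq_lo (loD (lo_cj hy) (loN (lo_head (c 0%N)%:~R))) => k.
  by rewrite /F; case: (k) => [|k']; rewrite ?subrr ?oppr0 ?addr0.
have hF : hi (fun k => emb (F k)) (y - (c 0%N * 1, c 0%N * 0)).
  apply: eq_hi (hiD hy (hiN (hi_single 0 (c 0%N)))) => k.
  by congr (_, _); rewrite /F /=; case: (k) => [|k'] /=; ring.
have [ED rE] := rep_mk ct Ft hy lF; have [E'ndig rE'] := rep_mk Ft ct hF (lo_cj hy).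
exists (fun k => dmk (c k) (F k)); split=> //; split=> //.
  rewrite zero_linP; last exact: vS ED (rep_valid rE).
  rewrite !track_setd //= (rep_val rE) !ev_int xn.
  by rewrite mulr0z; lra.
have swE' : (fun k => sw (dmk (c k) (F k))) = (fun k => dmk (F k) (c k)).
  by apply/funext => k; rewrite /sw; have [_ -> ->] := dmkK (ct k) (Ft k).
have -> : (fun k => setd (W k) 0 (sw (dmk (c k) (F k)))) =
          (fun k => setd (W k) 0 (dmk (F k) (c k))).
  by apply/funext => k; rewrite -[sw _]/((fun k => sw (dmk (c k) (F k))) k) swE'.
rewrite zero_linP; last exact: vS E'ndig (rep_valid rE').
rewrite !track_setd //= (rep_val rE') !ev_int xn evD evN.
by rewrite /(ev (_ * 1, _)) /ev /= mulr1 mulr0 mulr0z; move: yE; rewrite /ev; lra.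
Qed.
End Numeration.

(** * Decidability of the certificate conditions *)

Local Open Scope nat_scope.

Fixpoint wkn j k : env (j + k) -> env k :=
  match j with
  | 0 => fun e => e
  | j'.+1 => fun e => wkn (j := j') e.1
  end.

Lemma rc_app2 k j (F : env k -> nat -> nat -> nat) (g h : env (j + k) -> nat) :
  @rc k.+2 (fun e => F e.1.1 e.1.2 e.2) -> rc g -> rc h ->
  rc (fun e => F (wkn e) (g e) (h e)).
Proof.
move=> rF rg rh.
have := @rc_compn (j + k) k.+2 _
  (h :: g :: [seq (fun e : env (j + k) => nth 0 (seq_of e) (j + i)) | i <- iota 0 k]) _ rF.
rewrite /= size_map size_iota => /(_ erefl) H; apply: rc_ext (H _) => [e|].
  congr (F _ _ _); rewrite -map_comp (_ : map _ _ = seq_of (wkn e)) ?seq_ofK //.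
  apply: (@eq_from_nth _ 0) => [|i]; rewrite size_map size_iota ?size_seq_of //.
  move=> ik; rewrite (nth_map 0) ?size_iota // nth_iota //= add0n => {ik}.
  by elim: j e {rg rh h g H} => //= j IH e; apply: IH.
case=> [|[|i]] //= ik; rewrite !ltnS in ik.
by rewrite (nth_map 0) ?size_iota // nth_iota //; exact: (rc_nth (j + k)).
Qed.

Lemma rp_and3 k (P Q S : env k -> Prop) : rp P -> rp Q -> rp S ->
  rp (fun e => [/\ P e, Q e & S e]).
Proof.
by move=> rP rQ rS; apply: rp_ext (rp_and rP (rp_and rQ rS)) => e;
  split=> [[? []]|[]].
Qed.

Lemma rp_and4 k (P Q S T : env k -> Prop) : rp P -> rp Q -> rp S -> rp T ->
  rp (fun e => [/\ P e, Q e, S e & T e]).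
Proof.
by move=> rP rQ rS rT; apply: rp_ext (rp_and rP (rp_and rQ (rp_and rS rT))) => e;
  split=> [[? [? []]]|[]].
Qed.

Lemma rp_bex2 k (n : env k -> nat) (P : env k -> nat -> Prop) :
  rc n -> @rp k.+1 (fun e => P e.1 e.2) ->
  rp (fun e => exists x, x < n e /\ P e x).
Proof.
move=> rn rP; apply: rp_ext (rp_bex rn rP) => e.
by split=> [[x ? ?]|[x [? ?]]]; exists x.
Qed.

Ltac rc_weak H := first
  [ exact H | exact (rc_wk H) | exact (rc_wk (rc_wk H))
  | exact (rc_wk (rc_wk (rc_wk H))) | exact (rc_wk (rc_wk (rc_wk (rc_wk H))))
  | exact (rc_wk (rc_wk (rc_wk (rc_wk (rc_wk H)))))
  | exact (rc_wk (rc_wk (rc_wk (rc_wk (rc_wk (rc_wk H))))))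
  | exact (rc_wk (rc_wk (rc_wk (rc_wk (rc_wk (rc_wk (rc_wk H)))))))
  | exact (rc_wk (rc_wk (rc_wk (rc_wk (rc_wk (rc_wk (rc_wk (rc_wk H))))))))
  | exact (rc_wk (rc_wk (rc_wk (rc_wk (rc_wk (rc_wk (rc_wk (rc_wk (rc_wk H)))))))))
  | exact (rc_wk (rc_wk (rc_wk (rc_wk (rc_wk (rc_wk (rc_wk (rc_wk (rc_wk
      (rc_wk H))))))))))
  | exact (rc_wk (rc_wk (rc_wk (rc_wk (rc_wk (rc_wk (rc_wk (rc_wk (rc_wk
      (rc_wk (rc_wk H)))))))))))
  | exact (rc_wk (rc_wk (rc_wk (rc_wk (rc_wk (rc_wk (rc_wk (rc_wk (rc_wk
      (rc_wk (rc_wk (rc_wk H)))))))))))) ].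

Ltac rc_leaf := first
  [ rc_weak uconstr:(rc_var _) | match goal with H : rc _ |- _ => rc_weak H end
  | apply: rc_const ].

Ltac rc_auto := cbv beta; first
  [ rc_leaf
  | match goal with
    | |- rc (fun e => _.+1) => apply: rc_succ; rc_auto
    | |- rc (fun e => _.-1) => apply: rc_pred; rc_auto
    | |- rc (fun e => (_ + _)%N) => apply: rc_add; rc_auto
    | |- rc (fun e => (_ * _)%N) => apply: rc_mul; rc_auto
    | |- rc (fun e => (_ - _)%N) => apply: rc_subn; rc_auto
    | |- rc (fun e => (_ ^ _)%N) => apply: rc_exp; rc_auto
    | |- rc (fun e => (_ %/ _)%N) => apply: rc_div; rc_auto
    | |- rc (fun e => (_ %% _)%N) => apply: rc_mod; rc_auto
    | |- rc (fun e => cns _ _) => apply: rc_cns; rc_auto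
    | |- rc (fun e => entry _ _) => apply: rc_entry; rc_auto
    end ].

Ltac rp_auto tac := cbv beta; first
  [ match goal with
    | |- rp (fun e => _ /\ _) => apply: rp_and; rp_auto tac
    | |- rp (fun e => _ \/ _) => apply: rp_or; rp_auto tac
    | |- rp (fun e => ~ _) => apply: rp_not; rp_auto tac
    | |- rp (fun e => _ <-> _) => apply: rp_iff; rp_auto tac
    | |- rp (fun e => and3 _ _ _) => apply: rp_and3; rp_auto tac
    | |- rp (fun e => and4 _ _ _ _) => apply: rp_and4; rp_auto tac
    | |- rp (fun e => forall x, is_true (x < _) -> _) =>
        apply: rp_ball; [rc_auto|rp_auto tac]
    | |- rp (fun e => exists2 x, is_true (x < _) & _) =>
        apply: rp_bex; [rc_auto|rp_auto tac]
    | |- rp (fun e => exists x, is_true (x < _) /\ _) =>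
        apply: rp_bex2; [rc_auto|rp_auto tac]
    | |- rp (fun e => is_true (_ < _)) => apply: rp_lt; rc_auto
    | |- rp (fun e => is_true (_ <= _)) => apply: rp_le; rc_auto
    | |- rp (fun e => _ = _) => apply: rp_eq; rc_auto
    | |- rp (fun e => _ -> _) => apply: rp_imp; rp_auto tac
    end
  | tac ].

Lemma rc_asz k (v : env k -> nat) : rc v -> rc (fun e => asz (v e)).
Proof. by move=> rv; rewrite /asz; rc_auto. Qed.

Lemma rc_amul k (v x y : env k -> nat) : rc v -> rc x -> rc y ->
  rc (fun e => amul (v e) (x e) (y e)).
Proof. by move=> rv rx ry; rewrite /amul /asz; rc_auto. Qed.

Lemma rc_alet k (v l : env k -> nat) : rc v -> rc l -> rc (fun e => alet (v e) (l e)).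
Proof. by move=> rv rl; rewrite /alet; rc_auto. Qed.

Lemma rp_aacc k (v x y : env k -> nat) : rc v -> rc x -> rc y ->
  rp (fun e => aacc (v e) (x e) (y e)).
Proof. by move=> rv rx ry; rewrite /aacc /asz; rp_auto fail. Qed.

Lemma rp_apow k (v x y : env k -> nat) : rc v -> rc x -> rc y ->
  rp (fun e => apow (v e) (x e) (y e)).
Proof. by move=> rv rx ry; rewrite /apow /asz; rp_auto fail. Qed.

Lemma rp_linked k (v x y : env k -> nat) : rc v -> rc x -> rc y ->
  rp (fun e => linked (amul (v e)) (x e) (y e)).
Proof. by move=> rv rx ry; rewrite /linked /amul /asz; rp_auto fail. Qed.

Lemma rc_triple k (v1 v2 s1 s2 s3 : env k -> nat) : rc v1 -> rc v2 ->
  rc s1 -> rc s2 -> rc s3 ->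
  rc (fun e => triple (v1 e) (v2 e) (s1 e) (s2 e) (s3 e)).
Proof. by move=> r1 r2 q1 q2 q3; rewrite /triple /asz; rc_auto. Qed.

Lemma rp_walg k (A v : env k -> nat) : rc A -> rc v ->
  rp (fun e => walg (A e) (v e)).
Proof. by move=> rA rv; rewrite /walg /amul /alet /asz; rp_auto fail. Qed.

Lemma rp_sgn k b (P : env k -> Prop) : rp P -> rp (fun e => sgn b (P e)).
Proof. by case: b => //; apply: rp_not. Qed.

Ltac rc_alg := cbv beta; first
  [ rc_leaf
  | match goal with
    | |- rc (fun e => asz _) => apply: rc_asz; rc_alg
    | |- rc (fun e => amul _ _ _) => apply: rc_amul; rc_alg
    | |- rc (fun e => alet _ _) => apply: rc_alet; rc_alg
    | |- rc (fun e => triple _ _ _ _ _) => apply: rc_triple; rc_alg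
    end ].

Ltac rp_alg := first
  [ apply: rp_linked; rc_alg | apply: rp_aacc; rc_alg | apply: rp_apow; rc_alg
  | apply: rp_eq; rc_alg ].

Lemma rp_combines k (A X : env k -> nat) (f1 f2 f3 : env k -> nat -> nat -> nat) ng
    (v v1 v2 v3 : env k -> nat) : rc A -> rc X ->
  @rc k.+2 (fun e => f1 e.1.1 e.1.2 e.2) -> @rc k.+2 (fun e => f2 e.1.1 e.1.2 e.2) ->
  @rc k.+2 (fun e => f3 e.1.1 e.1.2 e.2) -> rc v -> rc v1 -> rc v2 -> rc v3 ->
  rp (fun e => combines (A e) (X e) (f1 e) (f2 e) (f3 e) ng (v e) (v1 e) (v2 e) (v3 e)).
Proof.
move=> rA rX r1 r2 r3 rv rv1 rv2 rv3; rewrite /combines.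
(* The clause on letters binds l, s1, s2, s3 and e; the maps of letters are applied to the outermost
   and the innermost of these five. *)
have F1 := rc_app2 (j := 5) r1 (rc_wk (rc_wk (rc_wk (rc_wk (rc_var _))))) (rc_var _).
have F2 := rc_app2 (j := 5) r2 (rc_wk (rc_wk (rc_wk (rc_wk (rc_var _))))) (rc_var _).
have F3 := rc_app2 (j := 5) r3 (rc_wk (rc_wk (rc_wk (rc_wk (rc_var _))))) (rc_var _).
have [q q1 q2 q3] := And4 (rc_asz rv) (rc_asz rv1) (rc_asz rv2) (rc_asz rv3).
have L1 := rc_alet (rc_wk (rc_wk (rc_wk (rc_wk (rc_wk rv1))))) F1.
have L2 := rc_alet (rc_wk (rc_wk (rc_wk (rc_wk (rc_wk rv2))))) F2.
have L3 := rc_alet (rc_wk (rc_wk (rc_wk (rc_wk (rc_wk rv3))))) F3.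
clear F1 F2 F3 r1 r2 r3.
rp_auto ltac:(first
  [ apply: rp_walg; rc_alg
  | apply: rp_sgn; rp_auto ltac:(rp_alg)
  | rp_alg ]).
Qed.

(** * Certificates *)

Section Rules.
Variables (R : realType) (t : nat) (b : R).
Hypotheses (t_gt2 : 2 < t) (b_gt1 : (1 < b)%R)
  (b_sq : (b ^+ 2 = t%:R * b - 1)%R).
Variables (vEq vAdd vMul vLt vInt vTrue : nat).

Local Notation nd := (ndig t).
Local Notation dg := (dg t).
Local Notation setd := (setd t).
Local Notation set3 := (set3 t).
Local Notation tv := (tval t b).
Local Notation X := (nd ^ 2).
Local Notation A3 := (nd ^ 3).

Let y l := dg l 0.
Let x l := dg l 1.
Let z (_ _ : nat) := 0.

(* In the rules for numbers a letter carries an argument [x] and a value [y]; *)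
(* in those for terms and formulas, a value and the variables.                *)
Definition rule_zero v := combines A3 X (fun l _ => set3 (y l) (y l) (y l))
  z z false v vAdd vTrue vTrue.
Definition rule_succ v v1 := combines A3 X (fun l e => set3 (y e) (x l) 0)
  (fun l e => set3 (y l) (y e) (x l)) z false v v1 vAdd vTrue.
Definition rule_diff v v1 v2 := combines A3 X (fun l e => set3 (y e) (x l) 0)
  (fun l e => set3 (x e) (x l) 0) (fun l e => set3 (y e) (y l) (x e))
  false v v1 v2 vAdd.
Definition rule_mulb v v1 := combines A3 X (fun l e => set3 (y e) (x l) 0)
  (fun l e => set3 (y l) (y e) 0) z false v vMul v1 vTrue.
Definition rule_sum v v1 v2 := combines A3 X (fun l e => set3 (y e) (x l) 0)
  (fun l e => set3 (x e) (x l) 0) (fun l e => set3 (y l) (y e) (x e))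
  false v v1 v2 vAdd.
Definition rule_div v v1 v2 := combines A3 X (fun l e => set3 (y e) (x l) 0)
  (fun l e => set3 (y e) (y l) 0) z false v v1 v2 vTrue.

Definition rule_Tvar A i v := combines A X
  (fun l e => set3 (y l) (dg l i.+1) 0) z z false v vEq vTrue vTrue.
Definition rule_Tadd A v v1 v2 := combines A X (fun l e => setd l 0 (y e))
  (fun l e => setd l 0 (x e)) (fun l e => set3 (y l) (y e) (x e))
  false v v1 v2 vAdd.
Definition rule_Tscale A v v1 v2 := combines A X (fun l e => setd l 0 (y e))
  (fun l e => set3 (y l) (y e) 0) z false v v1 v2 vTrue.
Definition rule_Feq A v v1 v2 := combines A X (fun l e => setd l 0 (y e))
  (fun l e => setd l 0 (x e)) (fun l e => set3 (y e) (x e) 0)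
  false v v1 v2 vEq.
Definition rule_Flt A v v1 v2 := combines A X (fun l e => setd l 0 (y e))
  (fun l e => setd l 0 (x e)) (fun l e => set3 0 (y e) (x e))
  false v v1 v2 vLt.
Definition rule_Fint A v v1 := combines A X (fun l e => setd l 0 (y e))
  (fun l e => set3 0 (y e) 0) z false v v1 vInt vTrue.
Definition rule_Fnot A v v1 := combines A X (fun l _ => l) z z true v v1 vTrue vTrue.
Definition rule_Fand A v v1 v2 := combines A X (fun l _ => l) (fun l _ => l) z
  false v v1 v2 vTrue.
Definition rule_Fex A i v v1 := combines A X (fun l e => setd l i.+1 (y e)) z z
  false v v1 vTrue vTrue.

Hypotheses (hEq : recognises A3 vEq (fun W => tv W 1 = tv W 0))
  (hAdd : recognises A3 vAdd (fun W => tv W 1 + tv W 2 = tv W 0)%R)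
  (hMul : recognises A3 vMul (fun W => b * tv W 1 = tv W 0)%R)
  (hLt : recognises A3 vLt (fun W => tv W 1 < tv W 2)%R)
  (hInt : recognises A3 vInt (fun W => tv W 1 \is a Num.int))
  (hTrue : recognises A3 vTrue (fun=> True)).

Lemma tv_set3 f g h : digits t f -> digits t g -> digits t h ->
  [/\ tv (fun n => set3 (f n) (g n) (h n)) 0 = value t b f,
      tv (fun n => set3 (f n) (g n) (h n)) 1 = value t b g
    & tv (fun n => set3 (f n) (g n) (h n)) 2 = value t b h].
Proof.
move=> fd gd hd; split; congr value; apply/funext => n; rewrite /track.
- by have [_ ->] := set3E (fd n) (gd n) (hd n).
- by have [_ _ ->] := set3E (fd n) (gd n) (hd n).
- by have [_ _ _ ->] := set3E (fd n) (gd n) (hd n).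
Qed.

Lemma tv_setd W k f j : digits t f ->
  tv (fun n => setd (W n) k (f n)) j = if j == k then value t b f else tv W j.
Proof. by move=> fd; rewrite /tval track_setd //; case: eqP. Qed.

Lemma zero_lt A : 0 < nd ^ A. Proof. exact: ndigX_gt0. Qed.

Lemma set3_lt a c d : a < nd -> c < nd -> d < nd -> set3 a c d < A3.
Proof. by move=> h1 h2 h3; have [] := set3E h1 h2 h3. Qed.

(** Every real has an expansion ([val_surj]), so quantifying over auxiliary words with two tracks is
    quantifying over two reals. *)
Lemma aux_values (P : R -> R -> Prop) :
  (exists E, (forall n, E n < X) /\ P (tv E 0) (tv E 1)) <-> exists p q, P p q.
Proof.
split=> [[E [_ HP]]|[p [q HP]]]; first by exists (tv E 0), (tv E 1).
have [f [fd _ fp]] := val_surj t_gt2 b_gt1 b_sq p.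
have [g [gd _ gq]] := val_surj t_gt2 b_gt1 b_sq q.
exists (fun n => setd (setd 0 0 (f n)) 1 (g n)); split=> [n|].
  by do 2!apply: setd_lt => //; apply: zero_lt.
have tvE k := tv_setd (fun n => setd 0 0 (f n)) 1 k gd.
by rewrite !tvE /= (tv_setd (fun=> 0) 0 0 fd) /= fp gq.
Qed.

Definition dgE := (dg_lt t, set3_lt, zero_lt).

(** Every rule amounts to a definition with two existentially quantified reals p and q; the
    soundness proofs below only match tracks and then eliminate p and q. *)
Lemma combines_rule A f1 f2 f3 ng v v1 v2 v3 A1 A2 A3' L1 L2 L3
    (P : (nat -> nat) -> R -> R -> Prop) (L : (nat -> nat) -> Prop) :
  recognises A1 v1 L1 -> recognises A2 v2 L2 -> recognises A3' v3 L3 ->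
  (forall l e, l < A -> e < X -> [/\ f1 l e < A1, f2 l e < A2 & f3 l e < A3']) ->
  combines A X f1 f2 f3 ng v v1 v2 v3 ->
  (forall W E, [/\ L1 (fun n => f1 (W n) (E n)), L2 (fun n => f2 (W n) (E n))
      & L3 (fun n => f3 (W n) (E n))] <-> P W (tv E 0) (tv E 1)) ->
  (forall W, sgn ng (exists p q, P W p q) <-> L W) ->
  recognises A v L.
Proof.
move=> r1 r2 r3 lt123 cb HP HL.
apply: recognises_ext (combines_sound r1 r2 r3 _ _ _ cb); last 3 first.
- by move=> l e lA eX; have [] := lt123 l e lA eX.
- by move=> l e lA eX; have [] := lt123 l e lA eX.
- by move=> l e lA eX; have [] := lt123 l e lA eX.
move=> W WA; rewrite -HL.
rewrite (_ : (exists E, _) = exists p q, P W p q) //; apply/propext.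
by rewrite -aux_values; split=> -[E [EX /HP H]]; exists E.
Qed.

Lemma digits_dg W k : digits t (fun n => dg (W n) k).
Proof. by move=> n; apply: dg_lt. Qed.

Lemma digits0 : digits t (fun=> 0). Proof. by move=> n; apply: ndig_gt0. Qed.

Ltac rule_lt := move=> l e lA eX; split; rewrite /z /x /y ?dgE ?ndig_gt0 //;
  try (apply: setd_lt => //; exact: dg_lt).

Lemma rule_zero_sound v : rule_zero v ->
  recognises A3 v (fun W => tv W 0 = 0%:R * tv W 1)%R.
Proof.
move=> cb; apply: (combines_rule (P := fun W _ _ => (tv W 0 + tv W 0 = tv W 0)%R)
  hAdd hTrue hTrue _ cb).
- by rule_lt.
- move=> W E; have [-> -> ->] := tv_set3 (digits_dg W 0) (digits_dg W 0) (digits_dg W 0).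
  by split=> [[]|].
move=> W /=; split; last by exists 0%R, 0%R; lra.
by case=> _ [_]; lra.
Qed.

Lemma rule_succ_sound v v1 (k : R) :
  recognises A3 v1 (fun W => tv W 0 = k * tv W 1)%R -> rule_succ v v1 ->
  recognises A3 v (fun W => tv W 0 = (k + 1) * tv W 1)%R.
Proof.
move=> h1 cb; apply: (combines_rule (P := fun W p _ =>
  (p = k * tv W 1 /\ p + tv W 1 = tv W 0)%R) h1 hAdd hTrue _ cb).
- by rule_lt.
- move=> W E; have [-> -> _] := tv_set3 (digits_dg E 0) (digits_dg W 1) digits0.
  have [-> -> ->] := tv_set3 (digits_dg W 0) (digits_dg E 0) (digits_dg W 1).
  by split=> [[]|[]].
move=> W /=; split=> [[p [_ [-> <-]]]|->]; first by ring.
by exists (k * tv W 1)%R, 0%R; split=> //; ring.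
Qed.

Lemma rule_diff_sound v v1 v2 (k1 k2 : R) :
  recognises A3 v1 (fun W => tv W 0 = k1 * tv W 1)%R ->
  recognises A3 v2 (fun W => tv W 0 = k2 * tv W 1)%R -> rule_diff v v1 v2 ->
  recognises A3 v (fun W => tv W 0 = (k1 - k2) * tv W 1)%R.
Proof.
move=> h1 h2 cb; apply: (combines_rule (P := fun W p q =>
  [/\ p = k1 * tv W 1, q = k2 * tv W 1 & tv W 0 + q = p]%R) h1 h2 hAdd _ cb).
- by rule_lt.
- move=> W E; have [-> -> _] := tv_set3 (digits_dg E 0) (digits_dg W 1) digits0.
  have [-> -> _] := tv_set3 (digits_dg E 1) (digits_dg W 1) digits0.
  by have [-> -> ->] := tv_set3 (digits_dg E 0) (digits_dg W 0) (digits_dg E 1).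
move=> W /=; split=> [[p [q [-> ->]]]|->]; first by lra.
by exists (k1 * tv W 1)%R, (k2 * tv W 1)%R; split=> //; ring.
Qed.

Lemma rule_mulb_sound v v1 (k : R) :
  recognises A3 v1 (fun W => tv W 0 = k * tv W 1)%R -> rule_mulb v v1 ->
  recognises A3 v (fun W => tv W 0 = (k * b) * tv W 1)%R.
Proof.
move=> h1 cb; apply: (combines_rule (P := fun W p _ =>
  (b * tv W 1 = p /\ tv W 0 = k * p)%R) hMul h1 hTrue _ cb).
- by rule_lt.
- move=> W E; have [-> -> _] := tv_set3 (digits_dg E 0) (digits_dg W 1) digits0.
  have [-> -> _] := tv_set3 (digits_dg W 0) (digits_dg E 0) digits0.
  by split=> [[]|[]].
move=> W /=; split=> [[p [_ [<- ->]]]|->]; first by ring.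
by exists (b * tv W 1)%R, 0%R; split=> //; ring.
Qed.

Lemma rule_sum_sound v v1 v2 (k1 k2 : R) :
  recognises A3 v1 (fun W => tv W 0 = k1 * tv W 1)%R ->
  recognises A3 v2 (fun W => tv W 0 = k2 * tv W 1)%R -> rule_sum v v1 v2 ->
  recognises A3 v (fun W => tv W 0 = (k1 + k2) * tv W 1)%R.
Proof.
move=> h1 h2 cb; apply: (combines_rule (P := fun W p q =>
  [/\ p = k1 * tv W 1, q = k2 * tv W 1 & p + q = tv W 0]%R) h1 h2 hAdd _ cb).
- by rule_lt.
- move=> W E; have [-> -> _] := tv_set3 (digits_dg E 0) (digits_dg W 1) digits0.
  have [-> -> _] := tv_set3 (digits_dg E 1) (digits_dg W 1) digits0.
  by have [-> -> ->] := tv_set3 (digits_dg W 0) (digits_dg E 0) (digits_dg E 1).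
move=> W /=; split=> [[p [q [-> ->]]]|->]; first by lra.
by exists (k1 * tv W 1)%R, (k2 * tv W 1)%R; split=> //; ring.
Qed.

Lemma rule_div_sound v v1 v2 (k : R) r :
  recognises A3 v1 (fun W => tv W 0 = k * tv W 1)%R ->
  recognises A3 v2 (fun W => tv W 0 = r.+1%:R * tv W 1)%R -> rule_div v v1 v2 ->
  recognises A3 v (fun W => tv W 0 = (k / r.+1%:R) * tv W 1)%R.
Proof.
move=> h1 h2 cb; apply: (combines_rule (P := fun W p _ =>
  (p = k * tv W 1 /\ p = r.+1%:R * tv W 0)%R) h1 h2 hTrue _ cb).
- by rule_lt.
- move=> W E; have [-> -> _] := tv_set3 (digits_dg E 0) (digits_dg W 1) digits0.
  have [-> -> _] := tv_set3 (digits_dg E 0) (digits_dg W 0) digits0.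
  by split=> [[]|[]].
have r0 : (r.+1%:R != 0 :> R)%R by rewrite pnatr_eq0.
move=> W /=; split=> [[p [_ [-> kE]]]|->].
  by apply: (mulfI r0); rewrite -kE; field; rewrite ?nat1r.
by exists (k * tv W 1)%R, 0%R; split=> //; field; rewrite ?nat1r.
Qed.

Local Notation vars W := (fun i => tv W i.+1).

(** Variable i is on track i + 1, because track 0 holds the value of the term. *)
Lemma rule_Tvar_sound m v i : i.+1 < m -> rule_Tvar (nd ^ m) i v ->
  recognises (nd ^ m) v (fun W => tv W 0 = tv W i.+1).
Proof.
move=> im cb; apply: (combines_rule (P := fun W _ _ => tv W i.+1 = tv W 0)
  hEq hTrue hTrue _ cb).
- by rule_lt.
- move=> W E; have [-> -> _] := tv_set3 (digits_dg W 0) (digits_dg W i.+1) digits0.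
  by split=> [[]|].
by move=> W /=; split=> [[_ [_ ->]]|->] //; exists 0%R, 0%R.
Qed.

Section TermRules.
Variables (m v v1 v2 : nat) (F G : (nat -> R) -> R).
Hypotheses (m2 : 2 < m)
  (h1 : recognises (nd ^ m) v1 (fun W => tv W 0 = F (vars W)))
  (h2 : recognises (nd ^ m) v2 (fun W => tv W 0 = G (vars W))).

Let m0 : 0 < m. Proof. exact: leq_trans m2. Qed.

Lemma vars_setd0 W f : digits t f ->
  vars (fun n => setd (W n) 0 (f n)) = vars W.
Proof. by move=> fd; apply/funext => i; rewrite tv_setd. Qed.

Let setd_aux1 W E : vars (fun n => setd (W n) 0 (dg (E n) 0)) = vars W /\
  vars (fun n => setd (W n) 0 (dg (E n) 1)) = vars W.
Proof. by split; apply: vars_setd0; apply: digits_dg. Qed.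

Let setd_aux2 W E : tv (fun n => setd (W n) 0 (dg (E n) 0)) 0 = tv E 0 /\
  tv (fun n => setd (W n) 0 (dg (E n) 1)) 0 = tv E 1.
Proof. by split; rewrite tv_setd //; apply: digits_dg. Qed.

Lemma rule_Tadd_sound : rule_Tadd (nd ^ m) v v1 v2 ->
  recognises (nd ^ m) v (fun W => tv W 0 = F (vars W) + G (vars W))%R.
Proof.
move=> cb; apply: (combines_rule (P := fun W p q =>
  [/\ p = F (vars W), q = G (vars W) & p + q = tv W 0]%R) h1 h2 hAdd _ cb).
- by rule_lt.
- move=> W E; rewrite /x /y.
  have [e1 e2] := setd_aux1 W E; rewrite ?e1 ?e2 {e1 e2}.
  have [e1 e2] := setd_aux2 W E; rewrite ?e1 ?e2 {e1 e2}.
  by have [-> -> ->] := tv_set3 (digits_dg W 0) (digits_dg E 0) (digits_dg E 1).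
by move=> W /=; split=> [[p [q [-> -> <-]]]|->] //; eexists; eexists.
Qed.

Lemma rule_Tscale_sound k vk :
  recognises A3 vk (fun W => tv W 0 = k * tv W 1)%R ->
  rule_Tscale (nd ^ m) v v1 vk ->
  recognises (nd ^ m) v (fun W => tv W 0 = k * F (vars W))%R.
Proof.
move=> hk cb; apply: (combines_rule (P := fun W p _ =>
  (p = F (vars W) /\ tv W 0 = k * p)%R) h1 hk hTrue _ cb).
- by rule_lt.
- move=> W E; rewrite /x /y.
  have [e1 e2] := setd_aux1 W E; rewrite ?e1 ?e2 {e1 e2}.
  have [e1 e2] := setd_aux2 W E; rewrite ?e1 ?e2 {e1 e2}.
  have [-> -> _] := tv_set3 (digits_dg W 0) (digits_dg E 0) digits0.
  by split=> [[]|[]].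
move=> W /=; split=> [[p [_ [->]]]|->] //.
by exists (F (vars W)), 0%R.
Qed.

Lemma rule_Feq_sound : rule_Feq (nd ^ m) v v1 v2 ->
  recognises (nd ^ m) v (fun W => F (vars W) = G (vars W)).
Proof.
move=> cb; apply: (combines_rule (P := fun W p q =>
  [/\ p = F (vars W), q = G (vars W) & q = p]) h1 h2 hEq _ cb).
- by rule_lt.
- move=> W E; rewrite /x /y.
  have [e1 e2] := setd_aux1 W E; rewrite ?e1 ?e2 {e1 e2}.
  have [e1 e2] := setd_aux2 W E; rewrite ?e1 ?e2 {e1 e2}.
  by have [-> -> _] := tv_set3 (digits_dg E 0) (digits_dg E 1) digits0.
by move=> W /=; split=> [[p [q [-> -> ->]]]|E] //; exists (F (vars W)), (G (vars W)).
Qed.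

Lemma rule_Flt_sound : rule_Flt (nd ^ m) v v1 v2 ->
  recognises (nd ^ m) v (fun W => F (vars W) < G (vars W))%R.
Proof.
move=> cb; apply: (combines_rule (P := fun W p q =>
  [/\ p = F (vars W), q = G (vars W) & (p < q)%R]) h1 h2 hLt _ cb).
- by rule_lt.
- move=> W E; rewrite /x /y.
  have [e1 e2] := setd_aux1 W E; rewrite ?e1 ?e2 {e1 e2}.
  have [e1 e2] := setd_aux2 W E; rewrite ?e1 ?e2 {e1 e2}.
  by have [_ -> ->] := tv_set3 digits0 (digits_dg E 0) (digits_dg E 1).
by move=> W /=; split=> [[p [q [-> ->]]]|E] //; exists (F (vars W)), (G (vars W)).
Qed.

Lemma rule_Fint_sound : rule_Fint (nd ^ m) v v1 ->
  recognises (nd ^ m) v (fun W => F (vars W) \is a Num.int).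
Proof.
move=> cb; apply: (combines_rule (P := fun W p _ =>
  p = F (vars W) /\ p \is a Num.int) h1 hInt hTrue _ cb).
- by rule_lt.
- move=> W E; rewrite /x /y.
  have [e1 e2] := setd_aux1 W E; rewrite ?e1 ?e2 {e1 e2}.
  have [e1 e2] := setd_aux2 W E; rewrite ?e1 ?e2 {e1 e2}.
  have [_ -> _] := tv_set3 digits0 (digits_dg E 0) digits0.
  by split=> [[]|[]].
by move=> W /=; split=> [[p [_ [->]]]|E] //; exists (F (vars W)), 0%R.
Qed.

End TermRules.

Section FormulaRules.
Variables (m v v1 v2 : nat) (P Q : (nat -> R) -> Prop).
Hypotheses (m2 : 2 < m) (h1 : recognises (nd ^ m) v1 (fun W => P (vars W)))
  (h2 : recognises (nd ^ m) v2 (fun W => Q (vars W))).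

Lemma rule_Fnot_sound : rule_Fnot (nd ^ m) v v1 ->
  recognises (nd ^ m) v (fun W => ~ P (vars W)).
Proof.
move=> cb; apply: (combines_rule (P := fun W _ _ => P (vars W)) h1 hTrue hTrue _ cb).
- by rule_lt.
- by move=> W E; split=> [[]|].
move=> W /=; split=> nP pW; apply: nP; first by exists 0%R, 0%R.
by case: pW => _ [].
Qed.

Lemma rule_Fand_sound : rule_Fand (nd ^ m) v v1 v2 ->
  recognises (nd ^ m) v (fun W => P (vars W) /\ Q (vars W)).
Proof.
move=> cb; apply: (combines_rule (P := fun W _ _ => P (vars W) /\ Q (vars W))
  h1 h2 hTrue _ cb).
- by rule_lt.
- by move=> W E; split=> [[]|[]].
by move=> W /=; split=> [[_ [_]]|H] //; exists 0%R, 0%R.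
Qed.

Lemma rule_Fex_sound i : i.+1 < m -> rule_Fex (nd ^ m) i v v1 ->
  recognises (nd ^ m) v (fun W => exists p, P [eta vars W with i |-> p]).
Proof.
move=> im cb; apply: (combines_rule
  (P := fun W p _ => P [eta vars W with i |-> p]) h1 hTrue hTrue _ cb).
- by rule_lt.
- move=> W E.
  have -> : vars (fun n => setd (W n) i.+1 (y (E n))) =
      [eta vars W with i |-> tv E 0].
    apply/funext => j; rewrite tv_setd; last exact: digits_dg.
    by rewrite eqSS /=; case: eqP.
  by split=> [[]|].
by move=> W /=; split=> [[p [_]]|[p ?]]; exists p => //; exists 0%R.
Qed.

End FormulaRules.
End Rules.

(** * Decidability of the rules *)

Section RuleDecidable.
Variables (t vEq vAdd vMul vLt vInt vTrue : nat).

Lemma rc_dg k (l i : env k -> nat) : rc l -> rc i -> rc (fun e => dg t (l e) (i e)).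
Proof. by move=> rl ri; rewrite /dg; rc_auto. Qed.

Lemma rc_setd k (l i d : env k -> nat) : rc l -> rc i -> rc d ->
  rc (fun e => setd t (l e) (i e) (d e)).
Proof. by move=> rl ri rd; rewrite /setd; rc_auto. Qed.

Lemma rc_set3 k (l i d : env k -> nat) : rc l -> rc i -> rc d ->
  rc (fun e => set3 t (l e) (i e) (d e)).
Proof.
move=> rl ri rd; rewrite /set3; apply: rc_setd => //; last exact: rc_const.
apply: rc_setd => //; last exact: rc_const.
by apply: rc_setd => //; exact: rc_const.
Qed.

Ltac rc_rule := cbv beta zeta; first
  [ rc_leaf
  | match goal with
    | |- rc (fun e => dg _ _ _) => apply: rc_dg; rc_rule
    | |- rc (fun e => setd _ _ _ _) => apply: rc_setd; rc_rule
    | |- rc (fun e => set3 _ _ _ _) => apply: rc_set3; rc_rule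
    end
  | rc_auto ].

Ltac rp_rule := intros; cbv beta delta [rule_zero rule_succ rule_diff rule_mulb
    rule_sum rule_div rule_Tvar rule_Tadd rule_Tscale rule_Feq rule_Flt
    rule_Fint rule_Fnot rule_Fand rule_Fex] zeta;
  apply: rp_combines; rc_rule.

Variable k : nat.
Implicit Types A i v : env k -> nat.

Lemma rp_rule_zero v : rc v -> rp (fun e => rule_zero t vAdd vTrue (v e)).
Proof. rp_rule. Qed.
Lemma rp_rule_succ v v1 : rc v -> rc v1 ->
  rp (fun e => rule_succ t vAdd vTrue (v e) (v1 e)).
Proof. rp_rule. Qed.
Lemma rp_rule_diff v v1 v2 : rc v -> rc v1 -> rc v2 ->
  rp (fun e => rule_diff t vAdd (v e) (v1 e) (v2 e)).
Proof. rp_rule. Qed.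
Lemma rp_rule_mulb v v1 : rc v -> rc v1 ->
  rp (fun e => rule_mulb t vMul vTrue (v e) (v1 e)).
Proof. rp_rule. Qed.
Lemma rp_rule_sum v v1 v2 : rc v -> rc v1 -> rc v2 ->
  rp (fun e => rule_sum t vAdd (v e) (v1 e) (v2 e)).
Proof. rp_rule. Qed.
Lemma rp_rule_div v v1 v2 : rc v -> rc v1 -> rc v2 ->
  rp (fun e => rule_div t vTrue (v e) (v1 e) (v2 e)).
Proof. rp_rule. Qed.
Lemma rp_rule_Tvar A i v : rc A -> rc i -> rc v ->
  rp (fun e => rule_Tvar t vEq vTrue (A e) (i e) (v e)).
Proof. rp_rule. Qed.
Lemma rp_rule_Tadd A v v1 v2 : rc A -> rc v -> rc v1 -> rc v2 ->
  rp (fun e => rule_Tadd t vAdd (A e) (v e) (v1 e) (v2 e)).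
Proof. rp_rule. Qed.
Lemma rp_rule_Tscale A v v1 v2 : rc A -> rc v -> rc v1 -> rc v2 ->
  rp (fun e => rule_Tscale t vTrue (A e) (v e) (v1 e) (v2 e)).
Proof. rp_rule. Qed.
Lemma rp_rule_Feq A v v1 v2 : rc A -> rc v -> rc v1 -> rc v2 ->
  rp (fun e => rule_Feq t vEq (A e) (v e) (v1 e) (v2 e)).
Proof. rp_rule. Qed.
Lemma rp_rule_Flt A v v1 v2 : rc A -> rc v -> rc v1 -> rc v2 ->
  rp (fun e => rule_Flt t vLt (A e) (v e) (v1 e) (v2 e)).
Proof. rp_rule. Qed.
Lemma rp_rule_Fint A v v1 : rc A -> rc v -> rc v1 ->
  rp (fun e => rule_Fint t vInt vTrue (A e) (v e) (v1 e)).
Proof. rp_rule. Qed.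
Lemma rp_rule_Fnot A v v1 : rc A -> rc v -> rc v1 ->
  rp (fun e => rule_Fnot t vTrue (A e) (v e) (v1 e)).
Proof. rp_rule. Qed.
Lemma rp_rule_Fand A v v1 v2 : rc A -> rc v -> rc v1 -> rc v2 ->
  rp (fun e => rule_Fand t vTrue (A e) (v e) (v1 e) (v2 e)).
Proof. rp_rule. Qed.
Lemma rp_rule_Fex A i v v1 : rc A -> rc i -> rc v -> rc v1 ->
  rp (fun e => rule_Fex t vTrue (A e) (i e) (v e) (v1 e)).
Proof. rp_rule. Qed.

End RuleDecidable.

Ltac rp_rules := first
  [ apply: rp_rule_zero; rc_auto | apply: rp_rule_succ; rc_auto
  | apply: rp_rule_diff; rc_auto | apply: rp_rule_mulb; rc_auto
  | apply: rp_rule_sum; rc_auto | apply: rp_rule_div; rc_auto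
  | apply: rp_rule_Tvar; rc_auto | apply: rp_rule_Tadd; rc_auto
  | apply: rp_rule_Tscale; rc_auto | apply: rp_rule_Feq; rc_auto
  | apply: rp_rule_Flt; rc_auto | apply: rp_rule_Fint; rc_auto
  | apply: rp_rule_Fnot; rc_auto | apply: rp_rule_Fand; rc_auto
  | apply: rp_rule_Fex; rc_auto ].

Section Certificates.
Variables (t vEq vAdd vMul vLt vInt vTrue : nat) (irr : bool).

Local Notation tab w k j := (entry (entry w k) j).

(* The number [s] describes the scalar [(e0 - e1 + (e2 - e3) b) / (e4 + 1)],   *)
(* where [ei] is its [i]-th entry. If [irr] is false, only rationals are used. *)
Definition admissible s := irr \/ entry s 2 = entry s 3.

(** Equality of the coordinates as fractions, cross-multiplied and with the subtractions moved
    across, so that it is a statement about natural numbers. *)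
Definition same_scalar s u :=
  entry s 0 * (entry u 4).+1 + entry u 1 * (entry s 4).+1 =
    entry u 0 * (entry s 4).+1 + entry s 1 * (entry u 4).+1 /\
  entry s 2 * (entry u 4).+1 + entry u 3 * (entry s 4).+1 =
    entry u 2 * (entry s 4).+1 + entry s 3 * (entry u 4).+1.

(** Each scalar symbol is numbered by its least description; this makes the numbering injective and
    its range decidable. *)
Definition canonical s := admissible s /\
  forall u, u < s -> ~ (admissible u /\ same_scalar s u).

(** Rows of a certificate: 0 and 1 hold recognisers of terms and formulas; 2 those of multiplication
    by k; 3 to 7 build multiplication by the scalar described by j, namely by e0 - e1, e2 - e3, (e2
    - e3) b, the numerator and the quotient; 8 and 9 flag the codes of terms and formulas; 10 and 11
    hold their free variables; 12 is the exponent of an idempotent power. *)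
Definition scalar_cert n w :=
  rule_zero t vAdd vTrue (tab w 2 0) /\
  ((forall k, k < n.+2 -> rule_succ t vAdd vTrue (tab w 2 k.+1) (tab w 2 k)) /\
  (forall j, j < n.+1 ->
    rule_diff t vAdd (tab w 3 j) (tab w 2 (entry j 0)) (tab w 2 (entry j 1)) /\
    (rule_diff t vAdd (tab w 4 j) (tab w 2 (entry j 2)) (tab w 2 (entry j 3)) /\
    (rule_mulb t vMul vTrue (tab w 5 j) (tab w 4 j) /\
    (rule_sum t vAdd (tab w 6 j) (tab w 3 j) (tab w 5 j) /\
    rule_div t vTrue (tab w 7 j) (tab w 6 j) (tab w 2 (entry j 4).+1)))))).

Definition term_rules A j (v : nat -> nat) (g : nat -> nat) x :=
  (forall i, i < j -> j = cns 0 (cns i 0) -> rule_Tvar t vEq vTrue A i x) /\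
  ((forall a, a < j -> forall d, d < j -> j = cns 1 (cns a (cns d 0)) ->
     rule_Tadd t vAdd A x (v a) (v d)) /\
  (forall s, s < j -> forall a, a < j -> j = cns 2 (cns s (cns a 0)) ->
     rule_Tscale t vTrue A x (v a) (g s))).

Definition formula_rules A j (vT v : nat -> nat) x :=
  (forall a, a < j -> forall d, d < j -> j = cns 0 (cns a (cns d 0)) ->
     rule_Feq t vEq A x (vT a) (vT d)) /\
  ((forall a, a < j -> forall d, d < j -> j = cns 1 (cns a (cns d 0)) ->
     rule_Flt t vLt A x (vT a) (vT d)) /\
  ((forall a, a < j -> j = cns 2 (cns a 0) -> rule_Fint t vInt vTrue A x (vT a)) /\
  ((forall a, a < j -> j = cns 3 (cns a 0) -> rule_Fnot t vTrue A x (v a)) /\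
  ((forall a, a < j -> forall d, d < j -> j = cns 4 (cns a (cns d 0)) ->
     rule_Fand t vTrue A x (v a) (v d)) /\
  (forall i, i < j -> forall a, a < j -> j = cns 5 (cns i (cns a 0)) ->
     rule_Fex t vTrue A i x (v a)))))).

(** Only entries below [j] are consulted. The equivalences required by a certificate therefore
    determine its flags by recursion on codes, without any parsing function; the same holds for
    [formula_shape] and the sets of free variables. *)
Definition term_shape j (v : nat -> nat) :=
  (exists i, i < j /\ j = cns 0 (cns i 0)) \/
  ((exists a, a < j /\ exists d, d < j /\
     (j = cns 1 (cns a (cns d 0)) /\ (v a <> 0 /\ v d <> 0))) \/
  (exists s, s < j /\ exists a, a < j /\
     (j = cns 2 (cns s (cns a 0)) /\ (canonical s /\ v a <> 0)))).

Definition formula_shape j (vT v : nat -> nat) :=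
  (exists a, a < j /\ exists d, d < j /\
     (j = cns 0 (cns a (cns d 0)) /\ (vT a <> 0 /\ vT d <> 0))) \/
  ((exists a, a < j /\ exists d, d < j /\
     (j = cns 1 (cns a (cns d 0)) /\ (vT a <> 0 /\ vT d <> 0))) \/
  ((exists a, a < j /\ (j = cns 2 (cns a 0) /\ vT a <> 0)) \/
  ((exists a, a < j /\ (j = cns 3 (cns a 0) /\ v a <> 0)) \/
  ((exists a, a < j /\ exists d, d < j /\
     (j = cns 4 (cns a (cns d 0)) /\ (v a <> 0 /\ v d <> 0))) \/
  (exists i, i < j /\ exists a, a < j /\
     (j = cns 5 (cns i (cns a 0)) /\ v a <> 0)))))).

Definition term_free j i (v : nat -> nat) :=
  j = cns 0 (cns i 0) \/
  ((exists a, a < j /\ exists d, d < j /\ (j = cns 1 (cns a (cns d 0)) /\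
     (entry (v a) i <> 0 \/ entry (v d) i <> 0))) \/
  (exists s, s < j /\ exists a, a < j /\ (j = cns 2 (cns s (cns a 0)) /\
     entry (v a) i <> 0))).

Definition formula_free j i (vT v : nat -> nat) :=
  (exists a, a < j /\ exists d, d < j /\
     ((j = cns 0 (cns a (cns d 0)) \/ j = cns 1 (cns a (cns d 0))) /\
     (entry (vT a) i <> 0 \/ entry (vT d) i <> 0))) \/
  ((exists a, a < j /\ (j = cns 2 (cns a 0) /\ entry (vT a) i <> 0)) \/
  ((exists a, a < j /\ (j = cns 3 (cns a 0) /\ entry (v a) i <> 0)) \/
  ((exists a, a < j /\ exists d, d < j /\ (j = cns 4 (cns a (cns d 0)) /\
     (entry (v a) i <> 0 \/ entry (v d) i <> 0))) \/
  (exists i', i' < j /\ exists a, a < j /\ (j = cns 5 (cns i' (cns a 0)) /\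
     (i <> i' /\ entry (v a) i <> 0)))))).

(** The power of exponent k + 1 of the image of letter 0. A sentence is evaluated on the constant
    word of letter 0; if e is an idempotent power, this word factors as e, e, e, ... and (e, e) is
    linked. *)
Definition power v k := iteri k (fun _ x => amul v x (alet v 0)) (alet v 0).

Definition certificate n w :=
  scalar_cert n w /\
  ((forall j, j < n.+1 ->
     term_rules (ndig t ^ n.+3) j (fun a => tab w 0 a) (fun s => tab w 7 s) (tab w 0 j) /\
     (formula_rules (ndig t ^ n.+3) j (fun a => tab w 0 a) (fun a => tab w 1 a) (tab w 1 j) /\
     ((tab w 8 j <> 0 <-> term_shape j (fun a => tab w 8 a)) /\
     ((tab w 9 j <> 0 <-> formula_shape j (fun a => tab w 8 a) (fun a => tab w 9 a)) /\
     (forall i, i < n.+1 ->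
        (entry (tab w 10 j) i <> 0 <-> term_free j i (fun a => tab w 10 a)) /\
        (entry (tab w 11 j) i <> 0 <->
           formula_free j i (fun a => tab w 10 a) (fun a => tab w 11 a))))))) /\
  linked (amul (tab w 1 n)) (power (tab w 1 n) (entry w 12))
     (power (tab w 1 n) (entry w 12))).

(** Free variables of a formula are smaller than its code ([free_vars_lt]), so a search up to n
    finds them all. *)
Definition accepted n w :=
  tab w 9 n <> 0 /\ ((forall i, i < n.+1 -> ~ entry (tab w 11 n) i <> 0) /\
  aacc (tab w 1 n) (power (tab w 1 n) (entry w 12)) (power (tab w 1 n) (entry w 12))).

Lemma rp_canonical k (s : env k -> nat) : rc s -> rp (fun e => canonical (s e)).
Proof.
move=> rs; rewrite /canonical /admissible /same_scalar.
by rp_auto ltac:(exact: rp_true).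
Qed.

Lemma rc_power k (v d : env k -> nat) : rc v -> rc d -> rc (fun e => power (v e) (d e)).
Proof.
move=> rv rd; rewrite /power.
have rl := rc_alet rv (rc_const _ 0).
apply: (rc_iter (s := fun e => amul (v e.1.1) e.1.2 (alet (v e.1.1) 0)) rd rl).
by apply: rc_amul; rc_alg.
Qed.

Lemma rp_certificate : @rp 2 (fun e => certificate e.1.2 e.2).
Proof.
rewrite /certificate /scalar_cert /term_rules /formula_rules /term_shape
  /formula_shape /term_free /formula_free.
rp_auto ltac:(first [rp_rules | apply: rp_canonical; rc_auto
  | apply: rp_linked; first [rc_auto|apply: rc_power; rc_auto]]).
Qed.

Lemma rp_accepted : @rp 2 (fun e => accepted e.1.2 e.2).
Proof.
rewrite /accepted.
rp_auto ltac:(apply: rp_aacc; first [rc_auto|apply: rc_power; rc_auto]).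
Qed.

End Certificates.

(** Course-of-values recursion for relations: [Q j v x] sees [v] only below [j], and [good] is the
    invariant that lets the next value exist. *)
Lemma strong_choice (good : nat -> Prop) (Q : nat -> (nat -> nat) -> nat -> Prop) :
  (forall j v v' x, (forall k, k < j -> v k = v' k) -> Q j v x -> Q j v' x) ->
  (forall j v, (forall k, k < j -> good (v k)) -> exists x, good x /\ Q j v x) ->
  exists v, forall j, good (v j) /\ Q j v (v j).
Proof.
move=> loc ex.
have /choice [g Hg] (s : seq nat) : exists x, (forall k, k < size s -> good (nth 0 s k)) ->
    good x /\ Q (size s) (nth 0 s) x.
  have [H|nH] := pselect (forall k, k < size s -> good (nth 0 s k)); last by exists 0.
  by have [x Hx] := ex (size s) (nth 0 s) H; exists x.
pose h := fix h n := if n is n'.+1 then rcons (h n') (g (h n')) else [::].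
have sh n : size (h n) = n by elim: n => //= n IH; rewrite size_rcons IH.
pose v n := g (h n).
have hv n k : k < n -> nth 0 (h n) k = v k.
  elim: n => // n IH; rewrite ltnS leq_eqVlt /= nth_rcons sh => /predU1P[->|kn].
    by rewrite ltnn eqxx.
  by rewrite kn IH.
exists v; elim/ltn_ind => j IH.
have [|gj Qj] := Hg (h j).
  by rewrite sh => k kj; rewrite hv //; have [] := IH k kj.
split=> //; rewrite sh in Qj; apply: loc Qj => k kj.
exact: hv.
Qed.

Lemma hd_le w : hd w <= w.
Proof.
by have [->|[n [m ->]]] := cns_cases w; rewrite // hd_cns ltnW //; case: (cns_gt n m).
Qed.

Lemma tl_le w : tl w <= w.
Proof.
by have [->|[n [m ->]]] := cns_cases w; rewrite // tl_cns ltnW //; case: (cns_gt n m).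
Qed.

Lemma entry_le w k : entry w k <= w.
Proof.
rewrite /entry (leq_trans (hd_le _)) //; elim: k => //= k IH.
exact: leq_trans (tl_le _) IH.
Qed.

Ltac transport vv vv' H := match type of H with
  | _ \/ _ => destruct H as [H|H]; [left; transport vv vv' H | right; transport vv vv' H]
  | ex _ => let x := fresh "x" in destruct H as [x H]; exists x; transport vv vv' H
  | _ /\ _ => let H1 := fresh "H" in destruct H as [H1 H]; split;
      [transport vv vv' H1 | transport vv vv' H]
  | _ => first [exact H | rewrite -vv //; exact H | rewrite -vv' //; exact H]
  end.

(* [j] has the form recorded in [jE], which fits at most one of six rules. *)
Ltac six_cases jE rx :=
  refine (conj _ (conj _ (conj _ (conj _ (conj _ _))))); intros;
  match goal with E : _ = cns _ _ |- _ =>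
    tryif constr_eq E jE then fail else (rewrite jE in E;
      first [ by case/cns_inj: E
            | by case/cns_inj: E => _ /cns_inj [<- /cns_inj [<-]]
            | by case/cns_inj: E => _ /cns_inj [<-] ])
  end.

(** * Existence of certificates *)

Section Existence.
Variables (t vEq vAdd vMul vLt vInt vTrue n : nat) (irr : bool).
Local Notation nd := (ndig t).
Local Notation A3 := (nd ^ 3).
Local Notation A := (nd ^ n.+3).
Hypotheses (wEq : walg A3 vEq) (wAdd : walg A3 vAdd) (wMul : walg A3 vMul)
  (wLt : walg A3 vLt) (wInt : walg A3 vInt) (wTrue : walg A3 vTrue)
  (wA : exists v, walg A v).

Lemma rule_exists B f1 f2 f3 ng v1 v2 v3 A1 A2 A3' :
  walg A1 v1 -> walg A2 v2 -> walg A3' v3 ->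
  (forall l e, l < B -> e < nd ^ 2 -> [/\ f1 l e < A1, f2 l e < A2 & f3 l e < A3']) ->
  exists v, walg B v /\ combines B (nd ^ 2) f1 f2 f3 ng v v1 v2 v3.
Proof.
move=> w1 w2 w3 F.
have [||| v cb] := @combines_exists B (nd ^ 2) f1 f2 f3 ng v1 v2 v3 A1 A2 A3' w1 w2 w3.
- by move=> l e lA eX; have [] := F l e lA eX.
- by move=> l e lA eX; have [] := F l e lA eX.
- by move=> l e lA eX; have [] := F l e lA eX.
by exists v; split=> //; case: cb.
Qed.

Ltac rule_ex w1 w2 w3 := apply: (rule_exists _ w1 w2 w3); move=> l e lA eX;
  split; rewrite ?(set3_lt, dg_lt, ndigX_gt0, ndig_gt0) //;
  try (apply: setd_lt => //; exact: dg_lt).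

Lemma term_rules_local j v v' g g' x : (forall k, k < j -> v k = v' k) ->
  (forall k, k < j -> g k = g' k) ->
  term_rules t vEq vAdd vTrue A j v g x -> term_rules t vEq vAdd vTrue A j v' g' x.
Proof.
move=> vv gg [h1 [h2 h3]]; split; [exact: h1|split].
  by move=> a aj d dj E; rewrite -!vv //; apply: h2.
by move=> s sj a aj E; rewrite -vv // -gg //; apply: h3.
Qed.

Lemma formula_rules_local j vT vT' v v' x : (forall k, k < j -> v k = v' k) ->
  (forall k, k < j -> vT k = vT' k) ->
  formula_rules t vEq vLt vInt vTrue A j vT v x ->
  formula_rules t vEq vLt vInt vTrue A j vT' v' x.
Proof.
move=> vv vv' [h1 [h2 [h3 [h4 [h5 h6]]]]].
split; [|split; [|split; [|split; [|split]]]].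
- by move=> a aj d dj E; rewrite -!vv' //; apply: h1.
- by move=> a aj d dj E; rewrite -!vv' //; apply: h2.
- by move=> a aj E; rewrite -!vv' //; apply: h3.
- by move=> a aj E; rewrite -!vv //; apply: h4.
- by move=> a aj d dj E; rewrite -!vv //; apply: h5.
- by move=> s sj a aj E; rewrite -!vv //; apply: h6.
Qed.

Lemma term_shape_local j v v' : (forall k, k < j -> v k = v' k) ->
  term_shape irr j v -> term_shape irr j v'.
Proof. by move=> vv H; rewrite /term_shape in H *; transport vv vv H. Qed.

Lemma formula_shape_local j vT vT' v v' : (forall k, k < j -> v k = v' k) ->
  (forall k, k < j -> vT k = vT' k) ->
  formula_shape j vT v -> formula_shape j vT' v'.
Proof. by move=> vv vv' H; rewrite /formula_shape in H *; transport vv vv' H. Qed.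

Lemma term_free_local j i v v' : (forall k, k < j -> v k = v' k) ->
  term_free j i v -> term_free j i v'.
Proof. by move=> vv H; rewrite /term_free in H *; transport vv vv H. Qed.

Lemma formula_free_local j i vT vT' v v' : (forall k, k < j -> v k = v' k) ->
  (forall k, k < j -> vT k = vT' k) ->
  formula_free j i vT v -> formula_free j i vT' v'.
Proof. by move=> vv vv' H; rewrite /formula_free in H *; transport vv vv' H. Qed.

Lemma number_tables : exists v, forall j, walg A3 (v j) /\
  ((j = 0 -> rule_zero t vAdd vTrue (v j)) /\
   (forall k, j = k.+1 -> rule_succ t vAdd vTrue (v j) (v k))).
Proof.
apply: (@strong_choice (walg A3) (fun j v x => (j = 0 -> rule_zero t vAdd vTrue x) /\
   (forall k, j = k.+1 -> rule_succ t vAdd vTrue x (v k)))).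
  move=> j v v' x vv [h1 h2]; split=> // k jk; rewrite -vv ?jk //.
  exact: h2.
move=> [|j] v gv.
  have [x [wx rx]] : exists x, walg A3 x /\ rule_zero t vAdd vTrue x.
    by rule_ex wAdd wTrue wTrue.
  by exists x.
have [x [wx rx]] : exists x, walg A3 x /\ rule_succ t vAdd vTrue x (v j).
  by rule_ex (gv j (ltnSn j)) wAdd wTrue.
by exists x; split=> //; split=> // k [<-].
Qed.

Lemma term_tables g : (forall s, walg A3 (g s)) -> exists v, forall j,
  walg A (v j) /\ (j < n.+1 -> term_rules t vEq vAdd vTrue A j v g (v j)).
Proof.
move=> wg.
apply: (@strong_choice (walg A) (fun j v x => j < n.+1 ->
  term_rules t vEq vAdd vTrue A j v g x)).
  by move=> j v v' x vv H jn; apply: term_rules_local vv _ (H jn).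
move=> j v gv.
have [[i [ij jE]]|n1] := pselect (exists i, i < j /\ j = cns 0 (cns i 0)).
  have [x [wx rx]] : exists x, walg A x /\ rule_Tvar t vEq vTrue A i x.
    by rule_ex wEq wTrue wTrue.
  exists x; split=> // jn; split=> [i' _|]; rewrite jE.
    by case/cns_inj => _ /cns_inj [<-].
  by split=> [a _ d _ /cns_inj []|s _ a _ /cns_inj []].
have [[a [aj [d [dj jE]]]]|n2] := pselect (exists a, a < j /\ exists d, d < j /\
    j = cns 1 (cns a (cns d 0))).
  have [x [wx rx]] : exists x, walg A x /\ rule_Tadd t vAdd A x (v a) (v d).
    by rule_ex (gv _ aj) (gv _ dj) wAdd.
  exists x; split=> // jn; split=> [i _|]; rewrite jE; first by case/cns_inj.
  split=> [a' _ d' _ /cns_inj [_ /cns_inj [<- /cns_inj [<-]]]|s _ a' _ /cns_inj []] //.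
have [[s [sj [a [aj jE]]]]|n3] := pselect (exists s, s < j /\ exists a, a < j /\
    j = cns 2 (cns s (cns a 0))).
  have [x [wx rx]] : exists x, walg A x /\ rule_Tscale t vTrue A x (v a) (g s).
    by rule_ex (gv _ aj) (wg s) wTrue.
  exists x; split=> // jn; split=> [i _|]; rewrite jE; first by case/cns_inj.
  split=> [a' _ d' _ /cns_inj []|s' _ a' _ /cns_inj [_ /cns_inj [<- /cns_inj [<-]]]] //.
have [x wx] := wA; exists x; split=> // jn; split=> [i ij jE|].
  by case: n1; exists i.
split=> [a aj d dj jE|s sj a aj jE]; first by case: n2; exists a; split=> //; exists d.
by case: n3; exists s; split=> //; exists a.
Qed.

Lemma formula_tables vT : (forall j, walg A (vT j)) -> exists v, forall j,
  walg A (v j) /\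
  (j < n.+1 -> formula_rules t vEq vLt vInt vTrue A j vT v (v j)).
Proof.
move=> wT.
apply: (@strong_choice (walg A) (fun j v x => j < n.+1 ->
  formula_rules t vEq vLt vInt vTrue A j vT v x)).
  by move=> j v v' x vv H jn; apply: formula_rules_local vv _ (H jn).
move=> j v gv; rewrite /formula_rules.
have [[a [aj [d [dj jE]]]]|n1] := pselect (exists a, a < j /\ exists d, d < j /\
    j = cns 0 (cns a (cns d 0))).
  have [x [wx rx]] : exists x, walg A x /\ rule_Feq t vEq A x (vT a) (vT d).
    by rule_ex (wT a) (wT d) wEq.
  exists x; split=> // jn; six_cases jE rx.
have [[a [aj [d [dj jE]]]]|n2] := pselect (exists a, a < j /\ exists d, d < j /\
    j = cns 1 (cns a (cns d 0))).
  have [x [wx rx]] : exists x, walg A x /\ rule_Flt t vLt A x (vT a) (vT d).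
    by rule_ex (wT a) (wT d) wLt.
  exists x; split=> // jn; six_cases jE rx.
have [[a [aj jE]]|n3] := pselect (exists a, a < j /\ j = cns 2 (cns a 0)).
  have [x [wx rx]] : exists x, walg A x /\ rule_Fint t vInt vTrue A x (vT a).
    by rule_ex (wT a) wInt wTrue.
  exists x; split=> // jn; six_cases jE rx.
have [[a [aj jE]]|n4] := pselect (exists a, a < j /\ j = cns 3 (cns a 0)).
  have [x [wx rx]] : exists x, walg A x /\ rule_Fnot t vTrue A x (v a).
    by rule_ex (gv _ aj) wTrue wTrue.
  exists x; split=> // jn; six_cases jE rx.
have [[a [aj [d [dj jE]]]]|n5] := pselect (exists a, a < j /\ exists d, d < j /\
    j = cns 4 (cns a (cns d 0))).
  have [x [wx rx]] : exists x, walg A x /\ rule_Fand t vTrue A x (v a) (v d).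
    by rule_ex (gv _ aj) (gv _ dj) wTrue.
  exists x; split=> // jn; six_cases jE rx.
(* The bound on [j] guarantees that track i + 1 is one of the n + 3 tracks. *)
have [[i [ij [a [aj [jE jn]]]]]|n6] := pselect (exists i, i < j /\ exists a, a < j /\
    (j = cns 5 (cns i (cns a 0)) /\ j < n.+1)).
  have [x [wx rx]] : exists x, walg A x /\ rule_Fex t vTrue A i x (v a).
    have im : i.+1 < n.+3 by rewrite !ltnS (leq_trans (ltnW ij)) // ltnW.
    by rule_ex (gv _ aj) wTrue wTrue.
  exists x; split=> // _; six_cases jE rx.
have [x wx] := wA; exists x; split=> // jn.
refine (conj _ (conj _ (conj _ (conj _ (conj _ _))))); intros; exfalso.
- by apply: n1; exists a; split=> //; exists d.
- by apply: n2; exists a; split=> //; exists d.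
- by apply: n3; exists a.
- by apply: n4; exists a.
- by apply: n5; exists a; split=> //; exists d.
- by apply: n6; exists i; split=> //; exists a.
Qed.

Lemma flag_tables (Sh : nat -> (nat -> nat) -> Prop) :
  (forall j v v', (forall k, k < j -> v k = v' k) -> Sh j v -> Sh j v') ->
  exists v, forall j, v j <> 0 <-> Sh j v.
Proof.
move=> loc.
have [|j v _|v Hv] := @strong_choice (fun=> True) (fun j v x => x <> 0 <-> Sh j v).
- move=> j v v' x vv H; rewrite H; split; apply: loc => // k kj.
  by rewrite vv.
- by exists (nat_of_bool `[< Sh j v >]); split=> //; case: asboolP.
by exists v => j; have [] := Hv j.
Qed.

Lemma set_tables (Sh : nat -> nat -> (nat -> nat) -> Prop) :
  (forall j i v v', (forall k, k < j -> v k = v' k) -> Sh j i v -> Sh j i v') ->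
  exists v, forall j i, i < n.+1 -> entry (v j) i <> 0 <-> Sh j i v.
Proof.
move=> loc.
have [|j v _|v Hv] := @strong_choice (fun=> True)
  (fun j v x => forall i, i < n.+1 -> entry x i <> 0 <-> Sh j i v).
- move=> j v v' x vv H i ni; rewrite (H i ni); split; apply: loc => // k kj.
  by rewrite vv.
- have [w Hw] := entry_mkseq (fun i => nat_of_bool `[< Sh j i v >]) n.+1.
  by exists w; split=> // i ni; rewrite Hw //; case: asboolP.
by exists v => j i ni; have [_] := Hv j; apply.
Qed.

(** Ramsey's theorem for the constant word gives an idempotent block, which is a power of the
    letter. *)
Lemma power_linked v : walg A v -> exists k, linked (amul v) (power v k) (power v k).
Proof.
move=> wv; have Dv (i : nat) : alet v 0 < asz v.
  by case: wv => _ _; apply; apply: ndigX_gt0.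
have [s [e [_ _ [_ ee] [c [_ cS _ Ee]]]]] := additive_ramsey (walg_wf wv) Dv.
by exists (c 2 - c 1).-1; move: (Ee 0); rewrite /seg -/(power v _) => ->.
Qed.

(** Every row exists as a function, filled by strong recursion from [rule_exists]; codes of no term
    or formula get an arbitrary semigroup. Since the conditions are local, tabulating the rows up to
    n + 2 preserves them. *)
Lemma certificate_exists : exists w, certificate t vEq vAdd vMul vLt vInt vTrue irr n w.
Proof.
have [vN HN] := number_tables.
have wN k : walg A3 (vN k) by have [] := HN k.
have /choice [vA HA] j : exists x, walg A3 x /\
    rule_diff t vAdd x (vN (entry j 0)) (vN (entry j 1)).
  by rule_ex (wN (entry j 0)) (wN (entry j 1)) wAdd.
have /choice [vB HB] j : exists x, walg A3 x /\
    rule_diff t vAdd x (vN (entry j 2)) (vN (entry j 3)).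
  by rule_ex (wN (entry j 2)) (wN (entry j 3)) wAdd.
have wA' j : walg A3 (vA j) by have [] := HA j.
have wB j : walg A3 (vB j) by have [] := HB j.
have /choice [vC HC] j : exists x, walg A3 x /\ rule_mulb t vMul vTrue x (vB j).
  by rule_ex wMul (wB j) wTrue.
have wC j : walg A3 (vC j) by have [] := HC j.
have /choice [vE HE] j : exists x, walg A3 x /\ rule_sum t vAdd x (vA j) (vC j).
  by rule_ex (wA' j) (wC j) wAdd.
have wE j : walg A3 (vE j) by have [] := HE j.
have /choice [vG HG] j : exists x, walg A3 x /\
    rule_div t vTrue x (vE j) (vN (entry j 4).+1).
  by rule_ex (wE j) (wN (entry j 4).+1) wTrue.
have wG j : walg A3 (vG j) by have [] := HG j.
have [vT HT] := term_tables wG.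
have wT j : walg A (vT j) by have [] := HT j.
have [vF HF] := formula_tables wT.
have wF j : walg A (vF j) by have [] := HF j.
have [vP HP] := flag_tables term_shape_local.
have [vQ HQ] := flag_tables (fun j v v' vv => @formula_shape_local j vP vP v v' vv (fun _ _ => erefl)).
have [vU HU] := set_tables term_free_local.
have [vV HV] := set_tables
  (fun j i v v' vv => @formula_free_local j i vU vU v v' vv (fun _ _ => erefl)).
have [k Hk] := power_linked (wF n).
have tb v := entry_mkseq v n.+3.
have [w0 H0] := tb vT; have [w1 H1] := tb vF; have [w2 H2] := tb vN.
have [w3 H3] := tb vA; have [w4 H4] := tb vB; have [w5 H5] := tb vC.
have [w6 H6] := tb vE; have [w7 H7] := tb vG; have [w8 H8] := tb vP.
have [w9 H9] := tb vQ; have [w10 H10] := tb vU; have [w11 H11] := tb vV.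
exists (CodeSeq.code [:: w0; w1; w2; w3; w4; w5; w6; w7; w8; w9; w10; w11; k]).
have le2 j : j < n.+1 -> j < n.+3 by move=> jn; rewrite ltnS leqW // ltnW.
have le3 j i : j < n.+1 -> (entry j i).+1 < n.+3.
  by move=> jn; rewrite !ltnS (leq_trans (entry_le _ _)) // ltnW.
rewrite /certificate /scalar_cert !entry_code /=; split.
  split; first by rewrite H2 //; have [_ [h _]] := HN 0; apply: h.
  split.
    move=> j jn; rewrite !H2 //; last by rewrite ltnW.
    by have [_ [_ h]] := HN j.+1; apply: h.
  move=> j jn; have e2 i := ltnW (le3 j i jn).
  rewrite (H2 _ (e2 0)) (H2 _ (e2 1)) (H2 _ (e2 2)) (H2 _ (e2 3)) (H2 _ (le3 j 4 jn)).
  rewrite H3 ?H4 ?H5 ?H6 ?H7 ?le2 //.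
  have [_ ?] := HA j; have [_ ?] := HB j; have [_ ?] := HC j.
  have [_ ?] := HE j; have [_ ?] := HG j.
  by split; [|split; [|split; [|split]]].
split; last by rewrite H1 ?le2.
move=> j jn.
have sub (f : nat -> nat) w : (forall k, k < n.+3 -> entry w k = f k) ->
    forall k, k < j -> f k = entry w k.
  by move=> Hw i ij; rewrite Hw // (ltn_trans ij) // le2.
have sub' (f : nat -> nat) w : (forall k, k < n.+3 -> entry w k = f k) ->
    forall k, k < j -> entry w k = f k.
  by move=> Hw i ij; rewrite Hw // (ltn_trans ij) // le2.
rewrite H0 ?H1 ?H8 ?H9 ?H10 ?H11 ?le2 //; split; [|split; [|split; [|split]]].
- have [_ h] := HT j; apply: term_rules_local (h jn); exact: sub.
- have [_ h] := HF j; apply: formula_rules_local (h jn); exact: sub.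
- rewrite HP; split; apply: term_shape_local; [exact: sub|exact: sub'].
- rewrite HQ; split; apply: formula_shape_local; first [exact: sub|exact: sub'].
- move=> i ni; rewrite HU // HV //; split; split.
  + by apply: term_free_local; apply: sub.
  + by apply: term_free_local; apply: sub'.
  + by apply: formula_free_local; apply: sub.
  + by apply: formula_free_local; apply: sub'.
Qed.
End Existence.

(** * Soundness of certificates *)

Section Satisfaction.
Variables (R : realType) (S : Type) (i : S -> R).

Lemma term_val_ext (e e' : nat -> R) u : (forall k, k \in term_vars u -> e k = e' k) ->
  term_val i e u = term_val i e' u.
Proof.
elim: u => [k|u IHu v IHv|s u IHu] /= H; first by rewrite H // mem_head.
  by rewrite IHu ?IHv // => k ku; apply: H; rewrite mem_cat ku ?orbT.
by rewrite IHu.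
Qed.

Lemma sat_ext p (e e' : nat -> R) : (forall k, k \in free_vars p -> e k = e' k) ->
  sat i e p <-> sat i e' p.
Proof.
elim: p e e' => [u v|u v|u|p IH|p IHp q IHq|k p IH] e e' /= H.
- rewrite (@term_val_ext e e' u) ?(@term_val_ext e e' v) // => k ku;
    by apply: H; rewrite mem_cat ku ?orbT.
- rewrite (@term_val_ext e e' u) ?(@term_val_ext e e' v) // => k ku;
    by apply: H; rewrite mem_cat ku ?orbT.
- by rewrite (@term_val_ext e e' u).
- by rewrite (IH e e').
- rewrite (IHp e e') ?(IHq e e') // => k kp; apply: H; by rewrite mem_cat kp ?orbT.
- have E x : sat i [eta e with k |-> x] p <-> sat i [eta e' with k |-> x] p.
    apply: IH => j jp /=; case: (eqVneq j k) => // jk.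
    by apply: H; rewrite mem_filter jk.
  by split=> -[x /E]; exists x.
Qed.

End Satisfaction.

Lemma power_seg v i k : seg (amul v) (fun=> alet v 0) i (i + k.+1) = power v k.
Proof. by rewrite /seg addKn. Qed.

Lemma cns2_gt h x : x < cns h (cns x 0).
Proof. by apply: (ltn_trans (cns_gt x 0).1); case: (cns_gt h (cns x 0)). Qed.
Lemma cns3_gt h x y : x < cns h (cns x (cns y 0)) /\ y < cns h (cns x (cns y 0)).
Proof.
have H := (cns_gt h (cns x (cns y 0))).2; split; apply: (ltn_trans _ H).
  by case: (cns_gt x (cns y 0)).
exact: cns2_gt.
Qed.

Section Codes.
Variables (S : Type) (c : S -> nat).

Lemma term_codeE :
  [/\ forall k, term_code c (Tvar S k) = cns 0 (cns k 0),
     forall u v, term_code c (Tadd u v) = cns 1 (cns (term_code c u) (cns (term_code c v) 0))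
   & forall s u, term_code c (Tscale s u) = cns 2 (cns (c s) (cns (term_code c u) 0))].
Proof. by []. Qed.

Lemma formula_codeE :
  [/\ forall u v, formula_code c (Feq u v) =
       cns 0 (cns (term_code c u) (cns (term_code c v) 0)),
     forall u v, formula_code c (Flt u v) =
       cns 1 (cns (term_code c u) (cns (term_code c v) 0)),
     forall u, formula_code c (Fint u) = cns 2 (cns (term_code c u) 0)
   & [/\ forall p, formula_code c (Fnot p) = cns 3 (cns (formula_code c p) 0),
     forall p q, formula_code c (Fand p q) =
       cns 4 (cns (formula_code c p) (cns (formula_code c q) 0))
   & forall k p, formula_code c (Fex k p) = cns 5 (cns k (cns (formula_code c p) 0))]].
Proof. by []. Qed.

Lemma term_vars_lt u k : k \in term_vars u -> k < term_code c u.
Proof.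
have [e1 e2 e3] := term_codeE.
elim: u => [n|u IHu v IHv|s u IHu] ; rewrite ?e1 ?e2 ?e3 [term_vars _]/=.
- by rewrite inE => /eqP ->; exact: cns2_gt.
- rewrite mem_cat; have [h1 h2] := cns3_gt 1 (term_code c u) (term_code c v).
  by case/orP => [/IHu|/IHv] /ltn_trans; apply.
- by have [h1 h2] := cns3_gt 2 (c s) (term_code c u); move/IHu/ltn_trans; apply.
Qed.

Lemma free_vars_lt p k : k \in free_vars p -> k < formula_code c p.
Proof.
have [e1 e2 e3 [e4 e5 e6]] := formula_codeE.
elim: p => [u v|u v|u|p IHp|p IHp q IHq|n p IHp];
  rewrite ?e1 ?e2 ?e3 ?e4 ?e5 ?e6 [free_vars _]/=.
- rewrite mem_cat; have [h1 h2] := cns3_gt 0 (term_code c u) (term_code c v).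
  by case/orP => /term_vars_lt /ltn_trans; apply.
- rewrite mem_cat; have [h1 h2] := cns3_gt 1 (term_code c u) (term_code c v).
  by case/orP => /term_vars_lt /ltn_trans; apply.
- by move/term_vars_lt/ltn_trans; apply; apply: cns2_gt.
- by move/IHp/ltn_trans; apply; apply: cns2_gt.
- rewrite mem_cat; have [h1 h2] := cns3_gt 4 (formula_code c p) (formula_code c q).
  by case/orP => [/IHp|/IHq] /ltn_trans; apply.
- rewrite mem_filter => /andP[_ /IHp /ltn_trans]; apply.
  by have [] := cns3_gt 5 n (formula_code c p).
Qed.

Hypothesis c_inj : injective c.

Lemma term_code_inj : injective (term_code c).
Proof.
have [e1 e2 e3] := term_codeE.
elim=> [n|u IHu v IHv|s u IHu] [n'|u' v'|s' u'];
  rewrite ?e1 ?e2 ?e3; try by case/cns_inj.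
- by case/cns_inj => _ /cns_inj [->].
- by case/cns_inj => _ /cns_inj [/IHu -> /cns_inj [/IHv ->]].
- by case/cns_inj => _ /cns_inj [/c_inj -> /cns_inj [/IHu ->]].
Qed.

Lemma formula_code_inj : injective (formula_code c).
Proof.
have [e1 e2 e3 [e4 e5 e6]] := formula_codeE.
elim=> [u v|u v|u|p IHp|p IHp q IHq|n p IHp] [u' v'|u' v'|u'|p'|p' q'|n' p'];
  rewrite ?e1 ?e2 ?e3 ?e4 ?e5 ?e6; try by case/cns_inj.
- by case/cns_inj => _ /cns_inj [/term_code_inj -> /cns_inj [/term_code_inj ->]].
- by case/cns_inj => _ /cns_inj [/term_code_inj -> /cns_inj [/term_code_inj ->]].
- by case/cns_inj => _ /cns_inj [/term_code_inj ->].
- by case/cns_inj => _ /cns_inj [/IHp ->].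
- by case/cns_inj => _ /cns_inj [/IHp -> /cns_inj [/IHq ->]].
- by case/cns_inj => _ /cns_inj [-> /cns_inj [/IHp ->]].
Qed.

End Codes.

Section Soundness.
Variables (R : realType) (t : nat) (b : R).
Hypotheses (t_gt2 : 2 < t) (b_gt1 : (1 < b)%R)
  (b_sq : (b ^+ 2 = t%:R * b - 1)%R).

Local Notation nd := (ndig t).
Local Notation tv := (tval t b).
Local Notation A3 := (nd ^ 3).
Local Notation tab w k j := (entry (entry w k) j).

Definition scalar s : R := (((entry s 0)%:R - (entry s 1)%:R +
  ((entry s 2)%:R - (entry s 3)%:R) * b) / (entry s 4).+1%:R)%R.

Variables (K : {pred R}) (irr : bool).
Hypotheses (HK : forall x, x \in K <-> exists s, admissible irr s /\ scalar s = x)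
  (Hsame : forall s u, admissible irr s -> admissible irr u ->
     scalar s = scalar u <-> same_scalar s u).

Local Notation S := {x : R | x \in K}.

Lemma canonical_exists (x : S) : exists s, canonical irr s /\ scalar s = sval x.
Proof.
case: x => x xK /=; have [s0 Hs0] := (HK x).1 xK.
have ex : exists s, `[< admissible irr s /\ scalar s = x >].
  by exists s0; apply/asboolP.
case: (ex_minnP ex) => s /asboolP [as_ sx] smin; exists s; split=> //; split=> // u us.
case=> au /(Hsame as_ au) su.
have /smin : `[< admissible irr u /\ scalar u = x >] by apply/asboolP; rewrite -su.
by rewrite leqNgt us.
Qed.

Lemma canonical_inj s u : canonical irr s -> canonical irr u ->
  scalar s = scalar u -> s = u.
Proof.
move=> [as_ cs] [au cu] su; have [us|su'|//] := ltngtP u s.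
  by case: (cs u us); split=> //; apply/Hsame.
by case: (cu s su'); split=> //; apply/Hsame.
Qed.

Variable c : S -> nat.
Hypothesis Hc : forall x, canonical irr (c x) /\ scalar (c x) = sval x.

Lemma c_inj : injective c.
Proof.
move=> x y xy; have [_ ex] := Hc x; have [_ ey] := Hc y.
have : sval x = sval y by rewrite -ex -ey xy.
case: x y {xy ex ey} => x xK [y yK] /= xy; rewrite -xy in yK *.
by congr exist; apply: bool_irrelevance.
Qed.

Lemma canonicalP s : canonical irr s <-> exists x, c x = s.
Proof.
split=> [cs|[x <-]]; last by have [] := Hc x.
have sK : scalar s \in K by apply/HK; exists s; split=> //; case: cs.
pose x : S := exist (fun x => x \in K) _ sK.
by exists x; have [cx ex] := Hc x; apply: canonical_inj.
Qed.

Variables (vEq vAdd vMul vLt vInt vTrue : nat).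
Hypotheses (hEq : recognises A3 vEq (fun W => tv W 1 = tv W 0))
  (hAdd : recognises A3 vAdd (fun W => tv W 1 + tv W 2 = tv W 0)%R)
  (hMul : recognises A3 vMul (fun W => b * tv W 1 = tv W 0)%R)
  (hLt : recognises A3 vLt (fun W => tv W 1 < tv W 2)%R)
  (hInt : recognises A3 vInt (fun W => tv W 1 \is a Num.int))
  (hTrue : recognises A3 vTrue (fun=> True)).

Variables (n w : nat).
Hypothesis cert : certificate t vEq vAdd vMul vLt vInt vTrue irr n w.

Lemma scalar_sound j : j < n.+1 ->
  recognises A3 (tab w 7 j) (fun W => tv W 0 = scalar j * tv W 1)%R.
Proof.
move=> jn; have [[c0 [cS cj]] _] := cert.
have N k : k < n.+3 -> recognises A3 (tab w 2 k) (fun W => tv W 0 = k%:R * tv W 1)%R.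
  elim: k => [_|k IH kn]; first exact: (rule_zero_sound t_gt2 b_gt1 b_sq hAdd hTrue c0).
  have := rule_succ_sound t_gt2 b_gt1 b_sq hAdd hTrue (IH (ltnW kn)) (cS k kn).
  by rewrite natr1.
have le3 i : (entry j i).+1 < n.+3.
  by rewrite !ltnS (leq_trans (entry_le _ _)) // ltnW.
have N' i := N _ (ltnW (le3 i)).
have [cA [cB [cC [cE cG]]]] := cj j jn.
have hA := rule_diff_sound t_gt2 b_gt1 b_sq hAdd (N' 0) (N' 1) cA.
have hB := rule_diff_sound t_gt2 b_gt1 b_sq hAdd (N' 2) (N' 3) cB.
have hC := rule_mulb_sound t_gt2 b_gt1 b_sq hMul hTrue hB cC.
have hE := rule_sum_sound t_gt2 b_gt1 b_sq hAdd hA hC cE.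
exact: (rule_div_sound t_gt2 b_gt1 b_sq hTrue hE (N _ (le3 4)) cG).
Qed.

Local Notation A := (nd ^ n.+3).
Local Notation vars W := (fun i => tv W i.+1).

Lemma term_sound u : term_code c u < n.+1 ->
  recognises A (tab w 0 (term_code c u)) (fun W => tv W 0 = term_val sval (vars W) u).
Proof.
have [_ [cj _]] := cert.
elim: u => [k|u IHu v IHv|s u IHu] jn; have [[r1 [r2 r3]] _] := cj _ jn.
- have kj : k < term_code c (Tvar S k) by exact: (cns2_gt 0 k).
  apply: (rule_Tvar_sound t_gt2 b_gt1 b_sq hEq hTrue) (r1 k kj erefl).
  by rewrite !ltnS (leq_trans (ltnW kj)) // ltnW.
- have [h1 h2] := cns3_gt 1 (term_code c u) (term_code c v).
  have h1' := IHu (ltn_trans h1 jn); have h2' := IHv (ltn_trans h2 jn).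
  exact: (rule_Tadd_sound (F := fun e => term_val sval e u) (G := fun e => term_val sval e v) t_gt2 b_gt1 b_sq hAdd _ h1' h2' (r2 _ h1 _ h2 erefl)).
- have [h1 h2] := cns3_gt 2 (c s) (term_code c u).
  have h2' := IHu (ltn_trans h2 jn).
  have hs := scalar_sound (ltn_trans h1 jn); have [_ sE] := Hc s; rewrite sE in hs.
  exact: (rule_Tscale_sound (F := fun e => term_val sval e u) t_gt2 b_gt1 b_sq hTrue _ h2' hs (r3 _ h1 _ h2 erefl)).
Qed.

Lemma formula_sound p : formula_code c p < n.+1 ->
  recognises A (tab w 1 (formula_code c p)) (fun W => sat sval (vars W) p).
Proof.
have [_ [cj _]] := cert.
elim: p => [u v|u v|u|p IHp|p IHp q IHq|k p IHp] jn;
  have [_ [[r1 [r2 [r3 [r4 [r5 r6]]]]] _]] := cj _ jn.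
- have [h1 h2] := cns3_gt 0 (term_code c u) (term_code c v).
  have h1' := term_sound (ltn_trans h1 jn); have h2' := term_sound (ltn_trans h2 jn).
  exact: (rule_Feq_sound (F := fun e => term_val sval e u) (G := fun e => term_val sval e v) t_gt2 b_gt1 b_sq hEq _ h1' h2' (r1 _ h1 _ h2 erefl)).
- have [h1 h2] := cns3_gt 1 (term_code c u) (term_code c v).
  have h1' := term_sound (ltn_trans h1 jn); have h2' := term_sound (ltn_trans h2 jn).
  exact: (rule_Flt_sound (F := fun e => term_val sval e u) (G := fun e => term_val sval e v) t_gt2 b_gt1 b_sq hLt _ h1' h2' (r2 _ h1 _ h2 erefl)).
- have h1 := cns2_gt 2 (term_code c u).
  have h1' := term_sound (ltn_trans h1 jn).
  exact: (rule_Fint_sound (F := fun e => term_val sval e u) t_gt2 b_gt1 b_sq hInt hTrue _ h1' (r3 _ h1 erefl)).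
- have h1 := cns2_gt 3 (formula_code c p).
  have h1' := IHp (ltn_trans h1 jn).
  exact: (rule_Fnot_sound (P := fun e => sat sval e p) t_gt2 b_gt1 b_sq hTrue h1' (r4 _ h1 erefl)).
- have [h1 h2] := cns3_gt 4 (formula_code c p) (formula_code c q).
  have h1' := IHp (ltn_trans h1 jn); have h2' := IHq (ltn_trans h2 jn).
  exact: (rule_Fand_sound (P := fun e => sat sval e p)
    (Q := fun e => sat sval e q) t_gt2 b_gt1 b_sq hTrue h1' h2' (r5 _ h1 _ h2 erefl)).
- have [h1 h2] := cns3_gt 5 k (formula_code c p).
  have h2' := IHp (ltn_trans h2 jn).
  apply: (rule_Fex_sound (P := fun e => sat sval e p) t_gt2 b_gt1 b_sq hTrue h2' _ (r6 _ h1 _ h2 erefl)).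
  by rewrite !ltnS (leq_trans (ltnW h1)) // ltnW.
Qed.

Lemma term_shape_sound j : j < n.+1 ->
  tab w 8 j <> 0 <-> exists u, term_code c u = j.
Proof.
have [_ [cj _]] := cert.
elim/ltn_ind: j => j IH jn; have [_ [_ [-> _]]] := cj _ jn; split.
  case=> [[i [_ ->]]|[[a [aj [d [dj [-> [ha hd']]]]]]|[s [sj [a [aj [-> [cs ha]]]]]]]].
  - by exists (Tvar S i).
  - have [u <-] := (IH a aj (ltn_trans aj jn)).1 ha.
    have [v <-] := (IH d dj (ltn_trans dj jn)).1 hd'.
    by exists (Tadd u v).
  - have [u <-] := (IH a aj (ltn_trans aj jn)).1 ha.
    by have [x <-] := (canonicalP s).1 cs; exists (Tscale x u).
case=> -[k|u v|s u] jE; subst j.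
- by left; exists k; split=> //; exact: (cns2_gt 0 k).
- have [h1 h2] := cns3_gt 1 (term_code c u) (term_code c v).
  right; left; exists (term_code c u); split=> //; exists (term_code c v); split=> //.
  split=> //; split; apply/IH => //; rewrite ?(ltn_trans _ jn) //;
    by [exists u|exists v].
- have [h1 h2] := cns3_gt 2 (c s) (term_code c u).
  right; right; exists (c s); split=> //; exists (term_code c u); split=> //.
  split=> //; split; first by apply/canonicalP; exists s.
  by apply/IH; rewrite ?(ltn_trans _ jn) //; exists u.
Qed.

Lemma formula_shape_sound j : j < n.+1 ->
  tab w 9 j <> 0 <-> exists p, formula_code c p = j.
Proof.
have [_ [cj _]] := cert.
have T a j' : a < j' -> j' < n.+1 -> tab w 8 a <> 0 <-> exists u, term_code c u = a.
  by move=> aj j'n; apply/term_shape_sound/(ltn_trans aj).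
elim/ltn_ind: j => j IH jn; have [_ [_ [_ [-> _]]]] := cj _ jn.
have {}IH a : a < j -> tab w 9 a <> 0 <-> exists p, formula_code c p = a.
  by move=> aj; apply: IH => //; apply: ltn_trans jn.
have {}T a : a < j -> tab w 8 a <> 0 <-> exists u, term_code c u = a.
  by move=> aj; apply: (T a j).
split.
  case=> [[a [aj [d [dj [-> [/T [//|u <-] /T [//|v <-]]]]]]]|].
    by exists (Feq u v).
  case=> [[a [aj [d [dj [-> [/T [//|u <-] /T [//|v <-]]]]]]]|].
    by exists (Flt u v).
  case=> [[a [aj [-> /T [//|u <-]]]]|]; first by exists (Fint u).
  case=> [[a [aj [-> /IH [//|p <-]]]]|]; first by exists (Fnot p).
  case=> [[a [aj [d [dj [-> [/IH [//|p <-] /IH [//|q <-]]]]]]]|].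
    by exists (Fand p q).
  by case=> [i [ij [a [aj [-> /IH [//|p <-]]]]]]; exists (Fex i p).
case=> -[u v|u v|u|p|p q|i p] jE; subst j; rewrite /= in T IH *.
- have [h1 h2] := cns3_gt 0 (term_code c u) (term_code c v).
  left; exists (term_code c u); split=> //; exists (term_code c v); split=> //.
  by split=> //; split; apply/T => //; [exists u|exists v].
- have [h1 h2] := cns3_gt 1 (term_code c u) (term_code c v).
  right; left; exists (term_code c u); split=> //; exists (term_code c v); split=> //.
  by split=> //; split; apply/T => //; [exists u|exists v].
- have h1 := cns2_gt 2 (term_code c u).
  do 2!right; left; exists (term_code c u); split=> //; split=> //.
  by apply/T => //; exists u.
- have h1 := cns2_gt 3 (formula_code c p).
  do 3!right; left; exists (formula_code c p); split=> //; split=> //.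
  by apply/IH => //; exists p.
- have [h1 h2] := cns3_gt 4 (formula_code c p) (formula_code c q).
  do 4!right; left; exists (formula_code c p); split=> //.
  exists (formula_code c q); split=> //.
  by split=> //; split; apply/IH => //; [exists p|exists q].
- have [h1 h2] := cns3_gt 5 i (formula_code c p).
  do 5!right; exists i; split=> //; exists (formula_code c p); split=> //.
  by split=> //; apply/IH => //; exists p.
Qed.

Lemma term_free_sound u k : term_code c u < n.+1 -> k < n.+1 ->
  entry (tab w 10 (term_code c u)) k <> 0 <-> k \in term_vars u.
Proof.
have [_ [cj _]] := cert; move=> + kn.
elim: u => [i|u IHu v IHv|s u IHu] jn;
  have [_ [_ [_ [_ f]]]] := cj _ jn; have [-> _] := f k kn; rewrite [term_vars _]/=.
- rewrite mem_seq1; split=> [|/eqP ->]; last by left.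
  case=> [/cns_inj [_ /cns_inj [->]] //|].
  by case=> [[a [_ [d [_ [/cns_inj []]]]]]|[a [_ [d [_ [/cns_inj []]]]]]].
- have [h1 h2] := cns3_gt 1 (term_code c u) (term_code c v).
  have [/(_ (ltn_trans h1 jn)) U /(_ (ltn_trans h2 jn)) V] := (IHu, IHv).
  rewrite mem_cat; split.
    case=> [/cns_inj []//|].
    case=> [[a [_ [d [_ [/cns_inj [_ /cns_inj [<- /cns_inj [<- _]]]]]]]]|]; last first.
      by case=> [a [_ [d [_ [/cns_inj []]]]]].
    by case=> [/U ->|/V ->]; rewrite ?orbT.
  move=> H; right; left; exists (term_code c u); split=> //.
  exists (term_code c v); split=> //; split=> //.
  by case/orP: H => [/U|/V]; [left|right].
- have [h1 h2] := cns3_gt 2 (c s) (term_code c u).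
  have /(_ (ltn_trans h2 jn)) U := IHu; split.
    case=> [/cns_inj []//|].
    case=> [[a [_ [d [_ [/cns_inj []]]]]]|] //.
    by case=> [a [_ [d [_ [/cns_inj [_ /cns_inj [_ /cns_inj [<- _]]] /U]]]]].
  move/U => H; do 2!right; exists (c s); split=> //.
  by exists (term_code c u).
Qed.

Lemma formula_free_sound p k : formula_code c p < n.+1 -> k < n.+1 ->
  entry (tab w 11 (formula_code c p)) k <> 0 <-> k \in free_vars p.
Proof.
have [_ [cj _]] := cert; move=> + kn.
elim: p => [u v|u v|u|p IHp|p IHp q IHq|i p IHp] jn;
  have [_ [_ [_ [_ f]]]] := cj _ jn; have [_ ->] := f k kn; rewrite [free_vars _]/=.
- have [h1 h2] := cns3_gt 0 (term_code c u) (term_code c v).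
  have U := term_free_sound (ltn_trans h1 jn) kn.
  have V := term_free_sound (ltn_trans h2 jn) kn.
  rewrite mem_cat; split.
    case=> [[a [_ [d [_ [[|/cns_inj [] //] /cns_inj [_ /cns_inj [<- /cns_inj [<- _]]]]]]]]|].
      by case=> [/U ->|/V ->]; rewrite ?orbT.
    case=> [[a [_ [/cns_inj []//]]]|]; case=> [[a [_ [/cns_inj []//]]]|].
    by case=> [] [a [_ [d [_ [/cns_inj []//]]]]].
  move=> H; left; exists (term_code c u); split=> //; exists (term_code c v); split=> //.
  by split; [left|case/orP: H => [/U|/V]; [left|right]].
- have [h1 h2] := cns3_gt 1 (term_code c u) (term_code c v).
  have U := term_free_sound (ltn_trans h1 jn) kn.
  have V := term_free_sound (ltn_trans h2 jn) kn.
  rewrite mem_cat; split.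
    case=> [[a [_ [d [_ [[/cns_inj []//|] /cns_inj [_ /cns_inj [<- /cns_inj [<- _]]]]]]]]|].
      by case=> [/U ->|/V ->]; rewrite ?orbT.
    case=> [[a [_ [/cns_inj []//]]]|]; case=> [[a [_ [/cns_inj []//]]]|].
    by case=> [] [a [_ [d [_ [/cns_inj []//]]]]].
  move=> H; left; exists (term_code c u); split=> //; exists (term_code c v); split=> //.
  by split; [right|case/orP: H => [/U|/V]; [left|right]].
- have h1 := cns2_gt 2 (term_code c u).
  have U := term_free_sound (ltn_trans h1 jn) kn; split.
    case=> [[a [_ [d [_ [[/cns_inj []//|/cns_inj []//]]]]]]|].
    case=> [[a [_ [/cns_inj [_ /cns_inj [<- _]] /U]]]|] //.
    case=> [[a [_ [/cns_inj []//]]]|].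
    by case=> [] [a [_ [d [_ [/cns_inj []//]]]]].
  by move/U => H; right; left; exists (term_code c u).
- have h1 := cns2_gt 3 (formula_code c p).
  have U := IHp (ltn_trans h1 jn); split.
    case=> [[a [_ [d [_ [[/cns_inj []//|/cns_inj []//]]]]]]|].
    case=> [[a [_ [/cns_inj []//]]]|].
    case=> [[a [_ [/cns_inj [_ /cns_inj [<- _]] /U]]]|] //.
    by case=> [] [a [_ [d [_ [/cns_inj []//]]]]].
  by move/U => H; do 2!right; left; exists (formula_code c p).
- have [h1 h2] := cns3_gt 4 (formula_code c p) (formula_code c q).
  have U := IHp (ltn_trans h1 jn); have V := IHq (ltn_trans h2 jn).
  rewrite mem_cat; split.
    case=> [[a [_ [d [_ [[/cns_inj []//|/cns_inj []//]]]]]]|].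
    case=> [[a [_ [/cns_inj []//]]]|]; case=> [[a [_ [/cns_inj []//]]]|].
    case=> [[a [_ [d [_ [/cns_inj [_ /cns_inj [<- /cns_inj [<- _]]]]]]]]|]; last first.
      by case=> a [_ [d [_ [/cns_inj []//]]]].
    by case=> [/U ->|/V ->]; rewrite ?orbT.
  move=> H; do 3!right; left; exists (formula_code c p); split=> //.
  exists (formula_code c q); split=> //; split=> //.
  by case/orP: H => [/U|/V]; [left|right].
- have [h1 h2] := cns3_gt 5 i (formula_code c p).
  have U := IHp (ltn_trans h2 jn); rewrite mem_filter; split.
    case=> [[a [_ [d [_ [[/cns_inj []//|/cns_inj []//]]]]]]|].
    case=> [[a [_ [/cns_inj []//]]]|]; case=> [[a [_ [/cns_inj []//]]]|].
    case=> [[a [_ [d [_ [/cns_inj []//]]]]]|].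
    case=> [i' [_ [a [_ [/cns_inj [_ /cns_inj [<- /cns_inj [<- _]]] [/eqP -> /U]]]]]] //.
  case/andP => /eqP ki /U H; do 4!right; exists i; split=> //.
  by exists (formula_code c p).
Qed.

(** The recogniser of a sentence is evaluated under the single assignment coded by the constant word
    of letter 0; by [sat_ext] its truth does not depend on the assignment. *)
Lemma accepted_sound : accepted n w <-> exists2 p, theory K p & formula_code c p = n.
Proof.
have [_ [_ lk]] := cert; set e := power _ _ in lk.
have nn : n < n.+1 by [].
have main p : formula_code c p = n ->
    sat sval (fun i => tv (fun=> 0) i.+1) p <-> aacc (tab w 1 n) e e.
  move=> pn; have := formula_sound (p := p); rewrite pn => /(_ nn) [wv rv].
  have ->: sat sval (fun i => tv (fun=> 0) i.+1) p <-> aacc (tab w 1 n) e e; last by [].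
  have A0 : 0 < A by apply: ndigX_gt0.
  have eD k : power (tab w 1 n) k < asz (tab w 1 n).
    have [cl _ lt] := wv; elim: k => [|k IH]; first exact: lt.
    by apply: cl => //; exact: lt.
  apply: rv => //; try exact: eD.
  (* Blocks of length k + 1, where k is the exponent stored in row 12, all have value [e]. *)
  exists (fun i => i * (entry w 12).+1); split=> //.
  - by move=> i; rewrite ltn_mul2r ltnS leqnn.
  - by rewrite mul1n -[_.+1]add0n power_seg.
  - by move=> i; rewrite [in RHS]/e -(power_seg _ (i.+1 * (entry w 12).+1)) -mulSnr.
split.
  case=> /(formula_shape_sound nn) [p pn] [fv acc]; exists p => //.
  have sp : sentence p.
    apply/nilP; case E : (free_vars p) => [|k s] //; exfalso.
    have kp : k \in free_vars p by rewrite E mem_head.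
    have kn : k < n.+1 by rewrite -pn ltnW // ltnS free_vars_lt.
    by apply: (fv k kn); have := formula_free_sound (p := p) _ kn; rewrite pn => ->.
  split=> // e'; have /main H := pn; move/H in acc.
  apply: (iffLR (@sat_ext _ _ sval p _ e' _)) acc => k.
  by move: sp => /nilP ->.
case=> p [sp Hp] pn; split; first by apply/formula_shape_sound => //; exists p.
split; last by apply/(main p pn).
move=> i ni; have := formula_free_sound (p := p) _ ni; rewrite pn => -> //.
by move: sp => /nilP ->.
Qed.
End Soundness.

(** The least certificate for n is a recursive function of n, because certificates exist for all n
    and the condition is decidable; acceptance is then read from it. *)
Theorem quadratic_decidable (R : realType) (t : nat) (b : R) (K : {pred R}) (irr : bool) :
  2 < t -> (1 < b)%R -> (b ^+ 2 = t%:R * b - 1)%R ->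
  (forall x, x \in K <-> exists s, admissible irr s /\ scalar b s = x) ->
  (forall s u, admissible irr s -> admissible irr u ->
     scalar b s = scalar b u <-> same_scalar s u) ->
  decidable_theory K.
Proof.
move=> t2 b1 bE HK Hsame.
have [vEq hEq] := reg_eq b1 bE; have [vAdd hAdd] := reg_add b1 bE.
have [vMul hMul] := reg_mulb b1 bE; have [vLt hLt] := reg_lt t2 b1 bE.
have [vInt hInt] := reg_int t2 b1 bE; have [vTrue hTrue] := reg_true (ndig t ^ 3).
have /choice [c Hc] := canonical_exists HK Hsame.
exists c; first exact: (c_inj Hc).
pose C n w := certificate t vEq vAdd vMul vLt vInt vTrue irr n w.
have exC n : exists w, `[< C n w >].
  have [w Cw] : exists w, C n w.
    apply: (certificate_exists (n := n) irr hEq.1 hAdd.1 hMul.1 hLt.1 hInt.1 hTrue.1).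
    by have [v []] := reg_true (ndig t ^ n.+3); exists v.
  by exists w; apply/asboolP.
pose W n := ex_minn (exC n).
have CW n : C n (W n) by rewrite /W; case: ex_minnP => w /asboolP.
have rW : @rc 1 (fun e => W e.2).
  apply: (rc_mu (P := fun (e : env 1) w => C e.2 w)) => [|e|e w].
  - exact: (rp_certificate t vEq vAdd vMul vLt vInt vTrue irr).
  - exact: CW.
  - rewrite /W; case: ex_minnP => w' _ wmin ww' Cw.
    by have := wmin w ltac:(by apply/asboolP); rewrite leqNgt ww'.
have rF : @rp 1 (fun e => accepted e.2 (W e.2)).
  exact: (rp_sub (P := fun e : env 2 => accepted e.1.2 e.2) rp_accepted rW).
exists (fun v => nat_of_bool `[< accepted (env_of 1 v).2 (W (env_of 1 v).2) >]) => //.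
move=> n /=; congr nat_of_bool; apply: asbool_equiv_eq.
have := accepted_sound t2 b1 bE HK Hsame Hc hEq hAdd hMul hLt hInt hTrue (CW n).
by move=> ->.
Qed.

(** * Pell's equation *)

Local Open Scope ring_scope.

Lemma pigeonhole n (f : nat -> nat) : (forall i, (i <= n)%N -> (f i < n)%N) ->
  exists i j, [/\ (i < j)%N, (j <= n)%N & f i = f j].
Proof.
move=> fn; have [inj|] := pselect {in iota 0 n.+1 &, injective f}.
  have : (size (map f (iota 0 n.+1)) <= size (iota 0 n))%N.
    apply: uniq_leq_size => [|_ /mapP [i + ->]].
      by rewrite map_inj_in_uniq ?iota_uniq.
    by rewrite !mem_iota /= !add0n ltnS; apply: fn.
  by rewrite size_map !size_iota ltnn.
move=> ninj; apply/not_existsP => H; apply: ninj => i j.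
rewrite !mem_iota !add0n !ltnS /= => ni nj fij.
have [ij|ji|//] := ltngtP i j; exfalso.
  by apply: (H i); exists j.
by apply: (H j); exists i.
Qed.

(** Two of the fractional parts of i x with i from 0 to Q lie in the same of Q intervals of length
    1/Q. *)
Lemma dirichlet (R : realType) (x : R) (Q : nat) : (0 < Q)%N ->
  exists (m : nat) (p : int), (0 < m <= Q)%N /\ `|m%:R * x - p%:~R| < Q%:R^-1.
Proof.
move=> Q0; have Q0' : 0 < Q%:R :> R by rewrite ltr0n.
pose fr (i : nat) := i%:R * x - (Num.floor (i%:R * x))%:~R.
have fr01 i : 0 <= fr i < 1.
  have /andP[h1 h2] := floor_itv (i%:R * x); rewrite /fr subr_ge0 h1 /=.
  by rewrite ltrBlDl addrC; move: h2; rewrite intrD addrC.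
have [i _|i [j [ij jQ E]]] := @pigeonhole Q (fun i => absz (Num.floor (Q%:R * fr i))).
  have /andP[h1 h2] := fr01 i.
  have fl0 : 0 <= Num.floor (Q%:R * fr i) by rewrite floor_ge0 mulr_ge0 // ltW.
  rewrite -ltz_nat gez0_abs // -(ltr_int R); apply: le_lt_trans (floor_le _) _.
  by rewrite -pmulrn -[ltRHS]mulr1 ltr_pM2l.
have fl k : (absz (Num.floor (Q%:R * fr k)))%:R <= Q%:R * fr k :> R /\
    Q%:R * fr k < (absz (Num.floor (Q%:R * fr k)))%:R + 1.
  have /andP[h1 h2] := fr01 k.
  have fl0 : 0 <= Num.floor (Q%:R * fr k) by rewrite floor_ge0 mulr_ge0 // ltW.
  have /andP[] := floor_itv (Q%:R * fr k).
  by rewrite natr_absz (ger0_norm fl0) intrD.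
exists (j - i)%N, (Num.floor (j%:R * x) - Num.floor (i%:R * x)); split.
  by rewrite subn_gt0 ij /= (leq_trans (leq_subr _ _)).
have -> : (j - i)%N%:R * x - (Num.floor (j%:R * x) - Num.floor (i%:R * x))%:~R =
    fr j - fr i by rewrite natrB ?(ltnW ij) // /fr intrB; ring.
rewrite -[ltRHS]mul1r ltr_pdivlMr // -[X in _ * X](gtr0_norm Q0') -normrM mulrC mulrBr.
have [a1 a2] := fl i; have [c1 c2] := fl j; rewrite E in a1 a2.
by rewrite ltr_norml; apply/andP; split; lra.
Qed.

Definition irrational (R : realType) (x : R) := forall q : rat, x <> ratr q.

Lemma irrational_int (R : realType) (x : R) (m p : int) : irrational x ->
  m%:~R * x = p%:~R -> m = 0 /\ p = 0.
Proof.
move=> ix E; have [m0|m0] := eqVneq m 0.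
  split=> //; apply/eqP; rewrite -(intr_eq0 R) -E m0.
  by rewrite mul0r.
exfalso; apply: (ix (p%:~R / m%:~R)); rewrite fmorph_div !rmorph_int -E.
by field; rewrite intr_eq0.
Qed.

(** Good approximations p/m of del give elements p + m del of bounded norm p^2 - Del m^2. Two of
    them with equal norm n and equal residues modulo n have as quotient a nontrivial solution. *)
Lemma pell (R : realType) (Del : nat) (del : R) : 0 < del -> del ^+ 2 = Del%:R ->
  irrational del -> exists x y : nat, (0 < y)%N /\ (x ^ 2 = Del * y ^ 2 + 1)%N.
Proof.
move=> d0 dE di.
have /choice [mp Hmp] Q : exists mp : nat * int, (0 < mp.1 <= Q.+1)%N /\
    `|mp.1%:R * del - mp.2%:~R| < Q.+1%:R^-1.
  by have [m [p H]] := dirichlet del (ltn0Sn Q); exists (m, p).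
pose m Q := (mp Q).1%:Z; pose p Q := (mp Q).2.
pose N Q : int := p Q ^+ 2 - Del%:Z * m Q ^+ 2.
pose e Q : R := (m Q)%:~R * del - (p Q)%:~R.
have eQ Q : `|e Q| < Q.+1%:R^-1 by have [_] := Hmp Q.
have NE Q : (N Q)%:~R = - e Q * (2 * (m Q)%:~R * del - e Q) :> R.
  by rewrite /N intrB intrM !rmorphXn /= -[Del%:~R]pmulrn -dE /e; ring.
have e0 Q : e Q <> 0.
  move=> /eqP; rewrite subr_eq0 => /eqP /(irrational_int di) [m0 _].
  by have [/andP[]] := Hmp Q; rewrite /m in m0; case: m0 => ->.
have N0 Q : N Q <> 0.
  move=> /(congr1 (fun z => z%:~R : R)); rewrite NE => /eqP.
  rewrite mulf_eq0 oppr_eq0 => /orP[/eqP/e0//|].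
  rewrite /e (_ : _ - _ = (m Q)%:~R * del + (p Q)%:~R); last by ring.
  rewrite addr_eq0 -intrN => /eqP /(irrational_int di) [m0 _].
  by have [/andP[]] := Hmp Q; rewrite /m in m0; case: m0 => ->.
pose B := Num.bound `|2 * del + 1|.
have NB Q : (absz (N Q) <= B)%N.
  rewrite -(ler_nat R) natr_absz intr_norm NE normrM normrN.
  apply: le_trans (ltW (archi_boundP (normr_ge0 _))).
  apply: le_trans (ler_norm _).
  have Q0 : 0 < Q.+1%:R :> R by rewrite ltr0n.
  have Q1 : 1 <= Q.+1%:R :> R by rewrite ler1n.
  have mQ0 : 0 <= (m Q)%:~R :> R by rewrite ler0z.
  have mQ1 : (m Q)%:~R <= Q.+1%:R :> R.
    by have [/andP[h1 h2] _] := Hmp Q; rewrite /m -pmulrn ler_nat.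
  have H1 : `|2 * (m Q)%:~R * del - e Q| <= 2 * Q.+1%:R * del + 1.
    apply: le_trans (ler_normB _ _) _; apply: lerD.
      rewrite !normrM (gtr0_norm d0) (ger0_norm mQ0) normr_nat.
      by rewrite ler_pM2r // ler_pM2l.
    apply: le_trans (ltW (eQ Q)) _; rewrite invf_le1 //.
  apply: le_trans (ler_pM (normr_ge0 _) (normr_ge0 _) (ltW (eQ Q)) H1) _.
  have -> : Q.+1%:R^-1 * (2 * Q.+1%:R * del + 1) = 2 * del + Q.+1%:R^-1.
    by move: Q0; move: (Q.+1%:R : R) => q q0; field; rewrite gt_eqF.
  by rewrite lerD2l invf_le1.
(* The norm and the two residues take finitely many values, so some triple recurs for arbitrarily
   large [Q]. *)
pose F Q := (N Q, (p Q %% N Q)%Z, (m Q %% N Q)%Z).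
pose I : seq int := [seq j%:Z - B%:Z | j <- iota 0 (B + B).+1].
have modI Q (a : int) : (a %% N Q)%Z \in I.
  apply: int_interval; apply: leq_trans (NB Q).
  have := modz_ge0 a (introN eqP (N0 Q)); have := ltz_mod a (introN eqP (N0 Q)).
  by lia.
have [k|Q _|v _ Hv] := @infinite_pigeonhole _ F
    [seq (x, z) | x <- [seq (x, y) | x <- I, y <- I], z <- I] (fun=> True).
- by exists k.
- apply: allpairs_f; last exact: modI.
  by apply: allpairs_f; [apply/int_interval/NB|apply: modI].
have [Q1 [_ _ F1]] := Hv 0%N.
have en0 : 0 < `|e Q1| by rewrite normr_gt0; apply/eqP/e0.
(* The second approximation is taken late enough to have a strictly smaller error, hence to differ
   from the first. *)
have [Q2 [Q2b _ F2]] := Hv (Num.bound `|(`|e Q1|^-1)|).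
have e21 : `|e Q2| < `|e Q1|.
  apply: lt_trans (eQ Q2) _; rewrite -[ltRHS]invrK ltf_pV2 ?posrE ?invr_gt0 ?ltr0n //.
  apply: le_lt_trans (ler_norm _) _; apply: lt_le_trans (archi_boundP (normr_ge0 _)) _.
  by rewrite ler_nat leqW.
have [N12 p12 m12] : [/\ N Q2 = N Q1, (p Q2 %% N Q1)%Z = (p Q1 %% N Q1)%Z &
    (m Q2 %% N Q1)%Z = (m Q1 %% N Q1)%Z].
  by move: F2; rewrite -F1 /F => -[-> -> ->].
set n := N Q1 in N12 p12 m12.
have n0 : n != 0 by apply/eqP/N0.
have pd : (n %| p Q2 - p Q1)%Z by rewrite -eqz_mod_dvd; apply/eqP.
have md : (n %| m Q2 - m Q1)%Z by rewrite -eqz_mod_dvd; apply/eqP.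
have nE1 : n = p Q1 ^+ 2 - Del%:Z * m Q1 ^+ 2 by [].
have nE2 : n = p Q2 ^+ 2 - Del%:Z * m Q2 ^+ 2 by rewrite -N12.
(* X and Y are, up to sign, the coordinates of one element times the conjugate of the other, divided
   by n; the congruences make them integers. *)
have [X XE] : exists X, p Q1 * p Q2 - Del%:Z * m Q1 * m Q2 = X * n.
  apply/dvdzP.
  have -> : p Q1 * p Q2 - Del%:Z * m Q1 * m Q2 = p Q1 * (p Q2 - p Q1) -
    Del%:Z * m Q1 * (m Q2 - m Q1) + n by rewrite nE1; ring.
  by apply: rpredD (dvdzz n); apply: rpredB; apply: dvdz_mull.
have [Y YE] : exists Y, p Q1 * m Q2 - p Q2 * m Q1 = Y * n.
  apply/dvdzP.
  have -> : p Q1 * m Q2 - p Q2 * m Q1 = p Q1 * (m Q2 - m Q1) -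
    m Q1 * (p Q2 - p Q1) by ring.
  by apply: rpredB; apply: dvdz_mull.
have XY : X ^+ 2 = Del%:Z * Y ^+ 2 + 1.
  apply: (mulIf (x := n ^+ 2)); first by rewrite expf_neq0.
  have -> : (Del%:Z * Y ^+ 2 + 1) * n ^+ 2 = Del%:Z * (Y * n) ^+ 2 + n * n by ring.
  by rewrite -exprMn -XE -YE {1}nE1 nE2; ring.
(* If Y = 0, the two pairs are proportional and of equal norm, hence equal, against the strict
   inequality of their errors. *)
have Y0 : Y != 0.
  apply/eqP => Y0; rewrite Y0 mul0r in YE; move/eqP: YE; rewrite subr_eq0 => /eqP YE.
  have mm : m Q1 ^+ 2 = m Q2 ^+ 2.
    apply: (mulIf n0); rewrite {1}nE2 nE1.
    have -> : m Q1 ^+ 2 * (p Q2 ^+ 2 - Del%:Z * m Q2 ^+ 2) =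
      (p Q2 * m Q1) ^+ 2 - Del%:Z * m Q2 ^+ 2 * m Q1 ^+ 2 by ring.
    by rewrite -YE; ring.
  have m1 : m Q1 = m Q2.
    by apply/eqP; rewrite -(@eqrXn2 _ 2) // ?mm //; apply: ler0n.
  have m2 : m Q2 != 0.
    by have [/andP[h _]] := Hmp Q2; rewrite /m; lia.
  have p1 : p Q1 = p Q2 by apply: (mulIf m2); rewrite YE m1.
  by move: e21; rewrite /e m1 p1 ltxx.
exists (absz X), (absz Y); split; first by rewrite absz_gt0.
apply/eqP; rewrite -eqz_nat PoszD PoszM -!abszX.
have -> : (absz (X ^+ 2)%R : int) = X ^+ 2 by rewrite abszE ger0_norm // sqr_ge0.
have -> : (absz (Y ^+ 2)%R : int) = Y ^+ 2 by rewrite abszE ger0_norm // sqr_ge0.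
by rewrite XY.
Qed.

(** * Fields of degree at most two *)

Definition rspan (R : realType) (a x : R) := exists p q : rat, x = ratr p + ratr q * a.

Section DivringClosed.
Variables (R : realType) (L : {pred R}) (hL : GRing.divring_closed L).

Lemma divring1 : 1 \in L. Proof. by case: hL. Qed.
Lemma divringB x y : x \in L -> y \in L -> x - y \in L.
Proof. by case: hL => _ h _; apply: h. Qed.
Lemma divring_div x y : x \in L -> y \in L -> x / y \in L.
Proof. by case: hL => _ _ h; apply: h. Qed.
Lemma divring0 : 0 \in L.
Proof. by rewrite -(subrr 1) divringB ?divring1. Qed.
Lemma divringD x y : x \in L -> y \in L -> x + y \in L.
Proof.
move=> xL yL; rewrite -[y]opprK -[- y]sub0r.
by rewrite divringB // divringB // divring0.
Qed.
Lemma divringM x y : x \in L -> y \in L -> x * y \in L.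
Proof.
move=> xL yL; rewrite -[y]invrK -[y^-1]mul1r.
by rewrite divring_div // divring_div // divring1.
Qed.
Lemma divring_nat n : n%:R \in L.
Proof. by elim: n => [|n IHn]; rewrite ?divring0 // -natr1 divringD ?divring1. Qed.
Lemma divring_int z : z%:~R \in L.
Proof.
by case: z => n; [|rewrite NegzE rmorphN /= -sub0r divringB ?divring0 //];
  rewrite -pmulrn divring_nat.
Qed.
Lemma divring_rat q : ratr q \in L.
Proof. by rewrite /ratr divring_div ?divring_int. Qed.
Lemma divring_rspan a x : a \in L -> rspan a x -> x \in L.
Proof.
move=> aL [p [q ->]]; apply: divringD; first exact: divring_rat.
by apply: divringM; first exact: divring_rat.
Qed.

End DivringClosed.

Definition rindep (R : realType) (x y : R) := forall p q r : rat,
  ratr p + ratr q * x + ratr r * y = 0 -> [/\ p = 0, q = 0 & r = 0].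

Lemma irr_rat0 (R : realType) (a : R) (p q : rat) : irrational a ->
  ratr p + ratr q * a = 0 -> p = 0 /\ q = 0.
Proof.
move=> ia H; have [q0|q0] := eqVneq q 0.
  by move: H; rewrite q0 rmorph0 mul0r addr0 => /eqP; rewrite fmorph_eq0 => /eqP.
exfalso; apply: (ia (- p / q)); rewrite fmorph_div rmorphN /=.
have q0' : ratr q != 0 :> R by rewrite fmorph_eq0.
have -> : - ratr p = ratr q * a by apply/eqP; rewrite eq_sym -addr_eq0 addrC H.
by field.
Qed.

Lemma rindep_irrational (R : realType) (x y : R) : rindep x y -> irrational x.
Proof.
move=> xy r E; have [_ /eqP] := xy (- r) 1 0 ltac:(by rewrite E rmorphN rmorph1 rmorph0; ring).
by rewrite oner_eq0.
Qed.

Section Degree.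
Variables (R : realType) (K : {pred R}) (hK : GRing.divring_closed K).

Lemma degree_trichotomy :
  [\/ forall x, x \in K <-> exists q, x = ratr q,
      exists a, irrational a /\ forall x, x \in K <-> rspan a x
    | exists x y, [/\ x \in K, y \in K & rindep x y]].
Proof.
have [h|/existsPNP [a aK na]] := pselect (forall x, x \in K -> exists q, x = ratr q).
  by constructor 1 => x; split=> [/h|[q ->]] //; apply: divring_rat.
have ia : irrational a by move=> q aq; apply: na; exists q.
have [h|/existsPNP [y yK ny]] := pselect (forall x, x \in K -> rspan a x).
  constructor 2; exists a; split=> // x; split=> [/h //|].
  exact: divring_rspan.
constructor 3; exists a, y; split=> // p q r.
have [-> |r0] := eqVneq r 0.
  by rewrite rmorph0 mul0r addr0 => /irr_rat0 [].
move=> H; exfalso; apply: ny; exists (- p / r), (- q / r).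
rewrite !fmorph_div !rmorphN /=.
have r0' : ratr r != 0 :> R by rewrite fmorph_eq0.
apply: (mulfI r0'); apply/eqP; rewrite -subr_eq0 -[X in _ == X]H; apply/eqP.
by field.
Qed.

Lemma has_degree_le2 : (exists2 d, (d <= 2)%N & has_degree K d) <->
  ((forall x, x \in K <-> exists q, x = ratr q) \/
   exists a, irrational a /\ forall x, x \in K <-> rspan a x).
Proof.
split.
  case=> d d2 [b [_ _ span]].
  have [|h|[x [y [xK yK xy]]]] := degree_trichotomy; [by left|by right|exfalso].
  have [w0 [w1 span2]] : exists w0 w1, forall z, z \in K ->
      exists p q, z = ratr p * w0 + ratr q * w1 :> R.
    case: d d2 b span => [|[|[|//]]] _ b span.
    - exists 0, 0 => z /span [q ->]; exists 0, 0.
      by rewrite big_ord0 !mulr0 addr0.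
    - exists (b ord0), 0 => z /span [q ->]; exists (q ord0), 0.
      by rewrite big_ord1 mulr0 addr0.
    - exists (b ord0), (b (lift ord0 ord0)) => z /span [q ->].
      exists (q ord0), (q (lift ord0 ord0)).
      by rewrite !big_ord_recl big_ord0 addr0.
  have [p0 [q0 E0]] := span2 1 (divring1 hK).
  have [p1 [q1 E1]] := span2 x xK.
  have [p2 [q2 E2]] := span2 y yK.
  (* A determinant with a repeated row: the three 2 by 2 minors of the coordinates of 1, x, y are
     the coefficients of a relation between 1, x, y, so they vanish. One of them then yields
     relations between 1 and x that force the coordinates of 1 to be zero. *)
  have [_ _ D2] : [/\ p1 * q2 - p2 * q1 = 0, p2 * q0 - p0 * q2 = 0 & p0 * q1 - p1 * q0 = 0].
    apply: xy; rewrite -[ratr (p1 * _ - _)]mulr1 {1}E0 E1 E2.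
    by rewrite !(rmorphB, rmorphM) /=; ring.
  have [_ q00 _] : [/\ - q1 = 0, q0 = 0 & 0 = 0 :> rat].
    apply: xy; rewrite -[ratr (- q1)]mulr1 {1}E0 E1.
    transitivity (- ratr (p0 * q1 - p1 * q0) * w0).
      by rewrite !(rmorphB, rmorphM, rmorphN, rmorph0) /=; ring.
    by rewrite D2 rmorph0 oppr0 mul0r.
  have [_ p00 _] : [/\ - p1 = 0, p0 = 0 & 0 = 0 :> rat].
    apply: xy; rewrite -[ratr (- p1)]mulr1 {1}E0 E1.
    transitivity (ratr (p0 * q1 - p1 * q0) * w1).
      by rewrite !(rmorphB, rmorphM, rmorphN, rmorph0) /=; ring.
    by rewrite D2 rmorph0 mul0r.
  by move/eqP: E0; rewrite p00 q00 rmorph0 !mul0r addr0 oner_eq0.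
case=> [h|[a [ia h]]].
  exists 1%N => //; exists (fun=> 1); split=> [i|q|x /h [q ->]].
  - exact: divring1.
  - rewrite big_ord1 mulr1 => /eqP; rewrite fmorph_eq0 => /eqP q0 i.
    by rewrite (ord1 i).
  - by exists (fun=> q); rewrite big_ord1 mulr1.
exists 2%N => //; exists (fun i => if i == ord0 then 1 else a); split=> [i|q|x /h [p [q ->]]].
- case: ifP => _; first exact: divring1.
  by apply/h; exists 0, 1; rewrite rmorph0 rmorph1 add0r mul1r.
- rewrite !big_ord_recl big_ord0 /= mulr1 addr0 => /(irr_rat0 ia) [p0 q0] i.
  have [->//|i0] := eqVneq i ord0.
  by rewrite -[RHS]q0; congr q; apply/val_inj; case: i i0 => [[|[|]]].
- exists (fun i => if i == ord0 then p else q).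
  by rewrite !big_ord_recl big_ord0 /= mulr1 addr0.
Qed.

(** Q(a) is the least subfield containing a. For a quadratic irrational a, the span of 1 and a is
    already a field, since a^2 lies in it and inverses come from the conjugate; conversely, a^2 in
    the span gives a quadratic equation. *)
Lemma quadratic_rspan : (exists2 a : R, quadratic a & [set` K] = Qadjoin a) <->
  ((forall x, x \in K <-> exists q, x = ratr q) \/
   exists a, irrational a /\ forall x, x \in K <-> rspan a x).
Proof.
split.
  case=> a [p sp pa] KE.
  have inL (L : {pred R}) : GRing.divring_closed L -> a \in L -> forall x, x \in K -> x \in L.
    move=> hL aL x xK; have : [set` K] x by [].
    by rewrite KE; apply.
  have aK : a \in K by have : [set` K] a by rewrite KE.
  have [[q aE]|/forallNP ia] := pselect (exists q, a = ratr q).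
    left=> x; split=> [xK|[r ->]]; last exact: divring_rat.
    pose L : {pred R} := [pred x | `[< exists q : rat, x = ratr q >]].
    suff : x \in L by move/asboolP.
    apply: (inL L) => //; last by apply/asboolP; exists q.
    split; first by apply/asboolP; exists 1; rewrite rmorph1.
      move=> _ _ /asboolP [u ->] /asboolP [v ->].
      by apply/asboolP; exists (u - v); rewrite rmorphB.
    move=> _ _ /asboolP [u ->] /asboolP [v ->].
    by apply/asboolP; exists (u / v); rewrite fmorph_div.
  right; exists a; split=> //.
  have [u [v aE]] : exists u v : rat, a ^+ 2 = ratr u + ratr v * a.
    have p2 : p`_2 != 0 by have := lead_coef_eq0 p; rewrite lead_coefE sp /= -size_poly_eq0 sp => ->.
    exists (- p`_0 / p`_2), (- p`_1 / p`_2); rewrite !fmorph_div !rmorphN /=.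
    have p2' : ratr p`_2 != 0 :> R by rewrite fmorph_eq0.
    apply: (mulfI p2'); apply/eqP; rewrite -subr_eq0; apply/eqP.
    move: pa; rewrite /root horner_coef size_map_poly sp !big_ord_recl big_ord0 /= !coef_map /=.
    by rewrite expr0 mulr1 => /eqP <-; rewrite /bump /=; field.
  move=> x; split=> [xK|]; last exact: divring_rspan.
  pose L : {pred R} := [pred x | `[< rspan a x >]].
  suff : x \in L by move/asboolP.
  apply: (inL L) => //; last first.
    by apply/asboolP; exists 0, 1; rewrite rmorph0 rmorph1 add0r mul1r.
  split; first by apply/asboolP; exists 1, 0; rewrite rmorph0 rmorph1 mul0r addr0.
    move=> _ _ /asboolP [r [s ->]] /asboolP [r' [s' ->]].
    by apply/asboolP; exists (r - r'), (s - s'); rewrite !rmorphB /=; ring.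
  move=> _ _ /asboolP [r [s ->]] /asboolP [r' [s' ->]]; apply/asboolP.
  have [->|y0] := eqVneq (ratr r' + ratr s' * a) 0.
    by rewrite invr0 mulr0; exists 0, 0; rewrite rmorph0 mul0r addr0.
  (* The norm of r' + s' a, with a^2 = u + v a; the conjugate is r' + s' v - s' a. *)
  pose N := r' ^+ 2 + r' * s' * v - s' ^+ 2 * u.
  have NE : ratr N = (ratr r' + ratr s' * a) * (ratr (r' + s' * v) + ratr (- s') * a).
    rewrite /N !(rmorphB, rmorphD, rmorphM, rmorphN, rmorphXn) /=.
    have -> : ratr u = a ^+ 2 - ratr v * a by rewrite aE addrK.
    by ring.
  have N0 : ratr N != 0 :> R.
    rewrite NE mulf_neq0 //; apply/eqP => /(irr_rat0 ia) [h /eqP].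
    rewrite oppr_eq0 => /eqP s0; move: h; rewrite s0 mul0r addr0 => r0.
    by move: y0; rewrite s0 r0 rmorph0 mul0r addr0 eqxx.
  have -> : (ratr r + ratr s * a) / (ratr r' + ratr s' * a) =
     (ratr r + ratr s * a) * (ratr (r' + s' * v) + ratr (- s') * a) / ratr N.
    have := N0; rewrite NE mulf_eq0 negb_or => /andP[_ c0].
    by rewrite -mulf_div divff ?mulr1.
  clearbody N; exists ((r * (r' + s' * v) - s * s' * u) / N),
    ((s * (r' + s' * v) - r * s' - s * s' * v) / N).
  rewrite !(fmorph_div, rmorphB, rmorphD, rmorphM, rmorphN) /=.
  have -> : ratr u = a ^+ 2 - ratr v * a by rewrite aE addrK.
  by field.
case=> [h|[a [ia h]]].
  exists 0.
    by exists 'X^2; rewrite ?size_polyXn // rmorphXn /= map_polyX rootE hornerXn expr0n.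
  apply/seteqP; split=> x /=.
    by move=> /h [q ->] L hL _; apply: divring_rat.
  by apply=> //; apply: divring0.
have aK : a \in K by apply/h; exists 0, 1; rewrite rmorph0 rmorph1 add0r mul1r.
exists a; last first.
  apply/seteqP; split=> x /=; last by move/(_ K hK aK).
  by move=> /h xa L hL aL; apply: divring_rspan hL _ _ aL xa.
have /h [u [v aE]] : a * a \in K by rewrite divringM.
exists ('X^2 - (v *: 'X + u%:P)).
  rewrite size_polyDl ?size_polyXn // size_polyN (leq_ltn_trans (size_polyD _ _)) //.
  rewrite gtn_max (leq_ltn_trans (size_scale_leq _ _)) ?size_polyX //=.
  by rewrite (leq_ltn_trans (size_polyC_leq1 _)).
rewrite rmorphB rmorphXn rmorphD /= map_polyZ map_polyX map_polyC /=.
by rewrite rootE !hornerE expr2 aE; apply/eqP; ring.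
Qed.

End Degree.

(** * Decidability in degree at most two *)

Lemma diff_frac_eq (a c r a' c' r' : nat) :
  (a%:R - c%:R) / r.+1%:R = (a'%:R - c'%:R) / r'.+1%:R :> rat <->
  (a * r'.+1 + c' * r.+1 = a' * r.+1 + c * r'.+1)%N.
Proof.
have r0 : r.+1%:R != 0 :> rat by rewrite pnatr_eq0.
have r0' : r'.+1%:R != 0 :> rat by rewrite pnatr_eq0.
have -> : (a * r'.+1 + c' * r.+1 = a' * r.+1 + c * r'.+1)%N <->
    (a%:R * r'.+1%:R + c'%:R * r.+1%:R = a'%:R * r.+1%:R + c%:R * r'.+1%:R :> rat).
  by rewrite -!natrM -!natrD; split=> [->//|/eqP]; rewrite eqr_nat => /eqP.
have E : ((a%:R - c%:R) / r.+1%:R == (a'%:R - c'%:R) / r'.+1%:R :> rat) =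
    (a%:R * r'.+1%:R + c'%:R * r.+1%:R == a'%:R * r.+1%:R + c%:R * r'.+1%:R :> rat).
  by rewrite eqr_div // -subr_eq0 -[RHS]subr_eq0; congr (_ == 0); ring.
by split=> /eqP h; apply/eqP; rewrite ?E // -E.
Qed.

Lemma rspan_decidable (R : realType) (t : nat) (b : R) (K : {pred R}) (irr : bool) :
  (2 < t)%N -> 1 < b -> b ^+ 2 = t%:R * b - 1 -> (irr -> irrational b) ->
  (forall x, x \in K <-> exists p q : rat, (irr \/ q = 0) /\ x = ratr p + ratr q * b) ->
  decidable_theory K.
Proof.
move=> t2 b1 bE ib HK.
pose pr s : rat := ((entry s 0)%:R - (entry s 1)%:R) / (entry s 4).+1%:R.
pose qr s : rat := ((entry s 2)%:R - (entry s 3)%:R) / (entry s 4).+1%:R.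
have scE s : scalar b s = ratr (pr s) + ratr (qr s) * b.
  rewrite /scalar /pr /qr !(fmorph_div, rmorphB, rmorph_nat) /=.
  have : (entry s 4).+1%:R != 0 :> R by rewrite pnatr_eq0.
  by move: (entry s 4).+1%:R => d d0; field.
have q0 s : entry s 2 = entry s 3 -> qr s = 0.
  by move=> e; rewrite /qr e subrr mul0r.
apply: (quadratic_decidable (irr := irr) t2 b1 bE) => [x|s u as_ au].
  rewrite HK; split=> [[p [q [iq ->]]]|[s [as_ <-]]]; last first.
    exists (pr s), (qr s); split; last exact: scE.
    by case: as_ => [->|/q0 ->]; [left|right].
  have split_int (z : int) : exists a c : nat, z = a%:Z - c%:Z.
    by case: z => n; [exists n, 0%N|exists 0%N, n.+1]; lia.
  have [a [c pE]] := split_int (numq p * denq q).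
  have [a2 [c2 qE]] := split_int (numq q * denq p).
  (* Both coordinates are put over the common denominator; the predecessor is stored because a
     description divides by [(entry s 4).+1]. *)
  pose s := CodeSeq.code [:: a; c; a2; c2; (absz (denq p * denq q)%R).-1].
  have dpq : 0 < denq p * denq q by rewrite mulr_gt0 // denq_gt0.
  have e4 : (entry s 4).+1%:R = (denq p)%:~R * (denq q)%:~R :> rat.
    rewrite /s entry_code [nth _ _ _]/= prednK ?absz_gt0 ?gt_eqF //.
    by rewrite natr_absz gtr0_norm // intrM.
  have dp0 : (denq p)%:~R != 0 :> rat by rewrite intr_eq0 denq_neq0.
  have dq0 : (denq q)%:~R != 0 :> rat by rewrite intr_eq0 denq_neq0.
  exists s; split.
    case: iq => [->|q_0]; [by left|right]; rewrite /s !entry_code [nth _ _ 2]/= [nth _ _ 3]/=.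
    by move: qE; rewrite q_0 (_ : numq 0 = 0) // mul0r; lia.
  rewrite scE; congr (ratr _ + ratr _ * _).
    rewrite /pr e4 -[RHS]divq_num_den /s !entry_code [nth _ _ 0]/= [nth _ _ 1]/=.
    have -> : a%:R - c%:R = (numq p)%:~R * (denq q)%:~R :> rat.
      by rewrite -intrM pE intrB -!pmulrn.
    by field; apply/andP.
  rewrite /qr e4 -[RHS]divq_num_den /s !entry_code [nth _ _ 2]/= [nth _ _ 3]/=.
  have -> : a2%:R - c2%:R = (numq q)%:~R * (denq p)%:~R :> rat.
    by rewrite -intrM qE intrB -!pmulrn.
  by field; apply/andP.
have -> : same_scalar s u <-> pr s = pr u /\ qr s = qr u.
  by rewrite /same_scalar /pr /qr !diff_frac_eq.
rewrite !scE; split=> [E|[-> ->]] //.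
have D : ratr (pr s - pr u) + ratr (qr s - qr u) * b = 0.
  rewrite !rmorphB /=; apply/eqP; move/eqP: E; rewrite -subr_eq0 => /eqP E.
  by rewrite -[X in _ == X]E; apply/eqP; ring.
case: irr ib as_ au {HK} => [/(_ isT) ib _ _|_ [//|/q0 qs] [//|/q0 qu]].
  have [/eqP] := irr_rat0 ib D; rewrite subr_eq0 => /eqP -> /eqP.
  by rewrite subr_eq0 => /eqP ->.
split; last by rewrite qs qu.
move: D; rewrite qs qu subrr rmorph0 mul0r addr0 => /eqP.
by rewrite fmorph_eq0 subr_eq0 => /eqP.
Qed.

(** Numeration needs a base b > 1 with b^2 = t b - 1, and Q contains none. The base (3 + sqrt 5) /
    2, with t = 3, serves although only rational scalars belong to the language. *)
Lemma rat_decidable (R : realType) (K : {pred R}) :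
  (forall x, x \in K <-> exists q, x = ratr q) -> decidable_theory K.
Proof.
move=> HK; pose r : R := Num.sqrt 5%:R.
have rE : r ^+ 2 = 5%:R by rewrite sqr_sqrtr // ler0n.
have r0 : 0 <= r by rewrite sqrtr_ge0.
apply: (@rspan_decidable R 3 ((3%:R + r) / 2%:R) K false) => //.
- by rewrite ltr_pdivlMr ?ltr0n //; lra.
- apply: (mulIf (x := 4%:R)); first by rewrite pnatr_eq0.
  transitivity ((3%:R + r) ^+ 2); first by field.
  transitivity (6%:R * (3%:R + r) - 4%:R); last by field.
  by rewrite sqrrD rE; ring.
move=> x; rewrite HK; split=> [[q ->]|[p [q [[//|->] ->]]]].
  by exists q, 0; split; [right|rewrite rmorph0 mul0r addr0].
by exists p; rewrite rmorph0 mul0r addr0.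
Qed.

(** K is generated by the square root del of a natural number, and a solution of x^2 = Del y^2 + 1
    gives the base b = x + y del, with t = 2x. *)
Lemma irrational_decidable (R : realType) (K : {pred R}) (hK : GRing.divring_closed K) (a : R) :
  irrational a -> (forall x, x \in K <-> rspan a x) -> decidable_theory K.
Proof.
move=> ia HK.
have aK : a \in K by apply/HK; exists 0, 1; rewrite rmorph0 rmorph1 add0r mul1r.
have /HK [u [v aE]] : a * a \in K by apply: divringM.
(* [(2 a - v) ^ 2] is rational; clear its denominator. *)
pose w : rat := v ^+ 2 + 4%:R * u.
have wE : (2%:R * a - ratr v) ^+ 2 = ratr w.
  rewrite /w rmorphD rmorphM rmorphXn rmorph_nat /=.
  transitivity (4%:R * (a * a) - 4%:R * ratr v * a + ratr v ^+ 2); first by ring.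
  by rewrite aE; ring.
pose d : R := (denq w)%:~R.
have d0 : 0 < d by rewrite ltr0z denq_gt0.
pose del := `|d * (2%:R * a - ratr v)|.
have irr2 (p q : rat) : q != 0 -> irrational (ratr p + ratr q * a : R).
  move=> q0 r H; have [|_ /eqP] := @irr_rat0 _ a (p - r) q ia; last by rewrite (negPf q0).
  by rewrite rmorphB /= -H; ring.
have sgnE : exists e : rat, e != 0 /\ del = ratr e * (2%:R * a - ratr v).
  rewrite /del; case: (ger0P (d * (2%:R * a - ratr v))) => _.
    by exists (denq w)%:~R; split; [rewrite intr_eq0 denq_neq0|rewrite rmorph_int].
  exists (- (denq w)%:~R); split; first by rewrite oppr_eq0 intr_eq0 denq_neq0.
  by rewrite rmorphN /= rmorph_int mulNr.
have [e [e0 delE]] := sgnE.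
have delE' : del = ratr (- e * v) + ratr (2%:R * e) * a.
  by rewrite delE rmorphM rmorphN rmorphM rmorph_nat /=; ring.
have idel : irrational del.
  by rewrite delE'; apply: irr2; rewrite mulf_neq0 // pnatr_eq0.
have del0 : 0 < del.
  rewrite lt_def normr_ge0 andbT; apply/eqP => H.
  by apply: (idel 0); rewrite rmorph0.
pose Del := absz (numq w * denq w)%R.
have del2 : del ^+ 2 = Del%:R.
  have E : del ^+ 2 = (numq w * denq w)%:~R.
    rewrite /del real_normK ?num_real // exprMn wE -[in ratr w](divq_num_den w).
    by rewrite fmorph_div !rmorph_int intrM /d; field; rewrite intr_eq0 denq_neq0.
  have : 0 <= (numq w * denq w)%:~R :> R by rewrite -E sqr_ge0.
  by rewrite ler0z => h; rewrite E /Del natr_absz ger0_norm.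
have [x [y [y0 xy]]] := pell del0 del2 idel.
have x2 : (1 < x)%N.
  have : (0 < Del)%N by rewrite -(ltr0n R) -del2 exprn_gt0.
  by nia.
have xyR : x%:R ^+ 2 = del ^+ 2 * y%:R ^+ 2 + 1 :> R.
  by rewrite del2 -!natrX -natrM xy natrD.
have yR : 0 < y%:R :> R by rewrite ltr0n.
pose b := x%:R + y%:R * del.
have bE : b = ratr (x%:R - y%:R * e * v) + ratr (2%:R * y%:R * e) * a.
  by rewrite /b delE' !(rmorphB, rmorphN, rmorphM, rmorph_nat) /=; ring.
have y2e : 2%:R * y%:R * e != 0 by rewrite !mulf_neq0 ?pnatr_eq0 -?lt0n.
have ib : irrational b by rewrite bE; apply: irr2.
apply: (@rspan_decidable R x.*2 b K true) => // [||| z].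
- by lia.
- rewrite /b; have : 1 < x%:R :> R by rewrite ltr1n.
  have : 0 < y%:R * del by rewrite mulr_gt0.
  by lra.
- rewrite /b -muln2 natrM; apply/eqP; rewrite -subr_eq0; apply/eqP.
  transitivity (del ^+ 2 * y%:R ^+ 2 + 1 - x%:R ^+ 2 : R); first by ring.
  by rewrite xyR subrr.
have bK : b \in K by apply/HK; rewrite bE; eexists; eexists.
split=> [/HK [p [q ->]]|[p [q [_ zE]]]]; last by apply: (divring_rspan hK bK); exists p, q.
exists (p - q * (x%:R - y%:R * e * v) / (2%:R * y%:R * e)), (q / (2%:R * y%:R * e)).
split; [by left|rewrite bE].
have y2e' : ratr (2%:R * y%:R * e) != 0 :> R by rewrite fmorph_eq0.
rewrite rmorphB !fmorph_div rmorphM /=.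
by move: (ratr (_ - _)) (ratr (2%:R * _ * _)) y2e' => A B B0; field.
Qed.

(** * Simultaneous approximation *)

Lemma approx_multiple (R : realType) (d z : R) : d != 0 -> 0 <= z / d ->
  exists k : nat, `|k%:R * d - z| < `|d|.
Proof.
move=> d0 /truncn_itv /andP[h1 h2]; exists (Num.truncn (z / d)).
have -> : (Num.truncn (z / d))%:R * d - z = ((Num.truncn (z / d))%:R - z / d) * d by field.
rewrite normrM gtr_pMl ?normr_gt0 // ltr_norml; apply/andP.
by rewrite -natr1 in h2; split; lra.
Qed.

Lemma inv_nat_lt (R : realType) (eps : R) : 0 < eps -> exists2 Q, (0 < Q)%N & Q%:R^-1 < eps.
Proof.
move=> e0; exists (Num.bound eps^-1).+1 => //.
rewrite -[ltRHS]invrK ltf_pV2 ?posrE ?invr_gt0 ?ltr0n //.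
have := archi_boundP (ltW (_ : 0 < eps^-1)); rewrite invr_gt0 => /(_ e0) /lt_le_trans; apply.
by rewrite ler_nat.
Qed.

(** Multiples of a small nonzero d = m x - p form a fine net. Shifting y by an integer J makes (y +
    J) / d nonnegative, so that a natural multiple suffices. *)
Lemma kronecker1 (R : realType) (x y eps : R) : irrational x -> 0 < eps ->
  exists (i : nat) (j : int), `|i%:R * x + j%:~R - y| < eps.
Proof.
move=> ix /inv_nat_lt [Q Q0 Qe]; have [m [p [m0 mp]]] := dirichlet x Q0.
pose d := m%:R * x - p%:~R.
have d0 : d != 0.
  rewrite subr_eq0; apply/eqP => E; have [] := @irrational_int _ x m%:Z p ix E.
  by move=> [mE]; rewrite mE in m0.
have [J HJ] : exists J : int, 0 <= (y + J%:~R) / d.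
  have yb := archi_boundP (normr_ge0 y); have /ler_normlP [y1 y2] := lexx `|y|.
  have [dn|dp|/eqP] := ltgtP d 0; last by rewrite (negPf d0).
    exists (- (Num.bound `|y|)%:Z); rewrite mulr_le0 ?invr_le0 ?(ltW dn) //.
    by rewrite intrN -pmulrn; lra.
  exists (Num.bound `|y|)%:Z; rewrite mulr_ge0 ?invr_ge0 ?(ltW dp) //.
  by rewrite -pmulrn; lra.
have [k Hk] := approx_multiple d0 HJ.
exists (k * m)%N, (- (k%:Z * p) - J); apply: lt_trans (lt_trans mp Qe).
have -> : (k * m)%N%:R * x + (- (k%:Z * p) - J)%:~R - y = k%:R * d - (y + J%:~R).
  by rewrite /d natrM intrB intrN intrM -pmulrn; ring.
exact: Hk.
Qed.

(** Let (s, t) be small with s nonzero, congruent to a multiple of (x, y) modulo integers. Its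
    multiples come near every point of a half-line of slope t/s. At abscissa u + e (B + i) the
    ordinate is that number times t/s; independence makes t/s irrational, so [kronecker1] provides i
    with the ordinate near v modulo 1. *)
Lemma kronecker2 (R : realType) (x y u v eps : R) : rindep x y -> 0 < eps ->
  exists (n : nat) (p q : int), `|n%:R * x - p%:~R - u| < eps /\ `|n%:R * y - q%:~R - v| < eps.
Proof.
move=> xy e0; have ix := rindep_irrational xy.
have /inv_nat_lt [Q Q0 Qe] : 0 < eps / 2 by rewrite divr_gt0.
have QR : 0 < Q%:R :> R by rewrite ltr0n.
have QQ0 : (0 < Q * Q)%N by rewrite muln_gt0 Q0.
(* The first multiplier is accurate to 1/Q^2, so that the second, which is at most Q, keeps the
   error for x below 1/Q. *)
have [m0 [p0 [/andP[m00 _] mp0]]] := dirichlet x QQ0.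
have [m1 [q [/andP[m10 m1Q] mq]]] := dirichlet (m0%:R * y) Q0.
pose m := (m1 * m0)%N; pose p := m1%:Z * p0.
pose s := m%:R * x - p%:~R; pose t := m%:R * y - q%:~R.
have tQ : `|t| < Q%:R^-1 by rewrite /t natrM -mulrA.
have sQ : `|s| < Q%:R^-1.
  have -> : s = m1%:R * (m0%:R * x - p0%:~R) by rewrite /s /p natrM intrM -pmulrn; ring.
  rewrite normrM normr_nat; apply: (@le_lt_trans _ _ (Q%:R * `|m0%:R * x - p0%:~R|)).
    by rewrite ler_wpM2r ?ler_nat.
  by rewrite -ltr_pdivlMl // -invfM -natrM.
have m0' : (0 < m)%N by rewrite muln_gt0 m10.
clearbody m p; have s0 : s != 0.
  rewrite subr_eq0; apply/eqP => E; have [] := @irrational_int _ x m%:Z p ix E.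
  by move=> [mE]; rewrite mE in m0'.
(* A rational value r of t/s would turn t = r s into a relation between 1, x and y. *)
have it : irrational (t / s).
  move=> r E; have tE : t = ratr r * s by rewrite -E divfK.
  have [|_ _ /eqP] := xy (r * p%:~R - q%:~R) (- r * m%:R) m%:R.
    transitivity (t - ratr r * s); last by rewrite tE subrr.
    by rewrite !(rmorphB, rmorphM, rmorphN, rmorph_int, rmorph_nat) /= /t /s; ring.
  by rewrite pnatr_eq0 eqn0Ngt m0'.
have ub := archi_boundP (normr_ge0 u); have /ler_normlP [u1 u2] := lexx `|u|.
set B := Num.bound _ in ub.
(* The sign e and the offset B give all these abscissas the sign of s, so that they are approximated
   by natural multiples. *)
have [e [e1 He]] : exists e : int, (e = 1 \/ e = - 1) /\
    forall i : nat, 0 <= (u + e%:~R * (B%:R + i%:R)) / s.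
  have i0 (i : nat) : 0 <= i%:R :> R by rewrite ler0n.
  have [sn|sp|/eqP] := ltgtP s 0; last by rewrite (negPf s0).
    exists (- 1); split=> [|i]; first by right.
    rewrite mulr_le0 ?invr_le0 ?(ltW sn) // rmorphN rmorph1.
    by have := i0 i; lra.
  exists 1; split=> [|i]; first by left.
  rewrite mulr_ge0 ?invr_ge0 ?(ltW sp) // rmorph1.
  by have := i0 i; lra.
have ie : irrational (e%:~R * (t / s)).
  by case: e1 => ->; rewrite ?rmorphN rmorph1 ?mulN1r ?mul1r // => r E; apply: (it (- r));
    rewrite rmorphN /= -E opprK.
have e20 : 0 < eps / 2 by rewrite divr_gt0.
have [i [j Hij]] := kronecker1 (v - u * (t / s) - e%:~R * B%:R * (t / s)) ie e20.
have [k Hk] := approx_multiple s0 (He i).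
have kE : k%:R * t - (u + e%:~R * (B%:R + i%:R)) * (t / s) =
  (k%:R * s - (u + e%:~R * (B%:R + i%:R))) * (t / s) by field.
have Ht : `|k%:R * t - (u + e%:~R * (B%:R + i%:R)) * (t / s)| < `|t|.
  rewrite kE !normrM normfV mulrCA gtr_pMr ?normr_gt0; last first.
    by apply/eqP => t0; apply: (it 0); rewrite t0 mul0r rmorph0.
  by rewrite ltr_pdivrMr ?normr_gt0 // mul1r.
exists (k * m)%N, (k%:Z * p + e * (B + i)%:Z), (k%:Z * q - j); split.
  have -> : (k * m)%N%:R * x - (k%:Z * p + e * (B + i)%:Z)%:~R - u =
      k%:R * s - (u + e%:~R * (B%:R + i%:R)).
    by rewrite /s natrM intrD !intrM -!pmulrn natrD; ring.
  by apply: lt_trans Hk (lt_trans sQ (lt_trans Qe _)); rewrite ltr_pdivrMr //; lra.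
have -> : (k * m)%N%:R * y - (k%:Z * q - j)%:~R - v =
   (k%:R * t - (u + e%:~R * (B%:R + i%:R)) * (t / s)) +
   (i%:R * (e%:~R * (t / s)) + j%:~R - (v - u * (t / s) - e%:~R * B%:R * (t / s))).
  by rewrite /t natrM intrB !intrM -!pmulrn; ring.
apply: le_lt_trans (ler_normD _ _) _.
by have := lt_trans Ht (lt_trans tQ Qe); lra.
Qed.

(** * Coding finite sets *)

Definition fr (R : realType) (x : R) := x - (Num.floor x)%:~R.

Lemma fr_itv (R : realType) (x : R) : 0 <= fr x /\ fr x < 1.
Proof.
have /andP[h1 h2] := floor_itv x; rewrite /fr subr_ge0 ltrBlDl addrC.
by split=> //; move: h2; rewrite intrD addrC.
Qed.

Lemma fr_eq (R : realType) (x y : R) : 0 <= y -> y < 1 -> x - y \is a Num.int -> fr x = y.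
Proof.
move=> y0 y1 /intrP [z E]; have xE : x = y + z%:~R by rewrite -E addrC subrK.
have fz : Num.floor x = z.
  by apply/eqP; rewrite floor_eq xE intrD; apply/andP; split; [lra|lra].
by rewrite /fr fz xE addrK.
Qed.

Lemma fr_int (R : realType) (x : R) : x - fr x \is a Num.int.
Proof. by rewrite /fr subKr intr_int. Qed.

Lemma fr_inj (R : realType) (x : R) : irrational x -> injective (fun n : nat => fr (n%:R * x)).
Proof.
move=> ix n m E; have : (n%:Z - m%:Z)%:~R * x =
    (Num.floor (n%:R * x) - Num.floor (m%:R * x))%:~R.
  move: E => /eqP; rewrite /fr -subr_eq0 => /eqP E; apply/eqP; rewrite -subr_eq0 -E.
  by rewrite !intrB -!pmulrn; apply/eqP; ring.
by case/(irrational_int ix); lia.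
Qed.

Lemma fr_dense (R : realType) (x y u u' v v' : R) : rindep x y ->
  0 <= u -> u < u' -> u' <= 1 -> 0 <= v -> v < v' -> v' <= 1 ->
  exists n : nat, (u < fr (n%:R * x) /\ fr (n%:R * x) < u') /\
    (v < fr (n%:R * y) /\ fr (n%:R * y) < v').
Proof.
move=> xy u0 uu u1 v0 vv v1.
pose eps := Num.min ((u' - u) / 2) ((v' - v) / 2).
have e1 : eps <= (u' - u) / 2 by rewrite /eps ge_min lexx.
have e2 : eps <= (v' - v) / 2 by rewrite /eps ge_min lexx orbT.
have e0 : 0 < eps by rewrite /eps lt_min; apply/andP; split; lra.
have [n [p [q [/ltr_normlP [h1 h2] /ltr_normlP [h3 h4]]]]] :=
  kronecker2 ((u + u') / 2) ((v + v') / 2) xy e0.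
exists n; rewrite (@fr_eq _ _ (n%:R * x - p%:~R)) ?(@fr_eq _ _ (n%:R * y - q%:~R)) //;
  rewrite ?subKr ?intr_int //; try lra.
Qed.

Section Coding.
Variables (R : realType) (a b : nat -> R).

(** A horizon L up to which every interval between two values [a m], [a m'] with indices at most M
    has been visited with [b n] in the window of each e <= N. *)
Definition suff (d N : R) M L := forall m m' e, (m <= M)%N -> (m' <= M)%N -> e%:R <= N ->
  a m < a m' -> exists n, (n <= L)%N /\ ((a m < a n /\ a n < a m') /\
    (b e < b n /\ b n < b e + d)).

(** k is coded when its window contains [b M] for an index M whose [a M] is the closest to [c] from
    below, and remains so up to a sufficient horizon. The parameter [u] cuts off records beyond the
    last intended one, and [d] is the width of the windows. *)
Definition coded (c u d N : R) k := k%:R <= N /\ exists M, (0 < M)%N /\ (a M <= u /\ (a M < c /\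
  ((exists L, (M <= L)%N /\ (suff d N M L /\
     forall n, (n <= L)%N -> ~ (a M < a n /\ a n < c))) /\
   (b k < b M /\ b M < b k + d)))).

Hypotheses (a_inj : injective a) (a0 : a 0%N = 0) (a_itv : forall n, 0 <= a n /\ a n < 1)
  (b_inj : injective b) (b_itv : forall n, 0 <= b n /\ b n < 1)
  (dense : forall u u' v v', 0 <= u -> u < u' -> u' <= 1 -> 0 <= v -> v < v' -> v' <= 1 ->
     exists n, (u < a n /\ a n < u') /\ (v < b n /\ b n < v')).

Lemma suff_ex (d : R) (N : nat) M : 0 < d -> (forall k, (k <= N)%N -> b k + d <= 1) ->
  exists L, (M <= L)%N /\ suff d N%:R M L.
Proof.
move=> d0 bd.
have bound (P : nat -> nat -> Prop) n : (forall i, exists k, P i k) ->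
    exists L, forall i, (i < n)%N -> exists k, (k <= L)%N /\ P i k.
  move=> H; elim: n => [|n [L HL]]; first by exists 0%N.
  have [k Pk] := H n; exists (maxn L k) => i; rewrite ltnS leq_eqVlt => /orP[/eqP ->|/HL].
    by exists k; rewrite leq_maxr.
  by case=> j [jL Pj]; exists j; rewrite leq_max jL.
have [L1 H1] : exists L, forall m, (m < M.+1)%N -> exists L', (L' <= L)%N /\
    (forall m', (m' < M.+1)%N -> exists L'', (L'' <= L')%N /\
     (forall e, (e < N.+1)%N -> exists n, (n <= L'')%N /\ (a m < a m' -> (a m < a n /\ a n < a m') /\
      (b e < b n /\ b n < b e + d)))).
  apply: (bound) => m; apply: (bound) => m'.
  have [|L HL] := bound (fun e n => (e < N.+1)%N -> a m < a m' -> (a m < a n /\ a n < a m') /\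
      (b e < b n /\ b n < b e + d)) N.+1.
    move=> e; have [amm|] := ltP (a m) (a m'); last by exists 0%N.
    have [|] := leqP e N; last by exists 0%N; lia.
    move=> eN; have [||||||n Hn] := @dense (a m) (a m') (b e) (b e + d).
    - by case: (a_itv m).
    - by [].
    - by case: (a_itv m') => _ /ltW.
    - by case: (b_itv e).
    - by rewrite ltrDl.
    - exact: bd.
    by exists n.
  by exists L => e eN; have [n [nL Hn]] := HL e eN; exists n; split=> // /Hn; apply.
exists (maxn M L1); split; first exact: leq_maxl.
move=> m m' e; rewrite -ltnS => mM; rewrite -ltnS => m'M; rewrite ler_nat -ltnS => eN amm.
have [L2 [l2 H2]] := H1 m mM; have [L3 [l3 H3]] := H2 m' m'M; have [n [nL Hn]] := H3 e eN.
exists n; split; last exact: Hn.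
by rewrite leq_max (leq_trans nL (leq_trans l3 l2)) orbT.
Qed.

Lemma gap_ex (x y : R) L : x < y -> exists z, x < z /\ z <= y /\
  forall n, (n <= L)%N -> ~ (x < a n /\ a n < z).
Proof.
move=> xy; have [z [xz [zy H]]] : exists z, x < z /\ z <= y /\
  forall n, (n < L.+1)%N -> ~ (x < a n /\ a n < z); last by exists z.
elim: L.+1 => [|n [z [xz [zy H]]]]; first by exists y.
have [xa|ax] := ltP x (a n).
  exists (Num.min z (a n)); rewrite lt_min xz xa ge_min zy; split=> //; split=> // k.
  rewrite ltnS leq_eqVlt => /orP[/eqP -> [_]|kn [h1]]; rewrite lt_min ?ltxx ?andbF //.
  by case/andP => h2 _; apply: (H k).
exists z; split=> //; split=> // k.
by rewrite ltnS leq_eqVlt => /orP[/eqP -> []|/H //]; rewrite ltNge ax.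
Qed.

(** Induction on the list: [M] is the last record, and every [c] in the gap between [a M] and [y]
    codes the list. A new element is appended by a later record placed inside this gap, which leaves
    the earlier records valid. *)
Lemma coded_list (d : R) (N : nat) (s : seq nat) : 0 < d -> (forall k, (k <= N)%N -> b k + d <= 1) ->
  (forall k l, (k <= N)%N -> (l <= N)%N -> b k < b l -> b k + d <= b l) ->
  (forall k, k \in s -> (k <= N)%N) ->
  exists M L y, [/\ (M <= L)%N /\ suff d N%:R M L, a M < y, y <= 1,
    (forall n, (n <= L)%N -> ~ (a M < a n /\ a n < y))
  & forall c k, a M < c -> c < y -> coded c (a M) d N%:R k <-> k \in s].
Proof.
move=> d0 bd sep; elim: s => [_|e s IH sN].
  have [L [_ sL]] := suff_ex 0 d0 bd.
  exists 0%N, 0%N, 1; split=> //; rewrite ?a0 ?ltr01 //.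
  - by split=> // m m' k; rewrite !leqn0 => /eqP -> /eqP ->; rewrite ltxx.
  - by move=> n; rewrite leqn0 => /eqP ->; rewrite a0 ltxx; case.
  (* Index 0 starts the construction with a 0 = 0 and codes nothing, since [coded] asks for a
     positive record. *)
  - move=> c k c0 c1; split=> // -[_ [M [M0 [aM _]]]]; move: M0.
    have := (a_itv M).1; rewrite le_eqVlt => /orP[/eqP E|]; last by rewrite ltNge aM.
    by rewrite (a_inj (_ : a M = a 0%N)) // a0.
have [|M [L [y [[ML sML] aMy y1 My HM]]]] := IH.
  by move=> k ks; apply: sN; rewrite inE ks orbT.
have eN : (e <= N)%N by apply: sN; rewrite mem_head.
(* [n0] is the first index to enter the gap, so it exceeds [L]. The new record [M1] is the first
   index with [a] between [a M] and [a n0] and with [b] in the window of [e]. *)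
have ex0 : exists n, (a M < a n) && (a n < y).
  have [||||||n [[h1 h2] _]] := @dense (a M) y (b e) (b e + d) => //.
  - by case: (a_itv M).
  - by case: (b_itv e).
  - by rewrite ltrDl.
  - exact: bd.
  by exists n; rewrite h1.
case: (ex_minnP ex0) => n0 /andP[Mn0 n0y] n0min.
have Ln0 : (L < n0)%N by rewrite ltnNge; apply/negP => /My; apply.
have ex1 : exists n, [&& a M < a n, a n < a n0, b e < b n & b n < b e + d].
  have [||||||n [[h1 h2] [h3 h4]]] := @dense (a M) (a n0) (b e) (b e + d) => //.
  - by case: (a_itv M).
  - by case: (a_itv n0) => _ /ltW.
  - by case: (b_itv e).
  - by rewrite ltrDl.
  - exact: bd.
  by exists n; rewrite h1 h2 h3.
case: (ex_minnP ex1) => M1 /and4P[MM1 M1n0 eM1 M1e] M1min.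
have n0M1 : (n0 < M1)%N.
  rewrite ltn_neqAle n0min ?MM1 ?(lt_trans M1n0) // andbT; apply/eqP => E.
  by move: M1n0; rewrite E ltxx.
have [L1 [ML1 sL1]] := suff_ex M1 d0 bd.
have [y1' [My1 [y1n0 Hy1]]] := gap_ex L1 M1n0.
exists M1, L1, y1'; split=> //.
  by apply: le_trans y1n0 _; case: (a_itv n0) => _ /ltW.
move=> c k M1c cy1; have cn0 : c < a n0 by apply: lt_le_trans cy1 _.
have {}HM := HM c k (lt_trans MM1 M1c) (lt_trans cn0 n0y).
rewrite inE; split.
  case=> kN [M' [M'0 [M'M1 [M'c [[L' [ML' [sL' HL']]] [kM' M'k]]]]]].
  have [M'M|MM'] := leP (a M') (a M).
    apply/orP; right; apply/HM; split=> //; exists M'; do 4!split=> //.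
    by exists L'.
  move: M'M1; rewrite le_eqVlt => /orP[/eqP /a_inj E|M'M1].
    rewrite E in kM' M'k; rewrite ler_nat in kN.
    have [ke|ek|/b_inj ->] := ltgtP (b k) (b e); last by rewrite eqxx.
      by have := sep _ _ kN eN ke; lra.
    by have := sep _ _ eN kN ek; lra.
  (* A spurious record M' between the two satisfies n0 <= M', and its horizon ends before M1. By
     sufficiency some n <= L' lies where M1 was chosen as the first index, a contradiction. *)
  exfalso.
  have L'M1 : (L' < M1)%N by rewrite ltnNge; apply/negP => /HL'; apply.
  have n0M' : (n0 <= M')%N.
    by apply: n0min; rewrite MM' (lt_trans M'c) // (lt_trans cn0).
  have [||n [nL' [[h1 h2] [h3 h4]]]] := sL' M n0 e _ n0M' _ Mn0.
  - by rewrite (leq_trans ML) // (leq_trans (ltnW Ln0)).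
  - by rewrite ler_nat.
  have /M1min : [&& a M < a n, a n < a n0, b e < b n & b n < b e + d] by rewrite h1 h2 h3.
  by move=> h; rewrite leqNgt (leq_ltn_trans nL' L'M1) in h.
case/orP => [/eqP ->|/HM [kN [M' [M'0 [M'M H]]]]]; last first.
  by split=> //; exists M'; do 2!split=> //; first by rewrite (le_trans M'M) // ltW.
split; first by rewrite ler_nat.
exists M1; split; first by apply: leq_trans n0M1.
do 3!split=> //; exists L1; do 2!split=> //.
by move=> n /Hy1 H [h1 h2]; apply: H; split=> //; apply: lt_trans cy1.
Qed.

(** The width d is taken so small that the windows of the numbers up to N are disjoint and stay
    inside the unit interval. *)
Lemma coded_exists (s : seq nat) : exists c u d B, forall k, coded c u d B k <-> k \in s.
Proof.
pose N := (\max_(k <- s) k)%N.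
have sN k : k \in s -> (k <= N)%N by move=> ks; apply: leq_bigmax_seq.
pose small d := [/\ 0 < d, forall k, (k <= N)%N -> b k + d <= 1 &
  forall k l, (k <= N)%N -> (l <= N)%N -> b k < b l -> b k + d <= b l].
have [d [d0 d1 d2]] : exists d, small d.
  have posmin (F : nat -> R) n : (forall k, 0 < F k) ->
      exists d, 0 < d /\ forall k, (k < n)%N -> d <= F k.
    move=> F0; elim: n => [|n [d [d0 H]]]; first by exists 1.
    exists (Num.min d (F n)); rewrite lt_min d0 F0; split=> // k.
    by rewrite ltnS ge_min leq_eqVlt => /orP[/eqP -> |/H ->//]; rewrite lexx orbT.
  have [d1 [d10 H1]] := posmin (fun k => 1 - b k) N.+1
    (fun k => ltac:(by rewrite subr_gt0; case: (b_itv k))).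
  pose F k l := if b k < b l then b l - b k else 1.
  have F0 k l : 0 < F k l by rewrite /F; case: ifP; rewrite ?subr_gt0 ?ltr01.
  have /choice [G HG] k : exists d, 0 < d /\ forall l, (l < N.+1)%N -> d <= F k l.
    exact: posmin.
  have [d2 [d20 H2]] := posmin G N.+1 (fun k => (HG k).1).
  exists (Num.min d1 d2); split; first by rewrite lt_min d10.
    by move=> k kN; have := H1 k kN; rewrite -lerBrDl => h; rewrite ge_min h.
  move=> k l kN lN kl; rewrite -lerBrDl ge_min; apply/orP; right.
  by apply: le_trans (H2 k kN) _; have := (HG k).2 l lN; rewrite /F kl.
have [M [L [y [_ My _ _ H]]]] := coded_list d0 d1 d2 sN.
exists ((a M + y) / 2), (a M), d, N%:R => k; apply: H; lra.
Qed.

Lemma coded_finite (c u d N : R) : exists s : seq nat, forall k, coded c u d N k <-> k \in s.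
Proof.
exists [seq k <- iota 0 (Num.bound `|N|).+1 | `[< coded c u d N k >]] => k.
rewrite mem_filter mem_iota add0n /=; split=> [H|/andP[/asboolP]] //.
apply/andP; split; first exact/asboolP.
rewrite ltnS -(ler_nat R); apply: le_trans H.1 (le_trans (ler_norm _) (ltW (archi_boundP _))).
exact: normr_ge0.
Qed.

End Coding.

(** * Definability *)

Section Definability.
Variables (R : realType) (K : {pred R}) (hK : GRing.divring_closed K).

Local Notation S := {x : R | x \in K}.

Definition scal x (xK : x \in K) : S := exist (fun x => x \in K) x xK.

(* A context describes the meaning of the variables below [ctx_size]: values *)
(* of sort [ctx_val] correspond to assignments through [ctx_rel].            *)
Record context := Context {
  ctx_val :> Type;
  ctx_size : nat;
  ctx_rel : (nat -> R) -> ctx_val -> Prop;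
  ctx_one : forall e x, ctx_rel e x -> e 0%N = 1;
  ctx_pos : (0 < ctx_size)%N;
  ctx_ext : forall e e' x, (forall k, (k < ctx_size)%N -> e k = e' k) ->
    ctx_rel e x -> ctx_rel e' x }.

Definition ctx1 : context := @Context unit 1 (fun e _ => e 0%N = 1) (fun _ _ h => h) isT
  (fun e e' _ ee h => etrans (esym (ee 0%N isT)) h).

Lemma extend_ext (C : context) T (emb : T -> R) (e e' : nat -> R) (x : C * T) :
  (forall k, (k < (ctx_size C).+1)%N -> e k = e' k) ->
  ctx_rel e x.1 /\ e (ctx_size C) = emb x.2 -> ctx_rel e' x.1 /\ e' (ctx_size C) = emb x.2.
Proof.
move=> ee [h1 h2]; split; last by rewrite -ee.
by apply: ctx_ext h1 => k kC; rewrite ee // ltnS ltnW.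
Qed.

Definition extend (C : context) (T : Type) (emb : T -> R) : context :=
  @Context (C * T) (ctx_size C).+1
    (fun e x => ctx_rel e x.1 /\ e (ctx_size C) = emb x.2)
    (fun e x h => ctx_one h.1) isT (@extend_ext C T emb).

Definition ctxR C := extend C (fun x : R => x).
Definition ctxN C := extend C (fun n : nat => n%:R).

(** Definability is a property of the predicate: some formula agrees with it under all related
    assignments. Connectives, quantifiers and substitution become closure lemmas, so that formulas
    need not be written out. *)
Definition df (C : context) (P : C -> Prop) :=
  exists p : formula S, forall e x, ctx_rel e x -> sat sval e p <-> P x.

Definition refines (C' C : context) (pi : C' -> C) :=
  forall e x, ctx_rel e x -> ctx_rel e (pi x).

(* The graph has to be definable over every extension of [C], because the    *)
(* variable holding the value need not come right after those of [C].        *)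
Record fd (C : context) (f : C -> R) : Prop := Fd {
  fdP : forall (C' : context) (pi : C' -> C), refines pi ->
    @df (ctxR C') (fun x => x.2 = f (pi x.1)) }.

Definition fn (C : context) (f : C -> nat) := fd (fun x => (f x)%:R).

Lemma refines_id (C : context) : @refines C C (fun x => x). Proof. by []. Qed.
Lemma refines_fst (C : context) T (emb : T -> R) : @refines (extend C emb) C (fun x => x.1).
Proof. by move=> e x []. Qed.
Lemma refines_comp (C C' C'' : context) (f : C' -> C) (g : C'' -> C') : refines f -> refines g -> refines (fun x => f (g x)).
Proof. by move=> sf sg e x /sg /sf. Qed.

Lemma df_ext (C : context) (P Q : C -> Prop) : (forall x, P x <-> Q x) -> df P -> df Q.
Proof. by move=> PQ [p Hp]; exists p => e x /Hp ->. Qed.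

Lemma fd_ext (C : context) (f g : C -> R) : f =1 g -> fd f -> fd g.
Proof. by move=> fg hf; split=> C' pi s; apply: df_ext (fdP hf s) => x; rewrite fg. Qed.

Lemma fd_pull (C C' : context) (pi : C' -> C) (f : C -> R) : refines pi -> fd f -> fd (fun x => f (pi x)).
Proof. by move=> s hf; split=> C'' rho t; apply: (fdP hf (pi := fun x => pi (rho x))); apply: refines_comp. Qed.

Lemma fd_wk (C : context) T (emb : T -> R) (f : C -> R) : fd f -> @fd (extend C emb) (fun x => f x.1).
Proof. exact/fd_pull/refines_fst. Qed.

Lemma df_not (C : context) (P : C -> Prop) : df P -> df (fun x => ~ P x).
Proof. by case=> p Hp; exists (Fnot p) => e x /Hp /= ->. Qed.

Lemma df_and (C : context) (P Q : C -> Prop) : df P -> df Q -> df (fun x => P x /\ Q x).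
Proof. by move=> [p Hp] [q Hq]; exists (Fand p q) => e x ex /=; rewrite (Hp e x ex) (Hq e x ex). Qed.

Lemma df_or (C : context) (P Q : C -> Prop) : df P -> df Q -> df (fun x => P x \/ Q x).
Proof.
move=> dP dQ; apply: df_ext (df_not (df_and (df_not dP) (df_not dQ))) => x.
by split=> [|[]]; tauto || (move=> h; apply: contrapT; tauto).
Qed.

Lemma df_imp (C : context) (P Q : C -> Prop) : df P -> df Q -> df (fun x => P x -> Q x).
Proof.
move=> dP dQ; apply: df_ext (df_not (df_and dP (df_not dQ))) => x.
by split=> [h p|]; [apply: contrapT; tauto|tauto].
Qed.

Lemma df_iff (C : context) (P Q : C -> Prop) : df P -> df Q -> df (fun x => P x <-> Q x).
Proof. by move=> dP dQ; apply: df_and; apply: df_imp. Qed.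

Lemma df_exR (C : context) (P : C -> R -> Prop) : @df (ctxR C) (fun x => P x.1 x.2) ->
  df (fun x => exists r, P x r).
Proof.
case=> p Hp; exists (Fex (ctx_size C) p) => e x ex /=.
suff H r : sat sval [eta e with ctx_size C |-> r] p <-> P x r.
  by split=> -[r /H]; exists r.
apply: (Hp _ (x, r)); split; last by rewrite /= eqxx.
by apply: ctx_ext ex => k kC /=; rewrite ltn_eqF.
Qed.

(** The naturals are the integers not below zero; zero is written as the scalar 0 applied to a
    variable, as there are no constants. *)
Lemma df_nat (C : context) (P : C -> nat -> Prop) : @df (ctxN C) (fun x => P x.1 x.2) ->
  @df (ctxR C) (fun x => exists n : nat, x.2 = n%:R /\ P x.1 n).
Proof.
case=> p Hp; pose v : term S := Tvar _ (ctx_size C).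
exists (Fand (Fand (Fint v) (Fnot (Flt v (Tscale (scal (divring0 hK)) v)))) p).
move=> e [x r] [/= ex er]; rewrite er mul0r.
split=> [[[/intrP [z zE] /negP lt0] sp]|[n [nE Pn]]].
  have z0 : 0 <= z by rewrite -(ler0z R) -zE leNgt.
  have {}zE : r = (absz z)%:R by rewrite natr_absz ger0_norm.
  by exists (absz z); split=> //; apply/(Hp e (x, absz z)) => //; split=> //; rewrite er zE.
split; last by apply/(Hp e (x, n)) => //; split=> //; rewrite er.
by split; [rewrite nE natr_int|apply/negP; rewrite -leNgt nE ler0n].
Qed.

Lemma df_exN (C : context) (P : C -> nat -> Prop) : @df (ctxN C) (fun x => P x.1 x.2) ->
  df (fun x => exists n, P x n).
Proof.
move/df_nat => dP; apply: df_ext (df_exR (P := fun x r => exists n : nat, r = n%:R /\ P x n) dP) => x.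
by split=> [[r [n [_ Pn]]]|[n Pn]]; [exists n|exists n%:R, n].
Qed.

Lemma df_allN (C : context) (P : C -> nat -> Prop) : @df (ctxN C) (fun x => P x.1 x.2) ->
  df (fun x => forall n, P x n).
Proof.
move=> dP; apply: df_ext (df_not (df_exN (P := fun x r => ~ P x r) (df_not dP))) => x.
by split=> [h r|h [r]]; [apply: contrapT => Pr; apply: h; exists r|apply].
Qed.

(** The value of the function is held by a new existentially quantified variable. *)
Lemma df_letR (C : context) (f : C -> R) (P : C -> R -> Prop) : fd f -> @df (ctxR C) (fun x => P x.1 x.2) ->
  df (fun x => P x (f x)).
Proof.
move=> hf dP; apply: df_ext (df_exR (P := fun x r => r = f x /\ P x r) (df_and (fdP hf (@refines_id C)) dP)) => x /=.
by split=> [[r [->]]|]; [|exists (f x)].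
Qed.

Lemma fd_varR (C : context) : @fd (ctxR C) (fun x => x.2).
Proof.
split=> C' pi s; exists (Feq (Tvar _ (ctx_size C')) (Tvar _ (ctx_size C))) => e [x r] [/= ex ->].
by have [_ ->] := s e x ex.
Qed.

Lemma fn_var (C : context) : @fn (ctxN C) (fun x => x.2).
Proof.
split=> C' pi s; exists (Feq (Tvar _ (ctx_size C')) (Tvar _ (ctx_size C))) => e [x r] [/= ex ->].
by have [_ ->] := s e x ex.
Qed.

Lemma fd_one (C : context) : fd (fun _ : C => 1).
Proof.
split=> C' pi s; exists (Feq (Tvar _ (ctx_size C')) (Tvar _ 0)) => e [x r] [/= ex ->].
by rewrite (ctx_one ex).
Qed.

Lemma df_lt (C : context) (f g : C -> R) : fd f -> fd g -> df (fun x => f x < g x).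
Proof.
move=> hf hg; apply: (df_letR (P := fun x r => r < g x) hf).
apply: (@df_letR (ctxR C) (fun x => g x.1) (fun x r => x.2 < r)); first exact (fd_wk _ hg).
exists (Flt (Tvar _ (ctx_size C)) (Tvar _ (ctx_size C).+1)).
by move=> e [[x r] r'] [[/= _ ->] ->].
Qed.

Lemma df_eq (C : context) (f g : C -> R) : fd f -> fd g -> df (fun x => f x = g x).
Proof.
move=> hf hg; apply: (df_letR (P := fun x r => r = g x) hf).
exact: (fdP hg (@refines_id C)).
Qed.

Lemma df_int (C : context) (f : C -> R) : fd f -> df (fun x => f x \is a Num.int).
Proof.
move=> hf; apply: (df_letR (P := fun x r => r \is a Num.int) hf).
by exists (Fint (Tvar _ (ctx_size C))) => e [x r] [/= _ ->].
Qed.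

Lemma fd_add (C : context) (f g : C -> R) : fd f -> fd g -> fd (fun x => f x + g x).
Proof.
move=> hf hg; split=> C' pi s; have {}hf := fd_pull s hf; have {}hg := fd_pull s hg.
apply: (@df_letR (ctxR C') (fun x => f (pi x.1)) (fun x r => x.2 = r + g (pi x.1))).
  exact (fd_wk _ hf).
apply: (@df_letR (ctxR (ctxR C')) (fun x => g (pi x.1.1)) (fun x r => x.1.2 = x.2 + r)).
  exact (fd_wk _ (fd_wk _ hg)).
exists (Feq (Tvar _ (ctx_size C')) (Tadd (Tvar _ (ctx_size C').+1) (Tvar _ (ctx_size C').+2))).
by move=> e [[[x r] r'] r2] [[[/= _ ->] ->] ->].
Qed.

Lemma fd_scale (C : context) (f : C -> R) s : s \in K -> fd f -> fd (fun x => s * f x).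
Proof.
move=> sK hf; split=> C' pi sp; have {}hf := fd_pull sp hf.
apply: (@df_letR (ctxR C') (fun x => f (pi x.1)) (fun x r => x.2 = s * r)).
  exact (fd_wk _ hf).
exists (Feq (Tvar _ (ctx_size C')) (Tscale (scal sK) (Tvar _ (ctx_size C').+1))).
by move=> e [[x r] r'] [[/= _ ->] ->].
Qed.

Lemma fn_graph (C : context) (f : C -> nat) :
  (forall (C' : context) (pi : C' -> C), refines pi -> @df (ctxN C') (fun x => x.2 = f (pi x.1))) ->
  fn f.
Proof.
move=> H; split=> C' pi s; apply: df_ext (df_nat (P := fun x n => n = f (pi x)) (H C' pi s)) => -[x r] /=.
by split=> [[n [-> ->]]|->] //; exists (f (pi x)).
Qed.

Lemma fd_opp (C : context) (f : C -> R) : fd f -> fd (fun x => - f x).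
Proof.
move=> hf; apply: fd_ext (fd_scale (divringB hK (divring0 hK) (divring1 hK)) hf) => x.
by rewrite sub0r mulN1r.
Qed.

(** The fractional part is the only number in [0, 1) that differs from the argument by an
    integer. *)
Lemma fd_fr (C : context) (f : C -> R) : fd f -> fd (fun x => fr (f x)).
Proof.
move=> hf; split=> C' pi s; have {}hf := fd_wk (fun r : R => r) (fd_pull s hf).
have h2 := @fd_varR C'; have h0 : fd (fun _ : ctxR C' => 0).
  by apply: fd_ext (fd_scale (divring0 hK) (fd_one _)) => x; rewrite mul0r.
apply: df_ext (df_and (df_not (df_lt h2 h0)) (df_and (df_lt h2 (fd_one _))
  (df_int (fd_add hf (fd_opp h2))))) => -[x r] /=.
split=> [[/negP]|->]; first by rewrite -leNgt => r0 [r1 H]; rewrite (fr_eq r0 r1 H).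
have [h3 h4] := fr_itv (f (pi x)); split; last by split; [|apply: fr_int].
by apply/negP; rewrite -leNgt.
Qed.

Lemma fn_const (C : context) n : fn (fun _ : C => n).
Proof.
by rewrite /fn; apply: fd_ext (fd_scale (divring_nat hK n) (fd_one _)) => x; rewrite mulr1.
Qed.

Lemma fn_add (C : context) (f g : C -> nat) : fn f -> fn g -> fn (fun x => f x + g x)%N.
Proof. by move=> hf hg; apply: fd_ext (fd_add hf hg) => x; rewrite natrD. Qed.

Lemma fn_succ (C : context) (f : C -> nat) : fn f -> fn (fun x => (f x).+1).
Proof. by move=> hf; apply: fd_ext (fd_add hf (fd_one _)) => x; rewrite natr1. Qed.

Lemma df_ltn (C : context) (f g : C -> nat) : fn f -> fn g -> df (fun x => (f x < g x)%N).
Proof. by move=> hf hg; apply: df_ext (df_lt hf hg) => x; rewrite ltr_nat. Qed.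

Lemma df_leqn (C : context) (f g : C -> nat) : fn f -> fn g -> df (fun x => (f x <= g x)%N).
Proof. by move=> hf hg; apply: df_ext (df_ltn hf (fn_succ hg)) => x; rewrite ltnS. Qed.

Lemma df_eqn (C : context) (f g : C -> nat) : fn f -> fn g -> df (fun x => f x = g x).
Proof.
move=> hf hg; apply: df_ext (df_eq hf hg) => x.
by split=> [/eqP|->] //; rewrite eqr_nat => /eqP.
Qed.

Lemma df_le (C : context) (f g : C -> R) : fd f -> fd g -> df (fun x => f x <= g x).
Proof.
move=> hf hg; apply: df_ext (df_not (df_lt hg hf)) => x.
by rewrite leNgt; split=> /negP.
Qed.

Variables (al be : R) (alK : al \in K) (beK : be \in K) (ab : rindep al be).

Lemma fd_a (C : context) (f : C -> nat) : fn f -> fd (fun x => fr ((f x)%:R * al)).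
Proof.
by move=> hf; apply: fd_fr; apply: fd_ext (fd_scale alK hf) => x; rewrite mulrC.
Qed.
Lemma fd_b (C : context) (f : C -> nat) : fn f -> fd (fun x => fr ((f x)%:R * be)).
Proof.
by move=> hf; apply: fd_fr; apply: fd_ext (fd_scale beK hf) => x; rewrite mulrC.
Qed.

End Definability.

(** * Definability of recursive functions *)

Section Arithmetic.
Variables (R : realType) (K : {pred R}) (hK : GRing.divring_closed K).
Variables (al be : R) (alK : al \in K) (beK : be \in K) (ab : rindep al be).

Local Notation df := (@df R K _).
Local Notation fd := (@fd R K _).
Local Notation fn := (@fn R K _).

Ltac fd_weak H := first
  [ exact H
  | exact (fd_wk _ H)
  | exact (fd_wk _ (fd_wk _ H))
  | exact (fd_wk _ (fd_wk _ (fd_wk _ H)))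
  | exact (fd_wk _ (fd_wk _ (fd_wk _ (fd_wk _ H))))
  | exact (fd_wk _ (fd_wk _ (fd_wk _ (fd_wk _ (fd_wk _ H)))))
  | exact (fd_wk _ (fd_wk _ (fd_wk _ (fd_wk _ (fd_wk _ (fd_wk _ H))))))
  | exact (fd_wk _ (fd_wk _ (fd_wk _ (fd_wk _ (fd_wk _ (fd_wk _ (fd_wk _ H)))))))
  | exact (fd_wk _ (fd_wk _ (fd_wk _ (fd_wk _ (fd_wk _ (fd_wk _ (fd_wk _ (fd_wk _ H))))))))
  | exact (fd_wk _ (fd_wk _ (fd_wk _ (fd_wk _ (fd_wk _ (fd_wk _ (fd_wk _ (fd_wk _ (fd_wk _ H)))))))))
  | exact (fd_wk _ (fd_wk _ (fd_wk _ (fd_wk _ (fd_wk _ (fd_wk _ (fd_wk _ (fd_wk _ (fd_wk _ (fd_wk _ H)))))))))) ].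

Ltac fd_leaf := first
  [ fd_weak uconstr:(fn_var _ _) | fd_weak uconstr:(fd_varR _ _)
  | match goal with H : fd _ |- _ => fd_weak H end
  | match goal with H : fn _ |- _ => fd_weak H end
  | exact (fn_const hK _ _) ].

Ltac fd_extra := fail.

Ltac fd_auto := cbv beta; first
  [ match goal with
    | |- fn (fun x => (_ + _)%N) => apply: fn_add; fd_auto
    | |- fn (fun x => _.+1) => apply: fn_succ; fd_auto
    | |- fd (fun x => _ + _) => apply: fd_add; fd_auto
    | |- fd (fun x => fr (_ * al)) => apply: (fd_a hK alK); fd_auto
    | |- fd (fun x => fr (_ * be)) => apply: (fd_b hK beK); fd_auto
    end
  | fd_extra; fd_auto
  | fd_leaf ].

Ltac df_extra := fail.

Ltac df_auto := cbv beta; lazymatch goal with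
  | |- df (fun x => _ /\ _) => apply: df_and; df_auto
  | |- df (fun x => _ \/ _) => apply: df_or; df_auto
  | |- df (fun x => _ <-> _) => apply: df_iff; df_auto
  | |- df (fun x => ~ _) => apply: df_not; df_auto
  | |- df (fun x => exists n : nat, _) => apply: (df_exN hK); df_auto
  | |- df (fun x => forall n : nat, _) => apply: (df_allN hK); df_auto
  | |- df (fun x => _ -> _) => apply: df_imp; df_auto
  | |- df (fun x => is_true (_ < _)%N) => apply: df_ltn; fd_auto
  | |- df (fun x => is_true (_ <= _)%N) => apply: df_leqn; fd_auto
  | |- df (fun x => is_true (_ < _)) => apply: df_lt; fd_auto
  | |- df (fun x => is_true (_ <= _)) => apply: df_le; fd_auto
  | |- df (fun x => @eq nat _ _) => apply: df_eqn; fd_auto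
  | |- df (fun x => @eq R _ _) => apply: df_eq; fd_auto
  | _ => df_extra
  end.

Local Notation code := (coded (fun n : nat => fr (n%:R * al)) (fun n => fr (n%:R * be))).

Lemma df_coded (C : context R) (c u d N : C -> R) (f : C -> nat) :
  fd c -> fd u -> fd d -> fd N -> fn f -> df (fun x => code (c x) (u x) (d x) (N x) (f x)).
Proof. by move=> hc hu hd hN hf; rewrite /coded /suff; df_auto. Qed.

Lemma code_exists (s : seq nat) : exists c u d B, forall k, code c u d B k <-> k \in s.
Proof.
have ba : rindep be al.
  move=> p q r; rewrite addrAC => /ab [-> -> ->] //.
apply: coded_exists.
- exact/fr_inj/rindep_irrational/ab.
- by rewrite mul0r /fr floor0 subr0.
- by move=> n; apply: fr_itv.
- exact/fr_inj/rindep_irrational/ba.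
- by move=> n; apply: fr_itv.
- by move=> u u' v v'; apply: fr_dense ab.
Qed.

(** The sets coded by four reals are exactly the finite sets, by [coded_exists] and
    [coded_finite]. *)
Lemma df_exS (C : context R) (P : C -> (nat -> Prop) -> Prop) :
  df (fun x : ctxR (ctxR (ctxR (ctxR C))) => P x.1.1.1.1 (code x.1.1.1.2 x.1.1.2 x.1.2 x.2)) ->
  df (fun x => exists s : seq nat, P x (fun k => k \in s)).
Proof.
move=> H.
have dP := df_exR (P := fun x c => exists u d N, P x (code c u d N))
  (df_exR (P := fun (x : ctxR C) u => exists d N, P x.1 (code x.2 u d N))
  (df_exR (P := fun (x : ctxR (ctxR C)) d => exists N, P x.1.1 (code x.1.2 x.2 d N))
  (df_exR (P := fun (x : ctxR (ctxR (ctxR C))) N => P x.1.1.1 (code x.1.1.2 x.1.2 x.2 N)) H))).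
apply: df_ext dP => x; split=> [[c [u [d [N Pc]]]]|[s Ps]].
  have [s Hs] := coded_finite (fun n : nat => fr (n%:R * al)) (fun n => fr (n%:R * be)) c u d N.
  exists s; rewrite (_ : (fun k => _) = code c u d N) //.
  by apply: funext => k; apply: propext; rewrite Hs.
have [c [u [d [N Hc]]]] := code_exists s; exists c, u, d, N.
rewrite (_ : code c u d N = fun k => k \in s) //.
by apply: funext => k; apply: propext; rewrite Hc.
Qed.

Ltac df_extra ::= lazymatch goal with
  | |- df (fun x => coded _ _ _ _ _ _ _) => apply: df_coded; fd_auto
  end.

(** A multiple of f is an element of a finite set in which every nonzero member has a smaller member
    at distance f; descent must end at 0. *)
Lemma df_dvd (C : context R) (f g : C -> nat) : fn f -> fn g -> df (fun x => (f x %| g x)%N).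
Proof.
move=> hf hg.
pose P x (s : nat -> Prop) := s (g x) /\ forall z, s z ->
  z = 0%N \/ exists w, s w /\ ((w < z)%N /\ z = (w + f x)%N).
have dP : df (fun x => exists s : seq nat, P x (fun k => k \in s)).
  by apply: df_exS; rewrite /P; df_auto.
apply: df_ext dP => x; split=> [[s [gs Hs]]|/dvdnP [k gE]].
  elim/ltn_ind: (g x) gs => z IH /Hs [->|[w [ws [wz zE]]]]; first exact: dvdn0.
  by rewrite zE dvdn_addl // IH.
exists [seq (j * f x)%N | j <- iota 0 k.+1]; split.
  by apply/mapP; exists k => //; rewrite mem_iota ltnS leqnn.
move=> _ /mapP [[|j] jk ->]; first by left.
have [->|f0] := posnP (f x); first by left; rewrite muln0.
right; exists (j * f x)%N; split; last by lia.
by apply/mapP; exists j => //; move: jk; rewrite !mem_iota; lia.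
Qed.

Ltac df_extra ::= lazymatch goal with
  | |- df (fun x => coded _ _ _ _ _ _ _) => apply: df_coded; fd_auto
  | |- df (fun x => is_true (_ %| _)%N) => apply: df_dvd; fd_auto
  end.

(** Consecutive numbers are coprime, so their product is their least common multiple, and it is
    determined by its multiples. *)
Lemma fn_pronic (C : context R) (f : C -> nat) : fn f -> fn (fun x => f x * (f x).+1)%N.
Proof.
move=> hf; apply: (fn_graph hK) => C' pi s; have {}hf := fd_pull s hf.
have dP : df (fun x : ctxN C' => forall w, ((f (pi x.1) %| w)%N /\ ((f (pi x.1)).+1 %| w)%N) <->
  (x.2 %| w)%N) by df_auto.
apply: df_ext dP => -[x n] /=; split=> [H|-> w]; last first.
  by rewrite Gauss_dvd ?coprimenS //; split=> /andP.
apply/eqP; rewrite eqn_dvd; apply/andP; split.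
  by apply/H; rewrite dvdn_mulr // dvdn_mull.
by rewrite Gauss_dvd ?coprimenS //; apply/andP/H.
Qed.

Ltac fd_extra ::= lazymatch goal with
  | |- fn (fun x => (_ * _.+1)%N) => apply: fn_pronic
  end.

(** Built from sums and n (n + 1) only. It is injective because i is smaller than the gap 2 (i + j +
    1) between consecutive values of n (n + 1). *)
Definition pairing (i j : nat) := ((i + j) * (i + j).+1 + i)%N.

Lemma pairing_inj i j i' j' : pairing i j = pairing i' j' -> i = i' /\ j = j'.
Proof.
rewrite /pairing => E; have [H|H|H] := ltngtP (i + j)%N (i' + j')%N.
- by exfalso; nia.
- by exfalso; nia.
- by rewrite H in E; lia.
Qed.

Lemma fn_pairing (C : context R) (f g : C -> nat) : fn f -> fn g -> fn (fun x => pairing (f x) (g x)).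
Proof. by move=> hf hg; rewrite /pairing; fd_auto. Qed.

Ltac fd_extra ::= lazymatch goal with
  | |- fn (fun x => pairing _ _) => apply: fn_pairing
  | |- fn (fun x => (_ * _.+1)%N) => apply: fn_pronic
  end.

Definition fn_rec k (h : k.-tuple nat -> nat) := forall (C : context R) (v : C -> k.-tuple nat),
  (forall i, fn (fun x => tnth (v x) i)) -> fn (fun x => h (v x)).

(** Induction on the construction of h. Minimisation is directly first-order, and primitive
    recursion is witnessed by a finite set of computation steps. *)
Lemma recursive_fn k (h : k.-tuple nat -> nat) : recursive h -> fn_rec h.
Proof.
have fn_cons (C : context R) n (f : C -> nat) (v : C -> n.-tuple nat) : fn f ->
    (forall i, fn (fun x => tnth (v x) i)) ->
    forall i, fn (fun x => tnth [tuple of f x :: v x] i).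
  move=> hf hv i; case: (unliftP ord0 i) => [j|] ->.
    by apply: fd_ext (hv j) => x; rewrite tnthS.
  by apply: fd_ext hf => x; rewrite tnth0.
elim=> {k h} [k h hE|h hE|k i h hE|k m f g h _ IHf _ IHg hE|k f g h _ IHf _ IHg h0 hS|k f h _ IHf h0 hmin] C v hv.
- by apply: fd_ext (fn_const hK C 0) => x; rewrite hE.
- by apply: fd_ext (fn_succ (hv ord0)) => x; rewrite hE.
- by apply: fd_ext (hv i) => x; rewrite hE.
- apply: (@fd_ext _ _ _ (fun x => (f [tuple g i (v x) | i < m])%:R)) => [x|]; first by rewrite hE.
  apply: IHf => i; apply: fd_ext (IHg i _ _ hv) => x; by rewrite tnth_mktuple.
- apply: (fn_graph hK) => C' pi s.
  have {}hv i := fd_pull s (hv i).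
  pose n x := tnth (v x) ord0; pose w x := [tuple of behead (v x)].
  have vE x : v x = [tuple of n x :: w x].
    by apply: eq_from_tnth => i; rewrite -tuple_eta.
  have hn : fn (fun x => n (pi x)) by exact: hv.
  have hw i : fn (fun x => tnth (w (pi x)) i).
    by apply: fd_ext (hv (lift ord0 i)) => x; rewrite vE tnthS.
  (* [s] contains the pair of the argument and the result, and each pair in it is an initial value
     or follows from a pair in it with smaller argument; hence every pair in it is correct. *)
  pose P x r (s : nat -> Prop) := s (pairing (n (pi x)) r) /\ forall i y, s (pairing i y) ->
    (i = 0%N /\ y = f (w (pi x))) \/
    exists i' y', i = i'.+1 /\ (s (pairing i' y') /\ y = g [tuple of i' :: y' :: w (pi x)]).
  have dP : df (fun x : ctxN C' => exists s : seq nat, P x.1 x.2 (fun k => k \in s)).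
    apply: (@df_exS (ctxN C') (fun x s => P x.1 x.2 s)); rewrite /P; apply: df_and; first df_auto.
    have hfw := IHf _ _ hw.
    do 2!apply: (df_allN hK); apply: df_imp; first df_auto; apply: df_or; first df_auto.
    do 2!apply: (df_exN hK); apply: df_and; first df_auto.
    apply: df_and; first df_auto; apply: df_eqn; first fd_auto.
    apply: (IHg _ (fun x : ctxN (ctxN (ctxN (ctxN (ctxR (ctxR (ctxR (ctxR (ctxN C')))))))) =>
      [tuple of x.1.2 :: x.2 :: w (pi x.1.1.1.1.1.1.1.1.1)])).
    apply: (fn_cons); first fd_auto; apply: (fn_cons); first fd_auto.
    by move=> i; have hwi := hw i; fd_auto.
  apply: df_ext dP => -[x r] /=; rewrite vE.
  split=> [[t [rt Ht]]|->].
    have H i y : pairing i y \in t -> y = h [tuple of i :: w (pi x)].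
      elim: i y => [|i IHi] y /Ht [[]|[i' [y' []]]] //; first by rewrite h0.
      by move=> [<-] [/IHi -> ->]; rewrite hS.
    exact: H.
  exists [seq pairing i (h [tuple of i :: w (pi x)]) | i <- iota 0 (n (pi x)).+1]; split.
    by apply/mapP; exists (n (pi x)) => //; rewrite mem_iota ltnS leqnn.
  move=> i y /mapP [j jn /pairing_inj [-> ->]]; case: j jn => [|j] jn; [left|right].
    by rewrite h0.
  exists j, (h [tuple of j :: w (pi x)]); rewrite hS; do 2!split=> //.
  by apply/mapP; exists j => //; move: jn; rewrite !mem_iota; lia.
- apply: (fn_graph hK) => C' pi s; have {}hv i := fd_pull s (hv i).
  have dP : df (fun x : ctxN C' => f [tuple of x.2 :: v (pi x.1)] = 0%N /\
      forall n, (n < x.2)%N -> ~ f [tuple of n :: v (pi x.1)] = 0%N).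
    apply: df_and.
      apply: df_eqn; last fd_auto; apply: IHf; apply: (fn_cons); first fd_auto.
      by move=> i; have hvi := hv i; fd_auto.
    apply: (df_allN hK); apply: df_imp; first df_auto; apply: df_not.
    apply: df_eqn; last fd_auto; apply: IHf; apply: (fn_cons); first fd_auto.
    by move=> i; have hvi := hv i; fd_auto.
  apply: df_ext dP => -[x n] /=; split=> [[n0 Hn]|->]; last by split=> // j; apply: hmin.
  have [nh|hn|//] := ltngtP n (h (v (pi x))); first by case: (hmin _ _ nh).
  by case: (Hn _ hn).
Qed.

End Arithmetic.

(** * Undecidability *)

Section Undecidability.
Variables (R : realType) (K : {pred R}) (hK : GRing.divring_closed K).

Local Notation S := {x : R | x \in K}.
Local Notation v0 := (Tvar S 0).
Local Notation v1 := (Tvar S 1).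
Local Notation zero := (Tscale (scal (divring0 hK)) v0).

Fixpoint numeral n : term S := if n is n'.+1 then Tadd (numeral n') v0 else zero.

Lemma numeral_val e n : term_val sval e (numeral n) = n%:R * e 0%N.
Proof. by elim: n => [|n /= ->] //; rewrite -natr1 mulrDl mul1r. Qed.

Lemma numeral_vars n : {subset term_vars (numeral n) <= [:: 0%N]}.
Proof. by elim: n => [|n IHn] //= k; rewrite mem_cat => /orP[/IHn|]. Qed.

(** The unit is definable as the least positive integer. *)
Definition is_one : formula S := Fand (Fand (Fint v0) (Flt zero v0))
  (Fnot (Fex 1 (Fand (Fint v1) (Fand (Flt zero v1) (Flt v1 v0))))).

Lemma sat_is_one e : sat sval e is_one <-> e 0%N = 1.
Proof.
rewrite /= mul0r; split=> [[[/intrP [z zE] e0] H]|->]; last first.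
  split; first by split; [exact: int_num1|exact: ltr01].
  case=> x [/intrP [z ->]].
  by rewrite ltr0z ltrz1; lia.
have z0 : 0 < z by rewrite -(ltr0z R) -zE.
have [z1|z1] := leP z 1; first by rewrite zE (_ : z = 1) //; lia.
case: H; exists 1; rewrite zE ltr1z; split; first exact: int_num1.
by rewrite ltr01 z1.
Qed.

(* The language has no constants: variable 0 holds the unit, variable 1 [n]. *)
Definition instance n (p : formula S) : formula S :=
  Fex 0 (Fand is_one (Fex 1 (Fand (Feq v1 (numeral n)) p))).

Lemma sat_instance e n p : sat sval e (instance n p) <->
  sat sval [eta [eta e with 0%N |-> 1] with 1%N |-> n%:R] p.
Proof.
rewrite /instance; split=> [[x [/sat_is_one /= -> [y]]]|H].
  by rewrite numeral_val /= mulr1 => -[->].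
exists 1; split; first exact/sat_is_one.
by exists n%:R; split; rewrite //= numeral_val /= mulr1.
Qed.

Lemma sentence_instance n p : {subset free_vars p <= [:: 0%N; 1%N]} -> sentence (instance n p).
Proof.
move=> Hp; have Hn := @numeral_vars n.
apply/nilP; case E: (free_vars _) => [//|k s].
have : k \in free_vars (instance n p) by rewrite E mem_head.
rewrite mem_filter => /andP[k0]; rewrite mem_cat => /orP[]; first by rewrite /= !inE (negPf k0).
rewrite mem_filter => /andP[k1]; rewrite mem_cat /= inE (negPf k1) /= => /orP[/Hn|/Hp];
  by rewrite !inE (negPf k0) ?(negPf k1).
Qed.

Lemma free_vars_close (p : formula S) l : free_vars (foldr (@Fex S) p l) =
  [seq k <- free_vars p | k \notin l].
Proof.
elim: l => [|k l IHl] /=; first by rewrite (eq_filter (a2 := predT)) ?filter_predT.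
by rewrite IHl -filter_predI; apply: eq_filter => j; rewrite /= inE negb_or.
Qed.

(** A defining formula may have free variables outside its context, on which its truth does not
    depend; they are bound by quantifiers without changing the meaning. *)
Lemma sat_close (P : Prop) (p : formula S) (I : (nat -> R) -> Prop) l :
  (forall e x k, k \in l -> I e -> I [eta e with k |-> x]) ->
  (forall e, I e -> sat sval e p <-> P) ->
  forall e, I e -> sat sval e (foldr (@Fex S) p l) <-> P.
Proof.
elim: l => //= k l IHl Hl Hp e Ie.
have {}IHl := IHl (fun e x j jl => Hl e x j ltac:(by rewrite inE jl orbT)) Hp.
have Ik x : I [eta e with k |-> x] by apply: Hl => //; rewrite inE eqxx.
by split=> [[x /(IHl _ (Ik x))]|HP] //; exists 0; apply/(IHl _ (Ik 0)).
Qed.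

(** The diagonal map from the code of p to the code of p at its own code; it is recursive because
    the numeral is built by iteration. *)
Lemma instance_code (c : S -> nat) : exists2 D : nat -> nat,
  recursive (fun v : 1.-tuple nat => D (tnth v ord0)) &
  forall p, D (formula_code c p) = formula_code c (instance (formula_code c p) p).
Proof.
have [_ eA _] := term_codeE c; have [eEq _ _ [_ eAnd eEx]] := formula_codeE c.
pose T n := iteri n (fun _ t => cns 1 (cns t (cns (term_code c v0) 0))) (term_code c zero).
have TE n : term_code c (numeral n) = T n by elim: n => [//|n IHn]; rewrite eA IHn.
exists (fun n => cns 5 (cns 0 (cns (cns 4 (cns (formula_code c is_one)
    (cns (cns 5 (cns 1 (cns (cns 4 (cns (cns 0 (cns (term_code c v1) (cns (T n) 0)))
    (cns n 0))) 0))) 0))) 0))); last first.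
  by move=> p; rewrite /instance eEx eAnd eEx eAnd eEq TE.
have rT : @rc 1 (fun e => T e.2).
  by apply: (rc_iter (s := fun e => cns 1 (cns e.1.2 (cns (term_code c v0) 0)))); rc_auto.
have : @rc 1 (fun e => cns 5 (cns 0 (cns (cns 4 (cns (formula_code c is_one)
    (cns (cns 5 (cns 1 (cns (cns 4 (cns (cns 0 (cns (term_code c v1) (cns (T e.2) 0)))
    (cns e.2 0))) 0))) 0))) 0))) by rc_auto.
rewrite /rc; congr recursive; apply: funext => v /=.
by rewrite (tuple_eta v).
Qed.

(** If f decides the theory, the predicate that f rejects D n is definable. At the code n of its own
    formula, the resulting sentence is true iff f rejects it, that is, iff it is not in the
    theory. *)
Lemma undecidable (al be : R) : al \in K -> be \in K -> rindep al be -> ~ decidable_theory K.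
Proof.
move=> alK beK ab [c c_inj [f rf Hf]].
have [D rD HD] := instance_code c.
have fnf := recursive_fn hK alK beK ab rf; have fnD := recursive_fn hK alK beK ab rD.
have [p Hp] : @df R K (ctxN (ctx1 R)) (fun x => f [tuple D x.2] = 0%N).
  have hD : fn K (fun x : ctxN (ctx1 R) => D x.2).
    apply: (fnD _ (fun x : ctxN (ctx1 R) => [tuple x.2])) => j.
    by apply: fd_ext (fn_var K (ctx1 R)) => x; rewrite (ord1 j).
  apply: df_eqn; last exact: fn_const.
  apply: (fnf _ (fun x : ctxN (ctx1 R) => [tuple D x.2])) => i.
  by apply: fd_ext hD => x; rewrite (ord1 i).
(* All variables other than 0, the unit, and 1, the argument, are bound, so that instances of [q]
   are sentences. *)
pose q := foldr (@Fex S) p [seq k <- free_vars p | 1 < k]%N.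
have qv : {subset free_vars q <= [:: 0%N; 1%N]}.
  move=> k; rewrite free_vars_close !mem_filter => /andP[].
  by rewrite negb_and => /orP[|/negP //]; case: k => [|[|k]].
pose n := formula_code c q.
have sq e : sat sval e (instance n q) <-> f [tuple D n] = 0%N.
  rewrite sat_instance.
  apply: (sat_close (I := @ctx_rel R (ctxN (ctx1 R)) ^~ (tt, n))).
  - by move=> e' x k; rewrite mem_filter => /andP[k1 _] [/= h0 h1]; split=> /=;
      case: k k1 => [|[|k]].
  - by move=> e' /Hp.
  - by split.
have : f [tuple D n] = 0%N <-> f [tuple D n] <> 0%N; last by tauto.
rewrite -{1}(sq (fun=> 0)) Hf; set A := ([set _ | _ in _] _).
have -> : sat sval (fun=> 0) (instance n q) <-> A.
  rewrite /A /n HD; split=> [H|].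
    exists (instance n q) => //; split; first exact: sentence_instance.
    by move=> e; apply/sq/(sq (fun=> 0)).
  by case=> r [_ Hr] /(formula_code_inj c_inj) <-.
by case: asboolP.
Qed.

End Undecidability.

Theorem theoremC (R : realType) (K : {pred R}) (hK : GRing.divring_closed K) :
  (decidable_theory K <->
     exists2 a : R, quadratic a & [set` K] = Qadjoin a) /\
  ((exists2 a : R, quadratic a & [set` K] = Qadjoin a) <->
     exists2 d : nat, (d <= 2)%N & has_degree K d).
Proof.
rewrite quadratic_rspan // has_degree_le2 //; split=> //; split.
  by have [|h|[x [y [xK yK /(undecidable hK xK yK)]]]] := degree_trichotomy hK; [left|right|].
by case=> [/rat_decidable|[a [ia /(irrational_decidable hK ia)]]].
Qed.
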